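(* For all integers $q\ge3$ the value of the constant $c(q,1)$ is given by $$c(q,1)=\zeta(\lambda(q))^{\varphi(q)/\lambda(q)}\ \Pi(q,1)\ \prod_{p\mid q}\Bigl(1-\frac1{p^{\lambda(q)}}\Bigr)^{\varphi(q)/\lambda(q)}\prod_{p\equiv1\bmod q}\Bigl(1-\frac1{p^{\lambda(q)}}\Bigr)^{\varphi(q)/\lambda(q)}$$ $$\qquad\times\prod_{b\in\mathcal{A}(q)}\ \prod_{p\equiv b\bmod q}\Bigl\{\Bigl(1-\frac1{p^{t_b}}\Bigr)^{-\varphi(q)/t_b}\Bigl(1-\frac1{p^{\lambda(q)}}\Bigr)^{\varphi(q)/\lambda(q)}\Bigr\},$$ where $$\Pi(q,1)=\prod_{\substack{\chi \bmod q\\ \chi\neq\chi_0}}L(1,\chi)^{-1},$$ $\lambda$ is the Carmichael lambda function, $t_b$ denotes the order of $b$ in the group $\mathbb{Z}_q^*$, and $\mathcal{A}(q)=\{b\in\mathbb{Z}_q^*\setminus\{1\}\colon t_b<\lambda(q)\}$.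
   Context: Throughout, $p$ denotes a prime number, $\varphi$ is the Euler totient function, $\zeta$ is the Riemann zeta function, $\gamma$ is Euler's constant, $\mathbb{Z}_q^*$ is the group of reduced residue classes modulo $q$, $\chi$ ranges over Dirichlet characters modulo $q$, $\chi_0$ is the principal character modulo $q$, and $L(s,\chi)$ is the Dirichlet $L$-function of $\chi$. The Carmichael function: if $q=2^{\alpha}p_1^{\alpha_1}\cdots p_k^{\alpha_k}$ (with $p_i$ distinct odd primes), then $\lambda(q)=\operatorname{lcm}\{\varphi(2^\alpha),\varphi(p_1^{\alpha_1}),\dots,\varphi(p_k^{\alpha_k})\}$ if $\alpha\le2$ and $\lambda(q)=\operatorname{lcm}\{2^{\alpha-2},\varphi(p_1^{\alpha_1}),\dots,\varphi(p_k^{\alpha_k})\}$ if $\alpha\ge3$; in other words, $\lambda(q)$ is the highest order of the elements of $\mathbb{Z}_q^*$. For $(q,a)=1$, the Mertens constant is $$C(q,a)=\lim_{x\to+\infty}(\log x)^{1/\varphi(q)}\prod_{\substack{p\le x\\ p\equiv a \bmod q}}\Bigl(1-\frac1p\Bigr),$$ a positive real number. The constant $c(q,a)$ is defined by $$C(q,a)^{\varphi(q)}=e^{-\gamma}\,\frac{q}{\varphi(q)}\,c(q,a);$$ equivalently (it is known that) $$c(q,a)=\prod_{p\nmid q}\Bigl(1-\frac1p\Bigr)^{\alpha(p;q,a)}=\lim_{x\to+\infty}\prod_{\substack{p\le x\\ p\nmid q}}\Bigl(1-\frac1p\Bigr)^{\alpha(p;q,a)},$$ where $\alpha(p;q,a)=\varphi(q)-1$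 if $p\equiv a\bmod q$ and $\alpha(p;q,a)=-1$ otherwise; this product converges (conditionally) when taken over primes in increasing order. *)

(* Defs.v *)
From HB Require Import structures.
From mathcomp Require Import all_boot all_order all_algebra all_fingroup.
From mathcomp Require Import all_classical all_reals all_analysis.
From mathcomp Require Import complex.

Set Implicit Arguments.
Unset Strict Implicit.
Unset Printing Implicit Defensive.

Import Order.TTheory GRing.Theory Num.Theory.
Import numFieldNormedType.Exports.

Local Open Scope classical_set_scope.
Local Open Scope ring_scope.

Definition carmichael (q : nat) : nat :=
  let a := logn 2 q in
  lcmn (if (a <= 2)%N then totient (2 ^ a) else (2 ^ (a - 2))%N)
       (\big[lcmn/1%N]_(p <- primes q | odd p) totient (p ^ logn p q)).

(* [R[i]] packed as a numClosedFieldType: the normed topology used by [lim] is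
   attached to abstract number fields and is not inferred on the bare [R[i]]. *)
Definition Cplx (R : realType) : numClosedFieldType := R[i].

Section Constants.
Variable R : realType.

Definition euler_gamma : R :=
  lim ((\sum_(1 <= k < n.+1) (k%:R : R)^-1 - ln (n%:R : R)) @[n --> \oo]).

(* Only integer arguments are needed; the series converges for [s >= 2]. *)
Definition zeta (s : nat) : R :=
  lim ((\sum_(1 <= k < n.+1) ((k%:R : R) ^+ s)^-1) @[n --> \oo]).

(* Product over the primes satisfying [P], taken in increasing order. *)
Definition prime_prod (P : pred nat) (f : nat -> R) : R :=
  lim ((\prod_(0 <= p < n | prime p && P p) f p) @[n --> \oo]).

(* In the next definitions residue classes modulo [q] are elements of ['Z_q],
   which is the ring of integers modulo [q] as soon as [1 < q]. *)
Definition mertens_partial (q : nat) (a : 'Z_q) (x : R) : R :=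
  \prod_(0 <= p < (Num.truncn x).+1 | prime p && (p%:R == a))
    (1 - (p%:R : R)^-1).

Definition mertens_C (q : nat) (a : 'Z_q) : R :=
  lim ((ln x `^ ((totient q)%:R^-1) * mertens_partial a x) @[x --> +oo]).

(* Solves [C(q,a)^phi(q) = e^(-gamma) * (q / phi(q)) * c(q,a)] for [c(q,a)]. *)
Definition mertens_c (q : nat) (a : 'Z_q) : R :=
  mertens_C a ^+ totient q /
    (expR (- euler_gamma) * (q%:R / (totient q)%:R)).

Definition dirichlet_character (q : nat) : set ('Z_q -> Cplx R) :=
  [set chi | [/\ chi 1 = 1,
                 forall x y, chi (x * y) = chi x * chi y &
                 forall x, (chi x != 0) = (x \is a GRing.unit)]].

Arguments dirichlet_character q : clear implicits.

Definition principal_character (q : nat) : 'Z_q -> Cplx R :=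
  fun x => (x \is a GRing.unit)%:R.
Arguments principal_character q : clear implicits.

(* The Dirichlet series at an integer [s >= 1]. For [s = 1] and [chi]
   non-principal it converges (conditionally, hence the ordered partial sums)
   to the value of the analytically continued L-function. *)
Definition dirichlet_L (q : nat) (s : nat) (chi : 'Z_q -> Cplx R) : Cplx R :=
  lim ((\sum_(1 <= k < n.+1) chi k%:R / (k%:R : Cplx R) ^+ s) @[n --> \oo]).

(* [\big[_/_]_(chi \in _)] is a product over a classical set; it is meaningful
   because there are finitely many Dirichlet characters modulo [q]. *)
Definition Pi1 (q : nat) : Cplx R :=
  \big[*%R/1]_(chi \in dirichlet_character q `\ principal_character q)
    (dirichlet_L 1 chi)^-1.

End Constants.

Definition low_order (q : nat) : {set {unit 'Z_q}} :=
  [set b : {unit 'Z_q} | (b != 1%g) && (#[b]%g < carmichael q)%N]%SET.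

(* Main.v *)
Require Import Defs.
From HB Require Import structures.
From mathcomp Require Import all_boot all_order all_algebra all_fingroup.
From mathcomp Require Import all_classical all_reals all_analysis.
From mathcomp Require Import complex.
From mathcomp Require Import cyclic cyclotomic separable.
From mathcomp Require Import ring lra.

(** Write [V(u)] for the sum of [- phi(q) ln (1 - 1/p)] over the primes
    [p <= e^u], [p = 1 mod q]; then [c(q,1)] is the limit of
    [exp (gamma + ln u - V(u))] up to the factor [q / phi(q)].  Let
    [V^(d) = \int e^(-d u) dV(u)].  By orthogonality of characters the Euler
    product gives, for [d > 0],
    [\prod_chi L(1 + d, chi)
       = exp (\sum_(p coprime to q) - phi(q)/t_p ln (1 - p^(-t_p (1 + d))))]
    with [t_p] the order of [p] mod [q].  The terms with [t_p = 1] are [V^(d)]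
    up to a quantity that vanishes with [d] (for [d > 0] the factor [p^-d] sits
    inside the logarithm), and those with [t_p > 1] converge absolutely at
    [d = 0].  Since [d L(1 + d, chi_0) -> phi(q)/q] and [L(1, chi) <> 0]
    otherwise, [V^(d) + ln d] has an explicit limit as [d -> 0+].  A Karamata
    type Tauberian argument, comparing [V] with the harmonic sums (whose
    asymptotic constant is [gamma]), turns this into the limit of [V(u) - ln u].
    What remains is a sum over [p] with [t_p > 1], which is regrouped by residue
    class after completing every term with [t_p = lambda(q)] to the Euler
    product of [zeta(lambda(q))]. *)

Set Implicit Arguments.
Unset Strict Implicit.
Unset Printing Implicit Defensive.

Import Order.TTheory GRing.Theory Num.Theory.
Import numFieldNormedType.Exports.

Local Open Scope ring_scope.

(** * Characters of finite abelian groups *)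

(** All the analysis stays on the real axis: [L(s, chi)] is only the sum of its series at real
    [s = 1 + d], and the limit [d -> 0+] replaces analytic continuation. Two obstacles shape the
    proof. The values [L(1, chi)] are complex while [c(q,1)] is real; complex logarithms are avoided
    by multiplying all characters together before any logarithm is taken, since the inverse Euler
    factor of the full product at [p] is the real number [(1 - p^(-t_p (1 + d)))^(phi(q)/t_p)]. And
    the way back from [V^] to [V] needs the masses to be nonnegative, together with a bound for
    [V^(d) - V^(2 d)] that controls the polynomial approximation of a step function; the comparison
    then loses a dilation [u -> k u] with [k > 1], which costs only [ln k] because [V] grows like a
    logarithm. The non-vanishing at 1 is elementary too: for real characters a sum with an unbounded
    lower bound would have a bounded upper one, for the others two zeros would outweigh the simple
    pole. *)

Section Characters.
Variable K : numClosedFieldType.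

Lemma prim_root_exists n : (0 < n)%N -> exists z : K, n.-primitive_root z.
Proof.
pose p : {poly K} := 'X^n - 1; have [r Dp] := closed_field_poly_normal p.
move=> n_gt0; rewrite (monicP _) ?monicXnsubC // scale1r in Dp.
have rn1: all n.-unity_root r by apply/allP=> z; rewrite -root_prod_XsubC -Dp.
have sz_r: (n < (size r).+1)%N.
  by rewrite -(size_prod_XsubC r id) -Dp size_XnsubC.
have [|z] := hasP (has_prim_root n_gt0 rn1 _ sz_r); last by exists z.
by rewrite -separable_prod_XsubC -Dp separable_Xn_sub_1 // pnatr_eq0 -lt0n.
Qed.

(** The minimal polynomial divides ['X^t - 1], which splits over [K] with distinct roots. *)
Lemma diagonalizable_finite_order m (A : 'M[K]_m) t :
  (0 < t)%N -> A ^+ t = 1 -> diagonalizable A.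
Proof.
move=> t0 At; case: m A At => [|m] A At; first by rewrite thinmx0; exact: diagonalizable0.
have [z zP] := prim_root_exists t0.
apply/diagonalizableP; exists [seq z ^+ i | i <- index_iota 0 t].
  rewrite map_inj_in_uniq ?iota_uniq // => i j; rewrite !mem_index_iota /= => it jt.
  by move/eqP; rewrite (eq_prim_root_expr zP) !modn_small // => /eqP.
rewrite big_map factor_Xn_sub_1 //; apply: mxminpoly_min.
by rewrite rmorphB /= rmorphXn /= horner_mx_X rmorph1 At subrr.
Qed.

Variable gT : finGroupType.
Hypothesis gTC : forall x y : gT, (x * y = y * x)%g.
Local Notation n := #|gT|.

Definition is_char (f : gT -> K) := f 1%g = 1 /\ forall x y, f (x * y)%g = f x * f y.

(** The right regular representation. Its trace is the source of the orthogonality relation in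
    [char_family]. *)
Definition translation_mx (g : gT) : 'M[K]_n :=
  \matrix_(i, j) ((enum_val i * g)%g == enum_val j)%:R.

Lemma translation_mxM g h : translation_mx g *m translation_mx h = translation_mx (g * h)%g.
Proof.
apply/matrixP => i j; rewrite !mxE (bigD1 (enum_rank (enum_val i * g)%g)) //= !mxE.
rewrite enum_rankK eqxx mul1r mulgA big1 ?addr0 // => k ne; rewrite !mxE.
case: eqP => [e|]; last by rewrite mul0r.
by case/eqP: ne; rewrite e enum_valK.
Qed.

Lemma translation_mx1 : translation_mx 1%g = 1%:M.
Proof.
by apply/matrixP => i j; rewrite !mxE mulg1 (inj_eq enum_val_inj).
Qed.

Lemma translation_mxX g k : translation_mx g ^+ k = translation_mx (g ^+ k)%g.
Proof.
elim: k => [|k IH]; first by rewrite expr0 expg0 translation_mx1.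
by rewrite exprS expgS -translation_mxM IH.
Qed.

Lemma translation_mx_tr g : \tr (translation_mx g) = (n * (g == 1%g))%:R.
Proof.
rewrite /mxtrace (eq_bigr (fun=> (g == 1%g)%:R)) => [|i _].
  by rewrite sumr_const card_ord natrM mulr_natl.
by rewrite mxE -{2}[enum_val i]mulg1 (inj_eq (mulgI _)).
Qed.

(* The translations of [gT] acting on functions commute and have finite order,
   so they are simultaneously diagonalisable; a common eigenfunction is a
   multiple of a character. *)
Lemma char_family : exists X : 'I_n -> gT -> K,
  [/\ forall i, is_char (X i), injective X,
      forall f, is_char f -> exists i, forall x, f x = X i x &
      forall g, \sum_i X i g = (n * (g == 1%g))%:R].
Proof.
have [Cs Ds] : {in [seq translation_mx g | g : gT] &, forall A B, comm_mx A B} /\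
   {in [seq translation_mx g | g : gT], forall A, diagonalizable A}.
  split=> [A B /mapP[g _ ->] /mapP[h _ ->]|A /mapP[g _ ->]].
    by rewrite /comm_mx !translation_mxM gTC.
  apply: (diagonalizable_finite_order (order_gt0 g)).
  by rewrite translation_mxX expg_order translation_mx1.
have [P Pu /allP PD] : codiagonalizable [seq translation_mx g | g : gT] by apply/codiagonalizableP.
have Pdiag g : exists D, P *m translation_mx g = diag_mx D *m P.
  have /PD /= /diagonalizable_forPex [D /simmxP] : translation_mx g \in [seq translation_mx g | g : gT].
    by apply/mapP; exists g; rewrite ?mem_enum.
  by move=> /(_ Pu) e; exists D.
pose X i g := (P *m translation_mx g *m invmx P) i i.
have XD g : P *m translation_mx g = diag_mx (\row_i X i g) *m P.
  have [D e] := Pdiag g; rewrite e; congr (diag_mx _ *m _); apply/rowP => i.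
  by rewrite !mxE /X e mulmxK // !mxE eqxx mulr1n.
(* Row [i] of [P] is a common eigenvector, so all its entries follow from the one at the identity,
   which cannot vanish because [P] is invertible. *)
have PX i g h : P i (enum_rank (h * g^-1)%g) = X i g * P i (enum_rank h).
  have /matrixP/(_ i (enum_rank h)) := XD g.
  rewrite mul_diag_mx !mxE => <-; rewrite (bigD1 (enum_rank (h * g^-1)%g)) //= !mxE.
  rewrite !enum_rankK mulgKV eqxx mulr1 big1 ?addr0 // => k ne; rewrite !mxE enum_rankK.
  case: eqP => [e|]; last by rewrite mulr0.
  by case/eqP: ne; rewrite -e mulgK enum_valK.
have P1 i : P i (enum_rank 1%g) != 0.
  apply/eqP => e; have : row i P == 0.
    apply/eqP/rowP => j; rewrite !mxE -(enum_valK j) -[enum_val j]mul1g -[enum_val j]invgK.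
    by rewrite PX e mulr0.
  move/eqP=> r0; have : row_free P by rewrite row_free_unit.
  move/row_freeP => [B PB]; have : row i (P *m B) = 0 by rewrite row_mul r0 mul0mx.
  by rewrite PB => /rowP/(_ i)/eqP; rewrite !mxE eqxx oner_eq0.
have X1 i : X i 1%g = 1.
  by rewrite /X translation_mx1 mulmx1 mulmxV // !mxE eqxx.
have XM i x y : X i (x * y)%g = X i x * X i y.
  apply: (mulIf (P1 i)); rewrite -mulrA -!PX.
  by rewrite !mul1g invMg.
have PE i g : P i (enum_rank g) = X i g^-1%g * P i (enum_rank 1%g).
  by rewrite -PX invgK mul1g.
exists X; split=> //.
(* Equal characters would make two rows of the invertible [P] proportional. *)
- move=> i j e; apply/eqP/negPn/negP => ne.
  have eR : row i P = (P i (enum_rank 1%g) / P j (enum_rank 1%g)) *: row j P.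
    apply/rowP => k; rewrite !mxE -(enum_valK k) (PE i (enum_val k)) (PE j (enum_val k)) e.
    by rewrite mulrCA divfK.
  have : row_free P by rewrite row_free_unit.
  move/row_freeP => [B PB].
  have : row i (P *m B) = (P i (enum_rank 1%g) / P j (enum_rank 1%g)) *: row j (P *m B).
    by rewrite !row_mul eR -scalemxAl.
  rewrite PB => /rowP/(_ i)/eqP; rewrite !mxE eqxx eq_sym (eq_sym j) (negbTE ne) mulr0 eq_sym.
  by rewrite oner_eq0.
- move=> f [f1 fM].
  (* The values of [f] at inverses form a common eigenvector with eigenvalues [f x]. In the basis of
     the rows of [P] it has a nonzero coordinate [i], and there [X i x] must equal [f x]. *)
  pose v : 'rV[K]_n := \row_k f (enum_val k)^-1%g.
  have [c cE] : exists c, c = v *m invmx P by exists (v *m invmx P).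
  have vE : v = c *m P by rewrite cE mulmxKV.
  have c0 : c != 0.
    apply/eqP => e; move: vE; rewrite e mul0mx => /rowP/(_ (enum_rank 1%g))/eqP.
    by rewrite !mxE enum_rankK invg1 f1 oner_eq0.
  have [i ci] : exists i, c 0 i != 0 by apply/rV0Pn.
  exists i => x.
  have : f x *: c = c *m diag_mx (\row_i X i x).
    have vx : f x *: v = v *m translation_mx x.
      apply/rowP => k; rewrite !mxE (bigD1 (enum_rank (enum_val k * x^-1)%g)) //= !mxE.
      rewrite !enum_rankK mulgKV eqxx mulr1 big1 ?addr0 => [|j ne].
        by rewrite -fM invMg invgK.
      rewrite !mxE; case: eqP => [e|]; last by rewrite mulr0.
      by case/eqP: ne; rewrite -e mulgK enum_valK.
    rewrite {1}cE scalemxAl vx vE -2!mulmxA [P *m _]mulmxA XD -mulmxA mulmxV //.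
    by rewrite mulmx1.
  by move/rowP/(_ i); rewrite mul_mx_diag !mxE [RHS]mulrC => e; exact: (mulIf ci).
(* The diagonal entries [X i g] sum to the trace, which conjugation by [P] preserves. *)
- move=> g; rewrite -translation_mx_tr.
  transitivity (\tr (P *m translation_mx g *m invmx P)); first by [].
  by rewrite mxtrace_mulC mulmxA mulVmx // mul1mx.
Qed.

Lemma is_charX f : is_char f -> forall g k, f (g ^+ k)%g = f g ^+ k.
Proof.
move=> [f1 fM] g; elim=> [|k IH]; first by rewrite expg0 expr0.
by rewrite expgS exprS fM IH.
Qed.

(** The values [X i g] are roots of unity of order dividing [t], the order of [g]. By orthogonality
    each one is taken [n / t] times, and the product of [1 - w ^+ j * z] over all of them is
    [1 - z ^+ t]. *)
Lemma prod_char_eval (X : 'I_n -> gT -> K) (g : gT) (z : K) :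
    (forall i, is_char (X i)) -> (forall g, \sum_i X i g = (n * (g == 1%g))%:R) ->
  \prod_i (1 - X i g * z) = (1 - z ^+ #[g]%g) ^+ (n %/ #[g]%g)%N.
Proof.
move=> Xc Xs; set t := #[g]%g; have t0 : (0 < t)%N := order_gt0 g.
have [w wP] := prim_root_exists t0.
have Xt i : t.-unity_root (X i g).
  by apply/unity_rootP; rewrite -is_charX // expg_order; case: (Xc i).
have ke i : {k : 'I_t | X i g = w ^+ k} by apply: (prim_rootP wP); exact/unity_rootP.
pose k i := sval (ke i).
have kP i : X i g = w ^+ (k i) by exact: (svalP (ke i)).
have tn : (t %| n)%N by rewrite -cardsT order_dvdG ?inE.
have cnt (j : 'I_t) : #|[pred i | k i == j]| = (n %/ t)%N.
  apply/eqP; rewrite -(eqn_pmul2r t0) divnK // -(eqr_nat K) natrM.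
  have wj0 : w ^+ j != 0.
    by rewrite expf_neq0 // (prim_root_eq0 wP) -lt0n.
  (* Summing the powers of [X i g / w ^+ j] over [a] detects [X i g = w ^+ j]. With the sum over [i]
     taken first only [a = 0] survives, as [g ^+ a] is not the identity for [0 < a < t]. *)
  have E : \sum_(a < t) \sum_i (X i g / w ^+ j) ^+ a = #|[pred i | k i == j]|%:R * t%:R :> K.
    rewrite exchange_big /= -(sum1_card [pred i | k i == j]) natr_sum mulr_suml [RHS]big_mkcond /=.
    apply: eq_bigr => i _; rewrite kP inE; case: eqP => [->|/eqP ne].
      rewrite mul1r (eq_bigr (fun=> 1)) ?sumr_const ?card_ord // => a _.
      by rewrite divff // expr1n.
    set u := _ / _; have u1 : u != 1.
      apply: contra ne => /eqP u1; have : w ^+ k i = w ^+ j by rewrite -[RHS]mul1r -u1 divfK.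
      by move/eqP; rewrite (eq_prim_root_expr wP) !modn_small ?ltn_ord.
    have ut : u ^+ t = 1 by rewrite expr_div_n -!exprM ![(_ * t)%N]mulnC !exprM (prim_expr_order wP) !expr1n divr1.
    have := subrX1 u t; rewrite ut subrr => /esym/eqP; rewrite mulf_eq0 subr_eq0 (negbTE u1) /=.
    by move/eqP.
  rewrite -E; apply/eqP.
  rewrite (bigD1 (Ordinal t0)) //= [X in X + _](eq_bigr (fun=> 1)); last by move=> i _; rewrite expr0.
  rewrite sumr_const card_ord big1 ?addr0 // => a a0.
  rewrite (eq_bigr (fun i => (w ^+ j) ^- a * X i (g ^+ a)%g)) => [|i _]; last first.
    by rewrite expr_div_n mulrC is_charX.
  rewrite -mulr_sumr Xs -order_dvdn gtnNdvd ?muln0 ?mulr0 //.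
  by rewrite lt0n; apply: contra a0 => /eqP e; apply/eqP/val_inj.
have -> : \prod_i (1 - X i g * z) = \prod_(j < t) \prod_(i | k i == j) (1 - w ^+ j * z).
  rewrite (partition_big k xpredT) //=; apply: eq_bigr => j _.
  by apply: eq_bigr => i /eqP e; rewrite kP e.
rewrite (eq_bigr (fun j : 'I_t => (1 - w ^+ j * z) ^+ (n %/ t))) => [|j _]; last first.
  by rewrite prodr_const cnt.
rewrite prodrXl; congr (_ ^+ _).
(* The factorisation of ['X^t - 1] is evaluated at [z^-1], so [z = 0] is treated apart. *)
have [->|z0] := eqVneq z 0.
  rewrite expr0n -[t == _]negbK -lt0n t0 /= subr0 big1 // => j _.
  by rewrite mulr0 subr0.
have := congr1 (fun p => z ^+ t * p.[z^-1]) (factor_Xn_sub_1 wP).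
rewrite hornerD hornerN hornerXn hornerC mulrBr mulr1 exprVn mulfV ?expf_neq0 // => <-.
rewrite horner_prod big_mkord.
have -> : z ^+ t = \prod_(j < t) z by rewrite prodr_const card_ord.
rewrite -big_split /=.
by apply: eq_bigr => j _; rewrite hornerXsubC mulrBr divff // mulrC.
Qed.

End Characters.

(** * The Carmichael function *)

(** The origin of the exponent [2^(alpha - 2)] for [alpha >= 3]: [b ^ 2 - 1] is four times a product
    of consecutive integers, and each further squaring gains the even factor [x + 1]. *)
Lemma odd_exp2_mod8 (b k : nat) : odd b -> (2 ^ k.+3 %| b ^ 2 ^ k.+1 - 1)%N.
Proof.
have sq1 (x : nat) : (x ^ 2 - 1 = (x - 1) * (x + 1))%N by rewrite -subn_sqr exp1n.
move=> bo; elim: k => [|k IH].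
  rewrite expn1 sq1 -[b in X in (_ %| X)%N]odd_double_half bo.
  have -> : (2 ^ 3 = 2 * (2 * 2))%N by [].
  rewrite add1n subn1 /= addn1 -doubleS -!muln2 mulnACA dvdn_pmul2r //.
  by rewrite dvdn2 oddM /= andbN.
have b0 : (0 < b ^ 2 ^ k.+1)%N by rewrite expn_gt0; case: (b) bo.
rewrite [(2 ^ k.+2)%N]expnS mulnC expnM sq1 expnS mulnC.
apply: dvdn_mul => //; rewrite dvdn2 addn1 /= oddX bo orbT //.
Qed.

(** Checked modulo each prime power dividing [q] exactly, by Euler's theorem, or by [odd_exp2_mod8]
    for [2^alpha] with [alpha >= 3]. *)
Lemma exp_carmichael (b q : nat) : (1 < q)%N -> coprime b q -> b ^ carmichael q = 1 %[mod q].
Proof.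
move=> q1 cbq; have q0 : (0 < q)%N by apply: ltnW.
have b0 : (0 < b)%N by case: b cbq => // /eqP; rewrite gcd0n => q1'; rewrite q1' in q1.
have e1 : (0 < b ^ carmichael q)%N by rewrite expn_gt0 b0.
apply/eqP; rewrite eqn_mod_dvd //; apply/dvdn_partP => // p; rewrite mem_primes => /and3P[pp _ pq].
rewrite p_part.
have cbp k : coprime b (p ^ k).
  by apply: coprimeXr; apply: coprime_dvdr cbq.
suff [m ml bm] : exists2 m, (m %| carmichael q)%N & b ^ m = 1 %[mod p ^ logn p q].
  rewrite -eqn_mod_dvd //; have /dvdnP[c ->] := ml.
  by rewrite mulnC expnM -modnXm bm modnXm exp1n.
have [p2|podd] := even_prime pp; last first.
  exists (totient (p ^ logn p q)); last exact: Euler_exp_totient.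
  rewrite /carmichael; apply: dvdn_trans (dvdn_lcmr _ _).
  rewrite big_mkcond (bigD1_seq p) /= ?primes_uniq ?mem_primes ?pp ?q0 // podd.
  exact: dvdn_lcml.
subst p; rewrite /carmichael; have [l2|] := leqP (logn 2 q) 2.
  exists (totient (2 ^ logn 2 q)); first exact: dvdn_lcml.
  exact: Euler_exp_totient.
case E : (logn 2 q) => [|[|[|k]]] // _; exists (2 ^ k.+1)%N.
  by rewrite !subSS subn0 dvdn_lcml.
have bo : odd b by rewrite -coprimen2 -[2%N]expn1.
by apply/eqP; rewrite eqn_mod_dvd ?expn_gt0 ?b0 // odd_exp2_mod8.
Qed.

Lemma carmichael_gt0 q : (0 < carmichael q)%N.
Proof.
rewrite /carmichael lcmn_gt0; apply/andP; split.
  by case: ifP => _; rewrite ?totient_gt0 expn_gt0.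
rewrite big_seq_cond; elim/big_ind: _ => // [x y x0 y0|p]; first by rewrite lcmn_gt0 x0.
by rewrite mem_primes => /andP[/and3P[pp _ _] _]; rewrite totient_gt0 expn_gt0 prime_gt0.
Qed.

(** Here [q >= 3] enters: it makes the series of [zeta(lambda(q))] and the products over primes of
    the theorem converge. *)
Lemma carmichael_ge2 q : (3 <= q)%N -> (2 <= carmichael q)%N.
Proof.
move=> q3; have q0 : (0 < q)%N by apply: leq_trans q3.
suff [m m2 ml] : exists2 m, (2 <= m)%N & (m %| carmichael q)%N.
  exact: leq_trans m2 (dvdn_leq (carmichael_gt0 q) ml).
have [/hasP[p pq po]|] := boolP (has odd (primes q)).
  exists (totient (p ^ logn p q)); last first.
    rewrite /carmichael; apply: dvdn_trans (dvdn_lcmr _ _).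
    by rewrite big_mkcond (bigD1_seq p) ?primes_uniq //= po dvdn_lcml.
  move: pq; rewrite mem_primes => /and3P[pp _ pq].
  rewrite totient_pfactor // ?logn_gt0 ?mem_primes ?pp ?q0 //.
  apply: (@leq_trans p.-1); first by have := prime_gt1 pp; case: (p) po => [|[|[|]]].
  by rewrite leq_pmulr // expn_gt0 prime_gt0.
move=> no; have qE : q = (2 ^ logn 2 q)%N.
  rewrite -p_part part_pnat_id //; apply/pnatP => // p pp pq.
  have [->//|po] := even_prime pp.
  by case/hasP: no; exists p; rewrite ?mem_primes ?pp ?q0.
rewrite /carmichael; case: leqP => l2.
  exists (totient (2 ^ logn 2 q)); last exact: dvdn_lcml.
  by move: q3 l2; rewrite {1}qE; case: (logn 2 q) => [|[|[|]]].
exists (2 ^ (logn 2 q - 2))%N; last exact: dvdn_lcml.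
by rewrite -{1}[2%N]expn1 leq_exp2l // subn_gt0.
Qed.

Lemma order_dvd_carmichael q (b : {unit 'Z_q}) : (1 < q)%N -> (#[b]%g %| carmichael q)%N.
Proof.
move=> q1; rewrite order_dvdn; apply/eqP/val_inj; rewrite FinRing.val_unitX /=.
have cb : coprime (val b) q.
  by rewrite coprime_sym -unitZpE // natr_Zp; case: (b).
rewrite -[val b]natr_Zp -natrX -Zp_nat_mod // exp_carmichael //.
by rewrite Zp_nat_mod.
Qed.

(** * A Tauberian theorem *)

Section BernoulliMean.
Variable R : realType.
Implicit Types (f : nat -> R) (x y : R).

(* The indeterminate is the success probability. *)
Fixpoint binomial_mean (N : nat) f : {poly R} :=
  if N is N'.+1 then
    'X * binomial_mean N' (fun j => f j.+1) + (1 - 'X) * binomial_mean N' f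
  else (f 0%N)%:P.

Lemma binomial_meanS N f x : (binomial_mean N.+1 f).[x] =
  x * (binomial_mean N (fun j => f j.+1)).[x] + (1 - x) * (binomial_mean N f).[x].
Proof. by rewrite /= !hornerE. Qed.

Lemma binomial_mean_at0 N f : (binomial_mean N f).[0] = f 0%N.
Proof.
elim: N f => [|N IH] f; first by rewrite /= hornerC.
by rewrite binomial_meanS mul0r add0r subr0 mul1r IH.
Qed.

Lemma binomial_mean_at1 N f : (binomial_mean N f).[1] = f N.
Proof.
elim: N f => [|N IH] f; first by rewrite /= hornerC.
by rewrite binomial_meanS subrr mul0r addr0 mul1r IH.
Qed.

Lemma ler_binomial_mean N f g x : 0 <= x <= 1 -> (forall j, f j <= g j) ->
  (binomial_mean N f).[x] <= (binomial_mean N g).[x].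
Proof.
move=> /andP[x0 x1]; elim: N f g => [|N IH] f g fg; first by rewrite /= !hornerC.
rewrite !binomial_meanS lerD //; apply: ler_wpM2l; rewrite ?subr_ge0 //; exact: IH.
Qed.

Lemma binomial_mean_cst N c x : (binomial_mean N (fun=> c)).[x] = c.
Proof.
elim: N => [|N IH]; first by rewrite /= hornerC.
by rewrite binomial_meanS IH; ring.
Qed.

Lemma binomial_meanBl N f c x :
  (binomial_mean N (fun j => c - f j)).[x] = c - (binomial_mean N f).[x].
Proof.
elim: N f => [|N IH] f; first by rewrite /= !hornerC.
by rewrite !binomial_meanS !IH; ring.
Qed.

(** Squared bias plus variance; at [y = N x] only the variance is left, as Chebyshev's inequality
    requires. *)
Lemma binomial_mean_sqr N x y c :
  (binomial_mean N (fun j => c * (j%:R - y) ^+ 2)).[x] =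
  c * ((N%:R * x - y) ^+ 2 + N%:R * x * (1 - x)).
Proof.
elim: N y => [|N IH] y; first by rewrite /= hornerC; ring.
rewrite binomial_meanS IH.
have -> : (fun j => c * (j.+1%:R - y) ^+ 2) = (fun j => c * (j%:R - (y - 1)) ^+ 2).
  by apply/funext => j; rewrite -(natr1 j); congr (c * _ ^+ 2); ring.
by rewrite IH -(natr1 N); ring.
Qed.

(* Bernstein approximation of the step function jumping in [t1, t2]: by
   Chebyshev's inequality the error is at most a multiple of the variance
   [x (1 - x)], which integrates to the bounded quantity [L d - L (2 * d)] in
   [laplace_poly_bounds]. *)
Lemma step_poly (t1 t2 e : R) : 0 < t1 -> t1 < t2 -> t2 < 1 -> 0 < e ->
  exists p : {poly R}, [/\ p`_0 = 0, p.[1] = 1,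
    forall x, 0 <= x <= 1 -> 0 <= p.[x] <= 1,
    forall x, t2 <= x <= 1 -> 1 <= p.[x] + e * (x * (1 - x)) &
    forall x, 0 <= x <= t1 -> p.[x] <= e * (x * (1 - x))].
Proof.
move=> t10 t12 t21 e0.
have [t [h [t0 t1' h0 tE1 tE2]]] :
    exists t h : R, [/\ 0 < t, t <= 1, 0 < h, t1 = t - h & t2 = t + h].
  by exists ((t1 + t2) / 2), ((t2 - t1) / 2); split; lra.
(* Chebyshev's bound will be [x (1 - x) / (N h^2)]; this [N] brings its coefficient below [e]. *)
have [N N0 NE] : exists2 N : nat, (0 : R) < N%:R & 1 / (N%:R * h ^+ 2) <= e.
  exists (Num.truncn (1 / (e * h ^+ 2))).+1; first by rewrite ltr0n.
  rewrite ler_pdivrMr ?mulr_gt0 ?exprn_gt0 // ?ltr0n //.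
  have := ltW (truncnS_gt (1 / (e * h ^+ 2))).
  rewrite ler_pdivrMr ?mulr_gt0 ?exprn_gt0 // => H.
  by rewrite (le_trans H) //; lra.
(* With the jump at the midpoint [t], an index [j] on the wrong side of [N t] lies at distance at
   least [N h] from [N x], so the error is dominated by the quadratic function in [key]. *)
pose f j : R := (N%:R * t <= j%:R)%R%:R.
have f01 j : 0 <= f j <= 1 by rewrite /f ler0n lern1; case: (_ <= _).
have key x : 0 <= x <= 1 ->
    (binomial_mean N (fun j => (1 / (N%:R * h) ^+ 2) * (j%:R - N%:R * x) ^+ 2)).[x] <= e * (x * (1 - x)).
  move=> /andP[x0 x1]; rewrite binomial_mean_sqr subrr expr0n /= add0r.
  have -> : 1 / (N%:R * h) ^+ 2 * (N%:R * x * (1 - x)) = 1 / (N%:R * h ^+ 2) * (x * (1 - x)).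
    by field; rewrite !lt0r_neq0.
  by apply: ler_wpM2r => //; rewrite mulr_ge0 // subr_ge0.
exists (binomial_mean N f); split.
- rewrite -horner_coef0 binomial_mean_at0 /f /=.
  by rewrite leNgt mulr_gt0.
- rewrite binomial_mean_at1 /f /=.
  by rewrite ler_piMr ?ler0n.
- move=> x x01; have := ler_binomial_mean N x01 (fun j => (andP (f01 j)).1).
  have := ler_binomial_mean N x01 (fun j => (andP (f01 j)).2).
  by rewrite !binomial_mean_cst => -> ->.
- move=> x /andP[xt x1]; have x01 : 0 <= x <= 1 by rewrite x1 andbT; lra.
  rewrite -lerBlDl -binomial_meanBl (le_trans _ (key x x01)) //.
  apply: ler_binomial_mean => // j; rewrite /f; case: (leP (N%:R * t)) => [_|jN] /=.
    by rewrite mulr1n subrr mulr_ge0 ?sqr_ge0 // divr_ge0 // exprn_ge0 // mulr_ge0 // ltW.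
  rewrite mulr0n subr0 mulrC mulrA mulr1 ler_pdivlMr ?exprn_gt0 ?mulr_gt0 // mul1r -(sqrrN (j%:R - _)) opprB.
  have Nh0 : 0 < N%:R * h by rewrite mulr_gt0.
  have : N%:R * (t + h) <= N%:R * x by rewrite ler_wpM2l ?ler0n // -tE2.
  move=> H; apply: lerXn2r; rewrite ?nnegrE; lra.
- move=> x /andP[x0 xt]; have x01 : 0 <= x <= 1 by rewrite x0; lra.
  rewrite (le_trans _ (key x x01)) //.
  apply: ler_binomial_mean => // j; rewrite /f; case: (leP (N%:R * t)) => [jN|_] /=; last first.
    by rewrite mulr0n mulr_ge0 ?sqr_ge0 // divr_ge0 // exprn_ge0 // mulr_ge0 // ltW.
  rewrite mulr1n mulrC mulrA mulr1 ler_pdivlMr ?exprn_gt0 ?mulr_gt0 // mul1r.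
  have Nh0 : 0 < N%:R * h by rewrite mulr_gt0.
  have : N%:R * x <= N%:R * (t - h) by rewrite ler_wpM2l ?ler0n // -tE1.
  move=> H; apply: lerXn2r; rewrite ?nnegrE; lra.
Qed.

End BernoulliMean.

Local Open Scope classical_set_scope.

Lemma cvg_mull_right0 (R : realType) (k : R) : 0 < k -> k * d @[d --> 0^'+] --> 0^'+.
Proof.
move=> k0 A [r /= r0 rA]; exists (r / k) => /=; first by rewrite divr_gt0.
move=> x /=; rewrite sub0r normrN => xr x0; apply: rA => /=; last by rewrite mulr_gt0.
by rewrite sub0r normrN normrM (gtr0_norm k0) mulrC -ltr_pdivlMr.
Qed.

Lemma cvg_div1_pinfty (R : realType) : 1 / u @[u --> +oo] --> (0 : R)^'+.
Proof.
move=> A [r /= r0 rA]; exists (1 / r); split; first exact: num_real.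
move=> x /= xr; have x0 : 0 < x by rewrite (lt_trans _ xr) // divr_gt0.
apply: rA => /=; last by rewrite divr_gt0.
rewrite sub0r normrN gtr0_norm ?divr_gt0 // ltr_pdivrMr // mulrC.
by rewrite -ltr_pdivrMr.
Qed.

(** * Laplace transforms and the comparison of two measures *)

Section Tauberian.
Variable R : realType.
Implicit Types (a lam : nat -> R) (V L : R -> R).

(* [V] is the cumulative function of the measure with masses [a n] at [lam n],
   and [L] is its Laplace transform. *)
Definition laplace_pair a lam V L :=
  [/\ forall n, 0 <= a n, forall n, 0 <= lam n,
      forall u, \forall M \near \oo, \sum_(0 <= n < M | lam n <= u) a n = V u &
      forall d, 0 < d ->
        (\sum_(0 <= n < M) a n * expR (- (d * lam n))) @[M --> \oo] --> L d].

(** The monomial [x^k] at [x = exp (- d lam)] integrates to [L (k d)]. A constant term would call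
    for [L 0], on which [laplace_pair] says nothing; hence the vanishing constant coefficient. *)
Lemma laplace_poly a lam V L (p : {poly R}) (d : R) : laplace_pair a lam V L -> p`_0 = 0 -> 0 < d ->
  (\sum_(0 <= n < M) a n * p.[expR (- (d * lam n))]) @[M --> \oo] -->
  \sum_(0 <= k < size p) p`_k * L (k%:R * d).
Proof.
move=> [_ _ _ H] p0 d0.
have -> : (fun M => \sum_(0 <= n < M) a n * p.[expR (- (d * lam n))]) =
  (fun M => \sum_(0 <= k < size p) p`_k * \sum_(0 <= n < M) a n * expR (- (k%:R * d * lam n))).
  apply/funext => M; under [RHS]eq_bigr do rewrite mulr_sumr.
  rewrite exchange_big /=; apply: eq_bigr => n _.
  rewrite horner_coef mulr_sumr big_mkord; apply: eq_bigr => k _.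
  by rewrite -expRM_natl mulrN -mulrA mulrCA.
elim: (size p) => [|n IH]; first by rewrite big_nil; under eq_cvg do rewrite big_nil; exact: cvg_cst.
rewrite big_nat_recr //=; under eq_cvg do rewrite big_nat_recr //=.
apply: cvgD => //; case: n {IH} => [|n].
  by rewrite p0 !mul0r; under eq_cvg do rewrite mul0r; exact: cvg_cst.
by apply: cvgMl_tmp; [ exact: (H _ (mulr_gt0 (ltr0Sn R n) d0))].
Qed.

(* [P] and [L d - L (2 * d)] are the integrals of [p.[x]] and [x (1 - x)] at
   [x = exp (- d * lam)]. *)
Lemma laplace_poly_bounds a lam V L (p : {poly R}) (e s1 s2 d : R) :
    laplace_pair a lam V L -> p`_0 = 0 -> 0 < d -> 0 <= e ->
    (forall x, 0 <= x <= 1 -> 0 <= p.[x] <= 1) ->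
    (forall x, expR (- s2) <= x <= 1 -> 1 <= p.[x] + e * (x * (1 - x))) ->
    (forall x, 0 <= x <= expR (- s1) -> p.[x] <= e * (x * (1 - x))) ->
  let P := \sum_(0 <= k < size p) p`_k * L (k%:R * d) in
  let E := e * (L d - L (2 * d)) in
  V (s2 / d) <= P + E /\ P <= V (s1 / d) + E.
Proof.
move=> LP p0 d0 e0 p01 phi plo P E.
have [a0 lam0 HV HL] := LP.
pose x n := expR (- (d * lam n)).
have x01 n : 0 <= x n <= 1 by rewrite expR_ge0 expR_le1 oppr_le0 mulr_ge0 // ltW.
have cP := laplace_poly LP p0 d0.
have cE : (\sum_(0 <= n < M) a n * (e * (x n * (1 - x n)))) @[M --> \oo] --> E.
  have -> : (fun M => \sum_(0 <= n < M) a n * (e * (x n * (1 - x n)))) =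
     (fun M => e * (\sum_(0 <= n < M) a n * expR (- (d * lam n)) -
           \sum_(0 <= n < M) a n * expR (- (2 * d * lam n)))).
    apply/funext => M; rewrite -sumrB mulr_sumr; apply: eq_bigr => n _.
    by rewrite -mulrA -[- (2 * _)]mulrN expRM_natl -/(x n); ring.
  by apply: cvgMl_tmp; [ apply: cvgB; apply: HL; rewrite // mulr_gt0].
split.
- apply: (cvgr_to_ge (cvgD cP cE)).
  near=> M.
  have <- : \sum_(0 <= n < M | lam n <= s2 / d) a n = V (s2 / d) by near: M; exact: HV.
  rewrite fctE /= -big_split /= big_mkcond /=; apply: ler_sum => n _; rewrite -mulrDr -/(x n).
  have /andP[x0 x1] := x01 n; have /andP[q0 q1] := p01 _ (x01 n).
  case: ifPn => [ln|_].
    rewrite ler_peMr //; apply: phi; rewrite x1 andbT ler_expR lerN2.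
    by rewrite mulrC -ler_pdivlMr.
  by rewrite mulr_ge0 // addr_ge0 // mulr_ge0 // mulr_ge0 // subr_ge0.
- rewrite -lerBlDr; apply: (cvgr_to_le (cvgB cP cE)).
  near=> M.
  have <- : \sum_(0 <= n < M | lam n <= s1 / d) a n = V (s1 / d) by near: M; exact: HV.
  rewrite !fctE /= lerBlDr [in leRHS]big_mkcond -big_split /=; apply: ler_sum => n _; rewrite -/(x n).
  have /andP[x0 x1] := x01 n; have /andP[q0 q1] := p01 _ (x01 n).
  case: ifPn; rewrite -?ltNge => ln.
    rewrite -[X in _ <= X + _]mulr1 -mulrDr; apply: ler_wpM2l => //; rewrite (le_trans q1) // lerDl.
    by rewrite mulr_ge0 // mulr_ge0 // subr_ge0.
  rewrite add0r ler_wpM2l //; apply: plo; rewrite x0 /= ler_expR lerN2.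
  by rewrite mulrC -ler_pdivrMr // ltW.
Unshelve. all: by end_near. Qed.

(** [V1 (1 / d)] and [V2 (k / d)] are compared with the two integrals of one polynomial, close to a
    step that jumps between [exp (- k)] and [exp (- 1)]; the dilation [k > 1] is the room for the
    jump. The integrals differ by a combination of the [L1 (j d) - L2 (j d)], which tends to [c],
    and [B] controls the approximation errors. *)
Lemma tauberian_half a1 lam1 V1 L1 a2 lam2 V2 L2 (c B : R) :
    laplace_pair a1 lam1 V1 L1 -> laplace_pair a2 lam2 V2 L2 ->
    (\forall d \near 0^'+, L1 d - L1 (2 * d) <= B) ->
    (\forall d \near 0^'+, L2 d - L2 (2 * d) <= B) ->
    (L1 d - L2 d) @[d --> 0^'+] --> c ->
  forall k e : R, 1 < k -> 0 < e ->
    \forall u \near +oo, V1 u <= V2 (k * u) + c + e.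
Proof.
move=> LP1 LP2 B1 B2 Dc k e k1 e0.
have B0 : 0 < `|B| + 1 by rewrite ltr_wpDl.
(* Each of the two approximation errors is then at most [e / 3]; the last third is spent on the
   limit [cS]. *)
pose e' := e / 3 / (`|B| + 1).
have e'0 : 0 < e' by rewrite !divr_gt0.
have [p [p0 p1 p01 phi plo]] : exists p : {poly R}, [/\ p`_0 = 0, p.[1] = 1,
    forall x, 0 <= x <= 1 -> 0 <= p.[x] <= 1,
    forall x, expR (- 1) <= x <= 1 -> 1 <= p.[x] + e' * (x * (1 - x)) &
    forall x, 0 <= x <= expR (- k) -> p.[x] <= e' * (x * (1 - x))].
  by apply: step_poly => //; rewrite ?expR_gt0 ?ltr_expR ?ltrN2 ?expR_lt1 ?oppr_lt0.
have cS : (\sum_(0 <= j < size p) p`_j * (L1 (j%:R * d) - L2 (j%:R * d))) @[d --> 0^'+] --> c.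
  (* The coefficients of [p] sum to [p.[1] = 1]. *)
  have -> : c = \sum_(0 <= j < size p) p`_j * c.
    by rewrite -mulr_suml big_mkord -[LHS]mul1r -p1 horner_coef; congr (_ * _); apply: eq_bigr => i _; rewrite expr1n mulr1.
  elim: (size p) => [|n IH]; first by rewrite big_nil; under eq_cvg do rewrite big_nil; exact: cvg_cst.
  rewrite big_nat_recr //=; under eq_cvg do rewrite big_nat_recr //=.
  apply: cvgD => //; case: n {IH} => [|n].
    by rewrite p0 !mul0r; under eq_cvg do rewrite mul0r; exact: cvg_cst.
  apply: cvgMl_tmp.
  have sc := @cvg_mull_right0 R n.+1%:R (ltr0Sn R n).
  exact: (cvg_comp _ _ sc Dc).
have nearS : \forall d \near 0^'+, \sum_(0 <= j < size p) p`_j * (L1 (j%:R * d) - L2 (j%:R * d)) <= c + e / 3.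
  have e3 : 0 < e / 3 by rewrite divr_gt0.
  move/cvgrPdist_le: cS => /(_ _ e3); apply: filterS => d.
  by rewrite ler_norml => /andP[]; lra.
have main : \forall d \near 0^'+, V1 (1 / d) <= V2 (k * (1 / d)) + c + e.
  near=> d.
  have d0 : 0 < d by near: d; exact: nbhs_right_gt.
  have /= [h1 _] := laplace_poly_bounds LP1 p0 d0 (ltW e'0) p01 phi plo.
  have /= [_ h2] := laplace_poly_bounds LP2 p0 d0 (ltW e'0) p01 phi plo.
  have : \sum_(0 <= j < size p) p`_j * (L1 (j%:R * d) - L2 (j%:R * d)) <= c + e / 3 by near: d.
  under eq_bigr do rewrite mulrBr; rewrite sumrB => h3.
  have eB x : x <= B -> e' * x <= e / 3.
    move=> xB; rewrite /e' mulrAC ler_pdivrMr //; apply: ler_wpM2l; first by rewrite ltW // divr_gt0.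
    by rewrite (le_trans xB) // (le_trans (ler_norm _)) // lerDl.
  have h4 : e' * (L1 d - L1 (2 * d)) <= e / 3 by apply: eB; near: d.
  have h5 : e' * (L2 d - L2 (2 * d)) <= e / 3 by apply: eB; near: d.
  by move: h1; rewrite div1r; lra.
near=> u.
have : V1 (1 / (1 / u)) <= V2 (k * (1 / (1 / u))) + c + e by near: u; exact: (@cvg_div1_pinfty R _ main).
by rewrite !div1r invrK.
Unshelve. all: by end_near. Qed.

End Tauberian.

(** * The logarithm series and Euler's constant *)

Section Logarithm.
Variable R : realType.
Implicit Types x : R.

(** The term of index [0] vanishes because [0^-1 = 0]; the derivative is the geometric remainder
    [- 1 / (1 - x) + (1 + ... + x^(M - 1))]. *)
Lemma is_derive_ln1B_series M x : x < 1 ->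
  is_derive x 1 (fun y => ln (1 - y) + \sum_(0 <= n < M.+1) y ^+ n / n%:R) (- (x ^+ M / (1 - x))).
Proof.
move=> x1; have y0 : 0 < 1 - x by rewrite subr_gt0.
elim: M => [|M IH].
  have -> : (fun y : R => ln (1 - y) + \sum_(0 <= n < 1) y ^+ n / n%:R) = (@ln R) \o (fun y => 1 - y).
    by apply/funext => y /=; rewrite big_nat1 invr0 mulr0 addr0.
  rewrite expr0 div1r -[- _]mulrN1.
  have D1 := is_derive1_ln y0.
  have D2 : is_derive x 1 (fun y : R => 1 - y) (-1).
    by apply: is_derive_eq; ring.
  exact: (@is_derive1_comp R (@ln R) (fun y : R => 1 - y) x _ _ D1 D2).
have -> : (fun y : R => ln (1 - y) + \sum_(0 <= n < M.+2) y ^+ n / n%:R) =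
   (fun y : R => ln (1 - y) + \sum_(0 <= n < M.+1) y ^+ n / n%:R) + M.+1%:R^-1 *: (@id R ^+ M.+1).
  by apply/funext => y; rewrite !fctE big_nat_recr //= addrA [_ / M.+1%:R]mulrC.
have D2 : is_derive x 1 (M.+1%:R^-1 *: (@id R ^+ M.+1)) (x ^+ M).
  apply: is_derive_eq; rewrite /= /GRing.scale /= mulr1 mulrA mulVf ?mul1r //.
apply: is_derive_eq; rewrite exprS.
by field; rewrite lt0r_neq0.
Qed.

Lemma ln1B_series_bound M x : 0 <= x < 1 ->
  `| - ln (1 - x) - \sum_(0 <= n < M.+1) x ^+ n / n%:R| <= x ^+ M / (1 - x).
Proof.
move=> /andP[x0 x1].
pose f (y : R) := ln (1 - y) + \sum_(0 <= n < M.+1) y ^+ n / n%:R.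
have f0 : f 0 = 0.
  rewrite /f subr0 ln1 add0r big_nat_recl // invr0 mulr0 add0r big1 // => i _.
  by rewrite expr0n mul0r.
have [||y] := @MVT_segment R f (fun y => - (y ^+ M / (1 - y))) 0 x x0.
- by move=> y; rewrite in_itv /= => /andP[_ yx]; apply: is_derive_ln1B_series; apply: lt_trans x1.
- apply: derivable_within_continuous => y; rewrite in_itv /= => /andP[_ yx].
  by have [] := is_derive_ln1B_series M (le_lt_trans yx x1).
rewrite in_itv /= => /andP[y0 yx]; rewrite f0 !subr0 => fx.
rewrite -opprD normrN -/(f x) fx mulNr normrN.
have y1 : 0 < 1 - y by lra.
have x1' : 0 < 1 - x by lra.
rewrite ger0_norm; last by rewrite mulr_ge0 // divr_ge0 ?exprn_ge0 // ltW.
rewrite -[leRHS]mulr1; apply: ler_pM => //; last exact: ltW.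
  by rewrite divr_ge0 ?exprn_ge0 // ltW.
apply: ler_pM; [by rewrite exprn_ge0 | by rewrite invr_ge0 ltW | |].
  by apply: lerXn2r; rewrite ?nnegrE.
by rewrite lef_pV2 ?posrE //; lra.
Qed.

Lemma cvg_ln1B_series x : 0 <= x < 1 ->
  (\sum_(0 <= n < M) x ^+ n / n%:R) @[M --> \oo] --> - ln (1 - x).
Proof.
move=> x01; rewrite -cvg_shiftS.
apply/cvgrPdist_le => e e0; have /andP[x0 x1] := x01.
have cX : x ^+ M / (1 - x) @[M --> \oo] --> (0 : R).
  rewrite -[X in _ --> X](mul0r (1 - x)^-1); apply: cvgMr_tmp; apply: cvg_expr.
  by rewrite ger0_norm.
have /cvgrPdist_le /(_ _ e0) := cX; apply: filterS => M.
rewrite sub0r normrN => xe; apply: le_trans (le_trans (ler_norm _) xe).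
exact: ln1B_series_bound.
Qed.

Lemma ln_succ_bounds n : (0 < n)%N ->
  (n.+1%:R)^-1 <= ln n.+1%:R - ln n%:R :> R /\ ln n.+1%:R - ln n%:R <= (n%:R)^-1 :> R.
Proof.
move=> n0; have p0 : 0 < n%:R :> R by rewrite ltr0n.
have p1 : 0 < n.+1%:R :> R by rewrite ltr0n.
split.
  rewrite -lerN2 opprB -ln_div ?posrE //.
  have -> : n%:R / n.+1%:R = 1 + - n.+1%:R^-1 :> R by rewrite -(natr1 n); field; rewrite natr1 lt0r_neq0.
  by apply: le_ln1Dx; rewrite ltrN2 invf_lt1 // ltr1n.
rewrite -ln_div ?posrE //.
have -> : n.+1%:R / n%:R = 1 + n%:R^-1 :> R by rewrite -(natr1 n); field; rewrite lt0r_neq0.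
by apply: le_ln1Dx; rewrite (lt_trans (ltrN10 _)) ?invr_gt0.
Qed.

Lemma cvg_euler_gamma :
  (\sum_(1 <= k < n.+1) (k%:R : R)^-1 - ln (n%:R : R)) @[n --> \oo] --> euler_gamma R.
Proof.
pose g n : R := \sum_(1 <= k < n.+1) (k%:R)^-1 - ln n%:R.
have gS n : (0 < n)%N -> g n.+1 <= g n.
  move=> n0; rewrite /g big_nat_recr //=.
  by have [h _] := ln_succ_bounds n0; rewrite -addrA lerD2l lerBlDr addrC.
have g0 n : (0 < n)%N -> 0 <= g n.
  move=> n0; rewrite /g subr_ge0.
  have : ln n.+1%:R <= \sum_(1 <= k < n.+1) k%:R^-1 :> R.
    elim: n {n0} => [|n IH]; first by rewrite big_geq // ln1.
    rewrite big_nat_recr //=; have [_ h] := ln_succ_bounds (ltn0Sn n).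
    by have := lerD h IH; rewrite subrK addrC.
  by apply: le_trans; rewrite ler_ln ?posrE ?ltr0n // ler_nat.
(* The shift drops the index [0]: with [ln 0 = 0] one has [g 0 = 0 < g 1], and [g] decreases only
   from [1] on. *)
have cS : cvgn (fun n => g n.+1).
  apply: nonincreasing_is_cvgn; first by apply/nonincreasing_seqP => n; exact: gS.
  by exists 0 => _ [n _ <-]; exact: g0.
have : g @ \oo --> lim ((fun n => g n.+1) @ \oo) by rewrite -cvg_shiftS.
exact: cvgP.
Qed.

End Logarithm.

(** * Comparison with the harmonic sums *)

Section TauberianLog.
Variable R : realType.
Implicit Types (a lam : nat -> R) (V L : R -> R).

Definition harmonic_sum (u : R) : R := \sum_(0 <= n < (Num.truncn u).+1) n%:R^-1.

(** The reference measure has mass [1 / n] at [n], and none at [0] because [0^-1 = 0]. Its transform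
    is the power series of [- ln (1 - x)] at [x = exp (- d)]. *)
Lemma harmonic_laplace_pair :
  laplace_pair (fun n => n%:R^-1 : R) (fun n => n%:R) harmonic_sum (fun d => - ln (1 - expR (- d))).
Proof.
split=> [n|n|u|d d0]; rewrite ?invr_ge0 ?ler0n //.
  exists (Num.truncn u).+1 => // M /= uM.
  rewrite /harmonic_sum (big_nat_widen _ _ M xpredT) // big_mkcond; apply: etrans (esym (big_mkcond _ _)).
  apply: eq_bigr => -[|n] _ /=; first by rewrite invr0 !if_same.
  by rewrite ltnS ltnNge truncn_le_nat -leNgt.
have x01 : 0 <= expR (- d) < 1 by rewrite expR_ge0 expR_lt1 oppr_lt0.
have -> : (fun M => \sum_(0 <= n < M) n%:R^-1 * expR (- (d * n%:R))) =
  (fun M => \sum_(0 <= n < M) expR (- d) ^+ n / n%:R).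
  apply/funext => M; apply: eq_bigr => n _.
  by rewrite mulrC -expRM_natl mulrN [d * _]mulrC.
exact: cvg_ln1B_series.
Qed.

(** Supplies the bound [B] of [tauberian_half]: near [0] both values are within [1] of [c], and the
    logarithms differ by [ln 2 <= 1]. *)
Lemma laplace_ln_diff L (c : R) : L d + ln d @[d --> 0^'+] --> c ->
  \forall d \near 0^'+, L d - L (2 * d) <= 3.
Proof.
move=> /cvgrPdist_le /(_ _ ltr01) H.
have H2 : \forall d \near 0^'+, `|c - (L (2 * d) + ln (2 * d))| <= 1.
  exact: (cvg_mull_right0 (ltr0Sn R 1) H).
near=> d.
have d0 : 0 < d by near: d; exact: nbhs_right_gt.
have : `|c - (L d + ln d)| <= 1 by near: d.
have : `|c - (L (2 * d) + ln (2 * d))| <= 1 by near: d.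
have : ln 2 <= 1 :> R by apply: (@le_ln1Dx R 1); rewrite (lt_trans (ltrN10 _)).
by rewrite lnM ?posrE // !ler_norml => h /andP[h1 h2] /andP[h3 h4]; lra.
Unshelve. all: by end_near. Qed.

Lemma ln1BexpR_equiv : - ln (1 - expR (- d)) + ln d @[d --> 0^'+] --> (0 : R).
Proof.
(* [d / (1 + d) <= 1 - exp (- d) <= d] *)
apply: (@squeeze_cvgr _ _ _ _ (fun=> 0) (fun d : R => d)).
- near=> d.
  have d0 : 0 < d by near: d; exact: nbhs_right_gt.
  have e1 : 0 < 1 - expR (- d) by rewrite subr_gt0 expR_lt1 oppr_lt0.
  rewrite addrC; apply/andP; split.
    rewrite subr_ge0 ler_ln ?posrE // lerBlDl -lerBlDr; have := expR_ge1Dx (- d); lra.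
  rewrite -ln_div ?posrE //.
  have -> : d / (1 - expR (- d)) = 1 + (d / (1 - expR (- d)) - 1) by rewrite addrCA subrr addr0.
  apply: le_trans (le_ln1Dx _) _.
    by rewrite ltrDr divr_gt0.
  rewrite lerBlDr ler_pdivrMr // expRN.
  have := expR_ge1Dx d; have := expR_gt0 d => E0 E1.
  have : (expR d)^-1 <= (1 + d)^-1 by rewrite lef_pV2 ?posrE // addr_gt0.
  have : (1 + d) * (1 + d)^-1 = 1 by rewrite divff // lt0r_neq0 // addr_gt0.
  have := addr_gt0 ltr01 d0.
  set v := (1 + d)^-1; set w := (expR d)^-1; nra.
- exact: cvg_cst.
- exact: cvg_at_right_filter cvg_id.
Unshelve. all: by end_near. Qed.

Lemma cvg_truncn : Num.truncn u @[u --> (+oo : set_system R)] --> \oo.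
Proof.
move=> A [N _ NA]; exists N%:R; split; first exact: num_real.
move=> x /= Nx; apply: NA => /=.
by rewrite -ltnS -(ltr_nat R) (lt_trans Nx) // truncnS_gt.
Qed.

Lemma cvg_harmonic_sum : harmonic_sum u - ln u @[u --> +oo] --> euler_gamma R.
Proof.
have H1 := cvg_comp _ _ cvg_truncn (@cvg_euler_gamma R).
have H2 : ln (Num.truncn u)%:R - ln u @[u --> (+oo : set_system R)] --> (0 : R).
  apply: (@squeeze_cvgr _ _ _ _ (fun u => - (Num.truncn u)%:R^-1) (fun=> 0)).
  - near=> u.
    have u1 : 1 < u by near: u; exact: nbhs_pinfty_gt.
    have m0 : (0 < Num.truncn u)%N by rewrite -ltnS -(ltr_nat R) (lt_trans u1) // truncnS_gt.
    have mu : (Num.truncn u)%:R <= u by rewrite truncn_le; lra.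
    have p0 : 0 < (Num.truncn u)%:R :> R by rewrite ltr0n.
    have u0 : 0 < u by lra.
    have uS : ln u <= ln (Num.truncn u).+1%:R by rewrite ler_ln ?posrE ?ltr0n // ltW // truncnS_gt.
    have [_ h] := @ln_succ_bounds R _ m0.
    apply/andP; split; last by rewrite subr_le0 ler_ln ?posrE.
    by rewrite lerNl opprB (le_trans _ h) // lerD2r.
  - rewrite -[0 : R]oppr0; apply: cvgN.
    have h : n%:R^-1 @[n --> \oo] --> (0 : R).
      by rewrite -(cvg_shiftS (fun n => n%:R^-1 : R)); exact: cvg_harmonic.
    exact: (cvg_comp _ _ cvg_truncn h).
  - exact: cvg_cst.
rewrite -[euler_gamma R]addr0; apply: cvg_trans (cvgD H1 H2); apply: near_eq_cvg; near=> u.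
by rewrite fctE /= subrKA /harmonic_sum (big_ltn (ltn0Sn _)) invr0 add0r.
Unshelve. all: by end_near. Qed.

(** Up to [e / 4], [V u] lies between the harmonic sums at [u / k] and at [k u], shifted by [c].
    These are asymptotic to [ln u + gamma] minus or plus [ln k], and [k] is chosen with
    [ln k = e / 4]. *)
Theorem tauberian_log a lam V L c : laplace_pair a lam V L ->
  L d + ln d @[d --> 0^'+] --> c -> V u - ln u @[u --> +oo] --> euler_gamma R + c.
Proof.
move=> LP Lc.
have HP := harmonic_laplace_pair.
have BV := laplace_ln_diff Lc.
have BH := laplace_ln_diff ln1BexpR_equiv.
have D1 : L d - - ln (1 - expR (- d)) @[d --> 0^'+] --> c.
  rewrite -[c]subr0; apply: cvg_trans (cvgB Lc ln1BexpR_equiv); apply: near_eq_cvg; near=> d.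
  by rewrite !fctE /=; ring.
have D2 : - ln (1 - expR (- d)) - L d @[d --> 0^'+] --> - c.
  rewrite -[- c]sub0r; apply: cvg_trans (cvgB ln1BexpR_equiv Lc); apply: near_eq_cvg; near=> d.
  by rewrite !fctE /=; ring.
apply/cvgrPdist_le => e e0.
pose k := expR (e / 4).
have k1 : 1 < k by rewrite expR_gt1 divr_gt0.
have k0 : 0 < k by rewrite expR_gt0.
have lnk : ln k = e / 4 by rewrite expRK.
have e4 : 0 < e / 4 by rewrite divr_gt0.
have up := tauberian_half LP HP BV BH D1 k1 e4.
have lo := tauberian_half HP LP BH BV D2 k1 e4.
have sk : k * u @[u --> +oo] --> (+oo : set_system R) by apply: gt0_cvgMry => //; exact: cvg_id.
have sk' : k^-1 * u @[u --> +oo] --> (+oo : set_system R).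
  by apply: gt0_cvgMry; [rewrite invr_gt0 | exact: cvg_id].
have /cvgrPdist_le /(_ _ e4) Hg := cvg_harmonic_sum.
have Hg1 : \forall u \near (+oo : set_system R), `|euler_gamma R - (harmonic_sum (k * u) - ln (k * u))| <= e / 4.
  exact: (sk _ Hg).
have Hg2 : \forall u \near (+oo : set_system R), `|euler_gamma R - (harmonic_sum (k^-1 * u) - ln (k^-1 * u))| <= e / 4.
  exact: (sk' _ Hg).
have lo' := sk' _ lo.
near=> u.
have u0 : 0 < u by near: u; exact: nbhs_pinfty_gt.
have h1 : V u <= harmonic_sum (k * u) + c + e / 4 by near: u.
have h2 : harmonic_sum (k^-1 * u) <= V (k * (k^-1 * u)) + - c + e / 4 by near: u.
have : `|euler_gamma R - (harmonic_sum (k * u) - ln (k * u))| <= e / 4 by near: u.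
have : `|euler_gamma R - (harmonic_sum (k^-1 * u) - ln (k^-1 * u))| <= e / 4 by near: u.
move: h2; rewrite mulVKf ?lt0r_neq0 // => h2.
rewrite !lnM ?posrE ?invr_gt0 // lnV ?posrE // lnk !ler_norml => /andP[h3 h4] /andP[h5 h6].
by apply/andP; split; lra.
Unshelve. all: by end_near. Qed.

End TauberianLog.

(** * Complex-valued series *)

Section ComplexNorm.
Variable R : realType.
Local Notation C := (Cplx R).
Implicit Types (x y : R) (z : C).

(* [rC] embeds the reals and [nC] is the real-valued modulus: the norm of
   [Cplx R] takes its values in [Cplx R] itself. *)
Definition rC (x : R) : C := (x%:C)%C.
Definition nC (z : C) : R := complex.Re (`|z| : R[i]).

Lemma rCD : {morph rC : x y / x + y}. Proof. by move=> x y; rewrite /rC (rmorphD (real_complex R)). Qed.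
Lemma rCB : {morph rC : x y / x - y}. Proof. by move=> x y; rewrite /rC (rmorphB (real_complex R)). Qed.
Lemma rCN : {morph rC : x / - x}. Proof. by move=> x; rewrite /rC (rmorphN (real_complex R)). Qed.
Lemma rCM : {morph rC : x y / x * y}. Proof. by move=> x y; rewrite /rC (rmorphM (real_complex R)). Qed.
Lemma rC0 : rC 0 = 0. Proof. by []. Qed.
Lemma rC1 : rC 1 = 1. Proof. by []. Qed.
Lemma rCX n : {morph rC : x / x ^+ n}. Proof. by move=> x; rewrite /rC (rmorphXn (real_complex R)). Qed.
Lemma rCV : {morph rC : x / x^-1}. Proof. by move=> x; rewrite /rC (fmorphV (real_complex R)). Qed.
Lemma rC_nat n : rC n%:R = n%:R. Proof. by rewrite /rC (rmorph_nat (real_complex R)). Qed.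
Lemma rC_sum I (r : seq I) (P : pred I) (F : I -> R) :
  rC (\sum_(i <- r | P i) F i) = \sum_(i <- r | P i) rC (F i).
Proof. by rewrite /rC (rmorph_sum (real_complex R)). Qed.
Lemma rC_prod I (r : seq I) (P : pred I) (F : I -> R) :
  rC (\prod_(i <- r | P i) F i) = \prod_(i <- r | P i) rC (F i).
Proof. by rewrite /rC (rmorph_prod (real_complex R)). Qed.
Lemma rC_inj : injective rC. Proof. by move=> x y [->]. Qed.

Lemma normcE z : `|z| = rC (nC z).
Proof.
rewrite /rC /nC; have /ger0_Im : 0 <= (`|z| : R[i]) := normr_ge0 z.
by case: (`|z|) => a b /= ->.
Qed.

Lemma ler_rC x y : (rC x <= rC y) = (x <= y). Proof. exact: lecR. Qed.
Lemma ltr_rC x y : (rC x < rC y) = (x < y). Proof. exact: ltcR. Qed.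

Lemma nC_ge0 z : 0 <= nC z. Proof. by rewrite -ler_rC -normcE normr_ge0. Qed.
Lemma nCM : {morph nC : x y / x * y >-> x * y}.
Proof. by move=> x y; apply: rC_inj; rewrite rCM -!normcE normrM. Qed.
Lemma nC_rC x : nC (rC x) = `|x|.
Proof.
apply: rC_inj; rewrite -normcE.
have [x0|x0] := leP 0 x; first by rewrite (ger0_norm x0) ger0_norm // -rC0 ler_rC.
by rewrite (ltr0_norm x0) ltr0_norm ?rCN // -rC0 ltr_rC.
Qed.
Lemma nC1 : nC 1 = 1. Proof. by rewrite -rC1 nC_rC normr1. Qed.
Lemma nC0 : nC 0 = 0. Proof. by rewrite -rC0 nC_rC normr0. Qed.
Lemma nCN z : nC (- z) = nC z. Proof. by rewrite /nC normrN. Qed.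
Lemma nC_distC z1 z2 : nC (z1 - z2) = nC (z2 - z1). Proof. by rewrite /nC distrC. Qed.
Lemma ler_nCD z1 z2 : nC (z1 + z2) <= nC z1 + nC z2.
Proof. by rewrite -ler_rC rCD -!normcE ler_normD. Qed.
Lemma ler_nCB z1 z2 : nC (z1 - z2) <= nC z1 + nC z2.
Proof. by rewrite -(nCN z2) ler_nCD. Qed.
Lemma nC_conj z : nC (z^*)%C = nC z. Proof. by rewrite /nC (normcJ z). Qed.
Lemma ler_nC_sum I (r : seq I) (P : pred I) (F : I -> C) :
  nC (\sum_(i <- r | P i) F i) <= \sum_(i <- r | P i) nC (F i).
Proof.
elim/big_rec2: _ => [|i y x _ H]; first by rewrite nC0.
by apply: le_trans (ler_nCD _ _) _; rewrite lerD2l.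
Qed.
Lemma ler_ReN z : `|complex.Re z| <= nC z.
Proof. by rewrite -ler_rC -normcE; exact: (normc_ge_Re z). Qed.
Lemma ler_ImN z : `|complex.Im z| <= nC z.
Proof.
have -> : `|complex.Im z| = `|complex.Re ((z : R[i]%C) * 'i%C)%R| by rewrite ReiNIm normrN.
apply: le_trans (ler_ReN (z * ('i%C : C))) _.
rewrite nCM -[leRHS]mulr1; apply: ler_wpM2l; first exact: nC_ge0.
by rewrite /nC normc_def /= expr0n add0r expr1n sqrtr1.
Qed.
Lemma ler_nC_ReIm z : nC z <= `|complex.Re z| + `|complex.Im z|.
Proof.
have zE : z = rC (complex.Re z) + ('i%C : C) * rC (complex.Im z) by rewrite /rC; exact: complexE.
rewrite {1}zE; apply: le_trans (ler_nCD _ _) _; rewrite nCM !nC_rC /=.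
have -> : nC 'i%C = 1 by rewrite /nC normc_def /= expr0n add0r expr1n sqrtr1.
by rewrite mul1r.
Qed.

(** Balls in [Cplx R] have their radii in the field itself; a positive radius is real, so the
    modulus may be taken in [R]. *)
Lemma cvgC {T} (F : set_system T) {FF : Filter F} (u : T -> C) (l : C) :
  u x @[x --> F] --> l <-> nC (l - u x) @[x --> F] --> (0 : R).
Proof.
split=> [/cvgrPdist_lt H|/cvgrPdist_lt H]; apply/cvgrPdist_lt => e e0.
  have /H : 0 < rC e by rewrite -rC0 ltr_rC.
  by apply: filterS => x; rewrite normcE ltr_rC sub0r normrN ger0_norm ?nC_ge0.
have eE : e = rC (complex.Re e).
  by rewrite /rC; have /ger0_Im := ltW e0; case: (e) => a b /= ->.
have /H : 0 < complex.Re e by move: e0; rewrite {1}eE -rC0 ltr_rC.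
by apply: filterS => x; rewrite sub0r normrN ger0_norm ?nC_ge0 // => xe; rewrite normcE eE ltr_rC.
Qed.

Lemma cvg_rC {T} (F : set_system T) {FF : Filter F} (u : T -> R) (l : R) :
  u x @[x --> F] --> l -> rC (u x) @[x --> F] --> rC l.
Proof.
move=> H; apply/cvgC; under eq_cvg do rewrite -rCB nC_rC.
by apply/norm_cvg0P; rewrite -[X in _ --> X](subrr l); apply: cvgB => //; exact: cvg_cst.
Qed.

Lemma cvg_rC_real T (G : set_system T) {FG : ProperFilter G} (u : T -> R) (z : C) :
  rC (u x) @[x --> G] --> z -> u x @[x --> G] --> complex.Re z /\ z = rC (complex.Re z).
Proof.
move=> H; have Rd : u x @[x --> G] --> complex.Re z.
  move/cvgC: (H) => H'; apply/cvgrPdist_le => eps eps0.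
  move/cvgrPdist_le: H' => /(_ _ eps0); apply: filterS => x.
  rewrite sub0r normrN ger0_norm ?nC_ge0 //; apply: le_trans.
  by apply: le_trans (ler_ReN _); rewrite (raddfB (@complex.Re R)).
split=> //; exact: (cvg_unique (@norm_hausdorff _ _) H (cvg_rC Rd)).
Qed.

End ComplexNorm.

(** * Convergence criteria with explicit rates *)

Section Series.
Variable R : realType.
Local Notation C := (Cplx R).
Implicit Types (w : nat -> R) (c f : nat -> C).

Lemma nested_real (u d : nat -> R) :
  (forall N M, u N - d N <= u M + d M) -> exists l, forall N, u N - d N <= l <= u N + d N.
Proof.
move=> H; pose A := [set u N - d N | N in [set: nat]].
have A0 : A !=set0 by exists (u 0%N - d 0%N), 0%N.
exists (sup A) => N; apply/andP; split.
  apply: ub_le_sup; last by exists N.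
  by exists (u 0%N + d 0%N) => _ [M _ <-].
by apply: ge_sup => // _ [M _ <-].
Qed.

(** Real and imaginary parts are trapped in nested intervals, which gives the limit with error
    [2 * d M]; the sharp rate [d N] returns by passing through a large [M]. *)
Lemma cauchy_rate (u : nat -> C) (d : nat -> R) : d @ \oo --> (0 : R) ->
  (forall N M, (N <= M)%N -> nC (u M - u N) <= d N) ->
  exists L, forall N, nC (L - u N) <= d N.
Proof.
move=> d0 H.
have dge N : 0 <= d N by apply: le_trans (nC_ge0 _) (H N N (leqnn _)).
have H' N M : nC (u M - u N) <= d N + d M.
  have [NM|/ltnW MN] := leqP N M; first by rewrite (le_trans (H _ _ NM)) // lerDl.
  by rewrite nC_distC (le_trans (H _ _ MN)) // lerDr.
have [l1 h1] : exists l, forall N, complex.Re (u N) - d N <= l <= complex.Re (u N) + d N.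
  apply: nested_real => N M; have := le_trans (ler_ReN _) (H' N M).
  by rewrite raddfB ler_norml => /andP[]; lra.
have [l2 h2] : exists l, forall N, complex.Im (u N) - d N <= l <= complex.Im (u N) + d N.
  apply: nested_real => N M; have := le_trans (ler_ImN _) (H' N M).
  by rewrite raddfB ler_norml => /andP[]; lra.
exists (Complex l1 l2) => N.
have d2 M : nC ((Complex l1 l2 : C) - u M) <= 2 * d M.
  apply: le_trans (ler_nC_ReIm _) _; have := h1 M; have := h2 M.
  rewrite (raddfB (@complex.Re R)) (raddfB (@complex.Im R)) /= => /andP[a b] /andP[a' b'].
  rewrite mulr_natl mulr2n; apply: lerD; rewrite ler_norml; lra.
apply/ler_addgt0Pr => e e0.
have e2 : 0 < e / 2 by rewrite divr_gt0.
move/cvgrPdist_le: d0 => /(_ _ e2) [M0 _ dM].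
pose M := maxn N M0.
have := dM M (leq_maxr _ _); rewrite sub0r normrN ger0_norm // => dMe.
have -> : (Complex l1 l2 : C) - u N = ((Complex l1 l2 : C) - u M) + (u M - u N) by rewrite addrA subrK.
apply: le_trans (ler_nCD _ _) _; have := H N M (leq_maxl _ _); have := d2 M; lra.
Qed.

(** Summation by parts: as [w] decreases, its total variation and the boundary term add up to
    [w N]. *)
Lemma abel_bound w c (B : R) N M :
    (forall K, nC (\sum_(N <= n < K) c n) <= B) ->
    (forall n, (N <= n)%N -> 0 <= w n) -> (forall n, (N <= n)%N -> w n.+1 <= w n) ->
  nC (\sum_(N <= n < M) rC (w n) * c n) <= B * w N.
Proof.
move=> cB w0 wS; have B0 : 0 <= B by apply: le_trans (nC_ge0 _) (cB N).
have [MN|NM] := ltnP M N; first by rewrite big_geq ?nC0 ?mulr_ge0 ?w0 // ltnW.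
pose S K := \sum_(N <= n < K) c n.
have E : \sum_(N <= n < M) rC (w n) * c n =
   rC (w M) * S M + \sum_(N <= n < M) rC (w n - w n.+1) * S n.+1.
  elim: M NM => [|M IH]; first by rewrite leqn0 => /eqP e; rewrite /S !big_geq ?e // mulr0 addr0.
  rewrite leq_eqVlt => /predU1P[e|]; first by rewrite /S !big_geq -?e // mulr0 addr0.
  rewrite ltnS => NM; rewrite !big_nat_recr //= IH // /S !big_nat_recr //= rCB; ring.
rewrite E; apply: le_trans (ler_nCD _ _) _.
have -> : B * w N = w M * B + \sum_(N <= n < M) (w n - w n.+1) * B.
  have -> : \sum_(N <= n < M) (w n - w n.+1) * B = (w N - w M) * B.
    rewrite -mulr_suml -[w N - w M]opprB -telescope_sumr // -sumrN; congr (_ * _).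
    by apply: eq_bigr => n _; rewrite opprB.
  ring.
apply: lerD; first by rewrite nCM nC_rC ger0_norm ?w0 //; apply: ler_wpM2l; [exact: w0|exact: cB].
apply: le_trans (ler_nC_sum _ _ _) _; apply: ler_sum_nat => n /andP[Nn _].
by rewrite nCM nC_rC ger0_norm ?subr_ge0 ?wS //; apply: ler_wpM2l; [rewrite subr_ge0 wS|exact: cB].
Qed.


Lemma dirichlet_test w c (B : R) :
    (forall N K, (0 < N)%N -> nC (\sum_(N <= n < K) c n) <= B) ->
    (forall n, (0 < n)%N -> 0 <= w n) -> (forall n, (0 < n)%N -> w n.+1 <= w n) ->
    w @ \oo --> (0 : R) ->
  exists L, forall N, (0 < N)%N -> nC (L - \sum_(1 <= n < N) rC (w n) * c n) <= B * w N.
Proof.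
move=> cB w0 wS wcvg.
have d0 : (fun N => B * w N.+1) @ \oo --> (0 : R).
  rewrite -[X in _ --> X](mulr0 B); apply: cvgMl_tmp.
  by rewrite (cvg_shiftS w).
have [|L HL] := @cauchy_rate (fun N => \sum_(1 <= n < N.+1) rC (w n) * c n) _ d0.
  move=> N M NM; rewrite (big_cat_nat (n := N.+1)) //= addrAC subrr add0r.
  by apply: abel_bound => [K|n Nn|n Nn]; [exact: cB | apply: w0 | apply: wS]; apply: leq_trans Nn.
by exists L => -[|N] // _; exact: HL.
Qed.

(** Full periods cancel, so fewer than [q] terms remain. *)
Lemma periodic_sum_bound f (q : nat) (b : R) N M :
    (0 < q)%N -> (forall n, f (n + q)%N = f n) -> \sum_(0 <= n < q) f n = 0 -> (forall n, nC (f n) <= b) ->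
  nC (\sum_(N <= n < M) f n) <= q%:R * b.
Proof.
move=> q0 fq f0 fb; have b0 : 0 <= b by apply: le_trans (nC_ge0 _) (fb 0%N).
have blk K : \sum_(K <= n < K + q) f n = 0.
  elim: K => [|K IH]; first by rewrite add0n.
  apply: (@addrI _ (f K)); rewrite -big_ltn ?addr0; last by rewrite addSn ltnS ltnW // -addn1 leq_add2l.
  rewrite addSn big_nat_recr /= ?leq_addr // IH add0r fq //.
elim/ltn_ind: M => M IH.
have [MN|NM] := leqP (N + q) M.
  have -> : \sum_(N <= n < M) f n = \sum_(N <= n < M - q) f n.
    rewrite (big_cat_nat (n := (M - q)%N)) ?leq_subr //=; last by rewrite leq_subRL ?(leq_trans (leq_addl _ _) MN) // addnC.
    by have := blk (M - q)%N; rewrite subnK ?(leq_trans (leq_addl _ _) MN) // => ->; rewrite addr0.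
  by apply: IH; rewrite ltn_subrL q0 (leq_trans q0) // (leq_trans (leq_addl _ _) MN).
apply: le_trans (ler_nC_sum _ _ _) _.
apply: le_trans (ler_sum _ (fun n _ => fb n)) _.
rewrite sumr_const_nat -[leLHS]mulr_natl; apply: ler_wpM2r => //.
by rewrite ler_nat leq_subLR ltnW.
Qed.

End Series.

(** * Euler products by sieving *)

Section EulerProduct.
Variable R : realType.
Local Notation C := (Cplx R).
Implicit Types (f : nat -> C).

Lemma sum_multiples (V : nmodType) (F : nat -> V) (P : pred nat) p M : (0 < p)%N ->
  \sum_(1 <= n < M.+1 | P n && (p %| n)%N) F n =
  \sum_(1 <= m < (M %/ p).+1 | P (p * m)%N) F (p * m)%N.
Proof.
move=> p0; elim: M => [|M IH]; first by rewrite div0n !big_geq.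
rewrite big_mkcond big_nat_recr //= -big_mkcond /= IH divnS //.
have [pM|_] := boolP (p %| M.+1)%N; last by rewrite andbF addr0 add0n.
rewrite andbT add1n [in RHS]big_mkcond [in RHS]big_nat_recr //= -big_mkcond /=.
have -> : (p * (M %/ p).+1)%N = M.+1 by rewrite -[RHS](divnK pM) divnS // pM add1n mulnC.
by [].
Qed.

Definition rough N n := all (leq N) (primes n).

Lemma roughS N n : (0 < n)%N -> rough N.+1 n = rough N n && ~~ (prime N && (N %| n)%N).
Proof.
move=> n0; apply/allP/andP => [H|[/allP H1 H2] p pn].
  split; first by apply/allP => p /H /ltnW.
  apply/negP => /andP[pN Nn]; have := H N.
  by rewrite mem_primes pN n0 Nn => /(_ isT); rewrite ltnn.
rewrite ltn_neqAle H1 // andbT; apply: contra H2 => /eqP ->.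
by move: pn; rewrite mem_primes => /and3P[-> _ ->].
Qed.

Lemma rough_mulp p m : prime p -> (0 < m)%N -> rough p (p * m) = rough p m.
Proof.
move=> pp m0; apply/allP/allP => H r.
  by move=> rm; apply: H; rewrite (primesM _ (prime_gt0 pp) m0); apply/orP; right.
by rewrite (primesM _ (prime_gt0 pp) m0) primes_prime // inE => /orP[/eqP ->|/H].
Qed.

Lemma rough_gt1 N n : (1 < n)%N -> rough N n -> (N <= n)%N.
Proof.
move=> n1 /allP /(_ (pdiv n)); rewrite mem_primes pdiv_prime // pdiv_dvd ltnW // => /(_ isT).
by move=> H; apply: leq_trans H (pdiv_leq _); apply: ltnW.
Qed.

Lemma cvg_divn p : (0 < p)%N -> (M %/ p)%N @[M --> \oo] --> \oo.
Proof.
move=> p0 A [N _ NA]; exists (N * p)%N => // M /= NM; apply: NA => /=.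
by rewrite leq_divRL.
Qed.

(* The sieve of Eratosthenes: each factor [1 - f p] removes the multiples of [p]
   from the sum. *)
Lemma rough_sum_cvg f (L : C) : f 1%N = 1 -> (forall m n, f (m * n)%N = f m * f n) ->
  (\sum_(1 <= n < M.+1) f n) @[M --> \oo] --> L ->
  forall N : nat, (\sum_(1 <= n < M.+1 | rough N n) f n) @[M --> \oo] -->
    L * \prod_(0 <= p < N | prime p) (1 - f p).
Proof.
move=> f1 fM fL.
have prodS N : \prod_(0 <= p < N.+1 | prime p) (1 - f p) =
    \prod_(0 <= p < N | prime p) (1 - f p) * (if prime N then 1 - f N else 1).
  by rewrite big_mkcond big_nat_recr //= -big_mkcond.
elim=> [|N IH].
  rewrite (_ : \prod_(0 <= p < 0 | prime p) (1 - f p) = 1) ?mulr1; last by rewrite big_geq.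
  apply: cvg_trans fL; apply: near_eq_cvg; near=> M.
  by apply: eq_bigl => n; have -> : rough 0 n = true by exact/allP.
have [Np|Np] := boolP (prime N); last first.
  rewrite prodS (negbTE Np) mulr1.
  apply: cvg_trans IH; apply: near_eq_cvg; near=> M.
  rewrite big_nat_cond [RHS]big_nat_cond; apply: eq_bigl => n.
  by case: ltnP => //= n0; rewrite roughS // (negbTE Np) andbT.
rewrite prodS Np mulrA mulrBr mulr1.
(* The rough multiples of [N] up to [M] are [N] times the rough integers up to [M / N], hence the
   limit along [M %/ N]. *)
have IH' := cvg_comp _ _ (cvg_divn (prime_gt0 Np)) IH.
rewrite [X in _ - X]mulrC.
apply: cvg_trans (cvgB IH (cvgMl_tmp (a := f N) IH')); apply: near_eq_cvg; near=> M.
rewrite !fctE /=.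
rewrite (bigID (fun n => N %| n)%N) /= sum_multiples ?prime_gt0 //.
have -> : \sum_(1 <= m < (M %/ N).+1 | rough N (N * m)) f (N * m)%N =
    f N * \sum_(1 <= n < (M %/ N).+1 | rough N n) f n.
  rewrite mulr_sumr big_nat_cond [RHS]big_nat_cond; apply: eq_big => [n|n _]; last exact: fM.
  by case: ltnP => //= n0; rewrite rough_mulp.
rewrite addrAC subrr add0r big_nat_cond [RHS]big_nat_cond; apply: eq_bigl => n.
by case: ltnP => //= n0; rewrite roughS // Np.
Unshelve. all: by end_near. Qed.

(** A positive [N]-rough integer other than [1] is at least [N], so the sifted sum differs from [1]
    by a tail of an absolutely convergent series. In this form no division by [L] occurs, and
    [L != 0] is a consequence. *)
Lemma euler_product f (L : C) (d : nat -> R) : f 1%N = 1 -> (forall m n, f (m * n)%N = f m * f n) ->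
    (\sum_(1 <= n < M.+1) f n) @[M --> \oo] --> L ->
    d @ \oo --> (0 : R) ->
    (forall N M, (0 < N)%N -> \sum_(N <= n < M) nC (f n) <= d N) ->
  L * \prod_(0 <= p < N | prime p) (1 - f p) @[N --> \oo] --> (1 : C).
Proof.
move=> f1 fM fL d0 fd; apply/cvgC/cvgrPdist_le => e e0.
have e2 : 0 < e / 2 by rewrite divr_gt0.
move/cvgrPdist_le: d0 => /(_ _ e2) [N0 _ dN].
exists (maxn 2 N0) => // N /=; rewrite geq_max => /andP[N2 NN0].
rewrite sub0r normrN ger0_norm ?nC_ge0 //.
have /cvgC/cvgrPdist_le /(_ _ e2) [M0 _ HM] := rough_sum_cvg f1 fM fL (N := N).
pose M := maxn M0 2.
have := HM M (leq_maxl _ _); rewrite sub0r normrN ger0_norm ?nC_ge0 // => h1.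
have h2 : nC (1 - \sum_(1 <= n < M.+1 | rough N n) f n) <= e / 2.
  rewrite big_ltn_cond; last by rewrite ltnS (leq_trans _ (leq_maxr _ _)).
  rewrite /rough /= f1 opprD addrA subrr add0r nCN.
  apply: le_trans (ler_nC_sum _ _ _) _.
  apply: (@le_trans _ _ (\sum_(N <= n < M.+1) nC (f n))).
    rewrite big_mkcond [leRHS](big_nat_widenl _ 2) // [leRHS]big_mkcond /=.
    apply: ler_sum_nat => n /andP[n2 _]; case: ifPn => [/(rough_gt1 n2) ->//|_].
    by case: ifP => // _; exact: nC_ge0.
  have := dN N NN0; rewrite sub0r normrN => h; apply: le_trans (fd _ _ _) (le_trans (ler_norm _) h).
  exact: leq_trans N2.
rewrite -(subrKA (\sum_(1 <= n < M.+1 | rough N n) f n)) (le_trans (ler_nCD _ _)) //.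
by rewrite [nC (_ - L * _)]nC_distC; lra.
Qed.

End EulerProduct.

(** * Real powers of the integers and their sums *)

Section Powers.
Variable R : realType.
Implicit Types (s d : R).

Lemma natpowN_gt0 n s : (0 < n)%N -> 0 < (n%:R : R) `^ (- s).
Proof. by move=> n0; rewrite powR_gt0 // ltr0n. Qed.

Lemma natpowN_ge0 n s : 0 <= (n%:R : R) `^ (- s).
Proof. exact: powR_ge0. Qed.

Lemma natpowNE n s : (0 < n)%N -> (n%:R : R) `^ (- s) = expR (- (s * ln n%:R)).
Proof. by move=> n0; rewrite /powR pnatr_eq0 gtn_eqF // mulNr. Qed.

Lemma natpowN_le n m s : 0 <= s -> (0 < n)%N -> (n <= m)%N -> (m%:R : R) `^ (- s) <= n%:R `^ (- s).
Proof.
move=> s0 n0 nm; rewrite !natpowNE ?(leq_trans n0) // ler_expR lerN2; apply: ler_wpM2l => //.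
by rewrite ler_ln ?posrE ?ltr0n ?(leq_trans n0) // ler_nat.
Qed.

Lemma natpowN_le1 n s : 0 <= s -> (0 < n)%N -> (n%:R : R) `^ (- s) <= 1.
Proof. by move=> s0 n0; have := natpowN_le s0 (ltn0Sn 0) n0; rewrite powR1. Qed.

Lemma natpowN_lexp n s s' : (0 < n)%N -> s <= s' -> (n%:R : R) `^ (- s') <= n%:R `^ (- s).
Proof.
move=> n0 ss; rewrite !natpowNE // ler_expR lerN2; apply: ler_wpM2r => //.
by rewrite ln_ge0 // ler1n.
Qed.

Lemma natpowN1 n : (n%:R : R) `^ (- 1) = n%:R^-1.
Proof. by rewrite powR_inv1. Qed.

Lemma natpowN_nat n k : (0 < k)%N -> (n%:R : R) `^ (- k%:R) = (n%:R ^+ k)^-1.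
Proof. by move=> k0; rewrite powRN powR_mulrn. Qed.

Lemma natpowND n s d : (0 < n)%N -> (n%:R : R) `^ (- (s + d)) = n%:R `^ (- s) * n%:R `^ (- d).
Proof. by move=> n0; rewrite opprD powRD // pnatr_eq0 gtn_eqF // implybT. Qed.

Lemma natpowNM m n s : ((m * n)%:R : R) `^ (- s) = m%:R `^ (- s) * n%:R `^ (- s).
Proof. by rewrite natrM powRM. Qed.

Lemma cvg_natpowN s : 0 < s -> (n%:R : R) `^ (- s) @[n --> \oo] --> (0 : R).
Proof.
move=> s0; apply/cvgrPdist_le => e e0.
exists (Num.truncn (expR (- ln e / s))).+1 => // n /= nN.
have n0 : (0 < n)%N by apply: leq_trans nN.
rewrite sub0r normrN ger0_norm ?natpowN_ge0 // natpowNE // -[leRHS]lnK ?posrE // ler_expR.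
rewrite lerNl mulrC -ler_pdivrMr // -[leLHS]expRK ler_ln ?posrE ?expR_gt0 ?ltr0n //.
by apply: ltW; apply: lt_le_trans (truncnS_gt _) _; rewrite ler_nat.
Qed.

(** The middle quantity is the integral of [x^(-1 - d)] over [[n, n + 1]]. In place of the integral,
    the proof uses [1 + x <= exp x] and the bounds on [ln (n + 1) - ln n]. *)
Lemma natpowN_telescope n d : 0 < d -> (0 < n)%N ->
  (n.+1%:R : R) `^ (- (1 + d)) <= (n%:R `^ (- d) - n.+1%:R `^ (- d)) / d /\
  (n%:R `^ (- d) - n.+1%:R `^ (- d)) / d <= (n%:R : R) `^ (- (1 + d)).
Proof.
move=> d0 n0; have [h1 h2] := @ln_succ_bounds R n n0.
rewrite !natpowND // !natpowN1 ler_pdivlMr // ler_pdivrMr //.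
set x := n%:R `^ (- d); set y := n.+1%:R `^ (- d).
have x0 : 0 < x by exact: natpowN_gt0.
have y0 : 0 < y by exact: natpowN_gt0.
have xE : x = y * expR (d * (ln n.+1%:R - ln n%:R)).
  by rewrite /x /y !natpowNE // -expRD; congr expR; ring.
have yE : y = x * expR (- (d * (ln n.+1%:R - ln n%:R))).
  by rewrite xE -mulrA -expRD subrr expR0 mulr1.
split.
  have := expR_ge1Dx (d * (ln n.+1%:R - ln n%:R)) => H.
  have : y * (1 + d * (ln n.+1%:R - ln n%:R)) <= x by rewrite xE; apply: ler_wpM2l => //; exact: ltW.
  have : y * (d * n.+1%:R^-1) <= y * (d * (ln n.+1%:R - ln n%:R)).
    by apply: ler_wpM2l; [exact: ltW | apply: ler_wpM2l => //; exact: ltW].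
  set u := n.+1%:R^-1; set v := ln _ - _; nra.
have := expR_ge1Dx (- (d * (ln n.+1%:R - ln n%:R))) => H.
have : x * (1 + - (d * (ln n.+1%:R - ln n%:R))) <= y by rewrite yE; apply: ler_wpM2l => //; exact: ltW.
have : x * (d * (ln n.+1%:R - ln n%:R)) <= x * (d * n%:R^-1).
  by apply: ler_wpM2l; [exact: ltW | apply: ler_wpM2l => //; exact: ltW].
set u := n%:R^-1; set v := ln _ - _; nra.
Qed.

Lemma natpowN_tail d N M : 0 < d -> (0 < N)%N ->
  \sum_(N <= n < M) (n%:R : R) `^ (- (1 + d)) <= N%:R `^ (- (1 + d)) + N%:R `^ (- d) / d.
Proof.
move=> d0 N0; have p0 := natpowN_ge0.
have [MN|NM] := leqP M N; first by rewrite big_geq // addr_ge0 // divr_ge0 // ltW.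
suff H k : \sum_(N <= n < N + k.+1) (n%:R : R) `^ (- (1 + d)) <=
    N%:R `^ (- (1 + d)) + (N%:R `^ (- d) - (N + k)%:R `^ (- d)) / d.
  have := H (M - N).-1; rewrite prednK ?subn_gt0 // subnKC ?(ltnW NM) // => /le_trans; apply.
  by rewrite lerD2l ler_pM2r ?invr_gt0 // lerBlDr lerDl.
elim: k => [|k IH]; first by rewrite addn1 big_nat1 addn0 subrr mul0r addr0.
rewrite addnS in IH; rewrite !addnS big_nat_recr ?leqW ?leq_addr //=.
have Nk : (0 < N + k)%N by rewrite addn_gt0 N0.
have [h _] := natpowN_telescope d0 Nk.
by apply: le_trans (lerD IH h) _; rewrite -addrA -mulrDl addrA subrK.
Qed.

Lemma natpowN_tail_cvg d : 0 < d ->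
  (N%:R : R) `^ (- (1 + d)) + N%:R `^ (- d) / d @[N --> \oo] --> (0 : R).
Proof.
move=> d0; rewrite -[X in _ --> X]addr0; apply: cvgD; first by apply: cvg_natpowN; rewrite addr_gt0.
by rewrite -[X in _ --> X](mul0r d^-1); apply: cvgMr_tmp; exact: cvg_natpowN.
Qed.

Lemma natpowN_head d M : 0 < d ->
  (1 - (M.+1%:R : R) `^ (- d)) / d <= \sum_(1 <= n < M.+1) (n%:R : R) `^ (- (1 + d)).
Proof.
move=> d0; elim: M => [|M IH]; first by rewrite powR1 subrr mul0r big_geq.
rewrite big_nat_recr //=.
have [_ h] := natpowN_telescope d0 (ltn0Sn M).
by apply: le_trans (lerD IH h); rewrite -mulrDl addrA subrK.
Qed.

Lemma sum_invsqrt_le M : \sum_(1 <= n < M.+1) (Num.sqrt (n%:R : R))^-1 <= 2 * Num.sqrt M%:R.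
Proof.
elim: M => [|M IH]; first by rewrite big_geq // sqrtr0 mulr0.
rewrite big_nat_recr //=; apply: le_trans (lerD IH (lexx _)) _.
have a0 : 0 <= Num.sqrt (M%:R : R) by exact: sqrtr_ge0.
have b0 : 0 < Num.sqrt (M.+1%:R : R) by rewrite sqrtr_gt0 ltr0n.
have aE : Num.sqrt (M%:R : R) ^+ 2 = M%:R by rewrite sqr_sqrtr.
have bE : Num.sqrt (M.+1%:R : R) ^+ 2 = M%:R + 1 by rewrite sqr_sqrtr // natr1.
move: a0 b0 aE bE; set a := Num.sqrt M%:R; set b := Num.sqrt _ => a0 b0 aE bE.
have vb : b^-1 * b = 1 by rewrite mulVf // lt0r_neq0.
have : a <= b by rewrite -(@ler_pXn2r _ 2) ?nnegrE ?(ltW b0) // aE bE lerDl.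
move=> ab; rewrite -(ler_pM2r b0) mulrDl vb; nra.
Qed.

(** From [1 - n^(-d) <= d ln n] and the crude [ln n = 2 ln (sqrt n) <= 2 sqrt n], which keeps the
    later sums elementary. *)
Lemma natpowN_diff_le n d : 0 <= d -> (0 < n)%N ->
  0 <= (n%:R : R) `^ (- 1) - n%:R `^ (- (1 + d)) <= 2 * d * (Num.sqrt n%:R)^-1.
Proof.
move=> d0 n0; rewrite natpowND //.
have p0 : 0 < (n%:R : R) by rewrite ltr0n.
have l1 : n%:R `^ (- d) <= 1 :> R by exact: natpowN_le1.
rewrite natpowN1 -[X in X - _]mulr1 -mulrBr.
apply/andP; split; first by rewrite mulr_ge0 // subr_ge0.
have h : 1 - n%:R `^ (- d) <= d * ln (n%:R : R).
  by rewrite natpowNE //; have := expR_ge1Dx (- (d * ln (n%:R : R))); lra.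
have s0 : 0 < Num.sqrt (n%:R : R) by rewrite sqrtr_gt0.
have sE : n%:R = Num.sqrt (n%:R : R) ^+ 2 by rewrite sqr_sqrtr // ltW.
have lns : ln (n%:R : R) <= 2 * Num.sqrt n%:R.
  by rewrite {1}sE lnXn // mulr_natl; have := ltW (ln_sublinear s0); lra.
apply: (@le_trans _ _ (n%:R^-1 * (d * (2 * Num.sqrt n%:R)))).
  apply: ler_wpM2l; first by rewrite invr_ge0 ltW.
  by rewrite (le_trans h) //; apply: ler_wpM2l.
by rewrite {1}sE le_eqVlt; apply/orP; left; apply/eqP; field; rewrite lt0r_neq0.
Qed.

End Powers.

(** * Dirichlet series at real points near 1 *)

Section DirichletSeries.
Variable R : realType.
Local Notation C := (Cplx R).
Implicit Types (f : nat -> C) (s d : R).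

Definition dterm f s n : C := rC ((n%:R : R) `^ (- s)) * f n.
Definition dser f s : C := lim (\sum_(1 <= n < M.+1) dterm f s n @[M --> \oo]).

Lemma cvg_rate (u : nat -> C) L (d : nat -> R) : d @ \oo --> (0 : R) ->
  (forall N, nC (L - u N) <= d N) -> u @ \oo --> L.
Proof.
move=> d0 H; apply/cvgC; apply: (@squeeze_cvgr _ _ _ _ (fun=> 0) d) => //; last exact: cvg_cst.
by near=> N; rewrite nC_ge0 H.
Unshelve. all: by end_near. Qed.

Lemma dser_lim f s L : \sum_(1 <= n < M.+1) dterm f s n @[M --> \oo] --> L -> dser f s = L.
Proof. by move=> H; apply: cvg_lim => //; exact: norm_hausdorff. Qed.

Section Balanced.
Variables (f : nat -> C) (q : nat) (b : R).
Hypotheses (q0 : (0 < q)%N) (fq : forall n, f (n + q)%N = f n).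
Hypotheses (f0 : \sum_(0 <= n < q) f n = 0) (fb : forall n, nC (f n) <= b).

Lemma dser_balanced_bound s N : 0 < s -> (0 < N)%N ->
  nC (dser f s - \sum_(1 <= n < N) dterm f s n) <= q%:R * b * N%:R `^ (- s).
Proof.
move=> s0 N0.
have [||||L HL] := @dirichlet_test R (fun n => n%:R `^ (- s)) f (q%:R * b).
- by move=> *; exact: periodic_sum_bound.
- by move=> n n0; exact: natpowN_ge0.
- by move=> n n0; apply: natpowN_le => //; exact: ltW.
- exact: cvg_natpowN.
have -> : dser f s = L; last exact: HL.
apply: dser_lim; apply: (@cvg_rate _ _ (fun N => q%:R * b * N.+1%:R `^ (- s))); last by move=> M; exact: HL.
rewrite -[X in _ --> X](mulr0 (q%:R * b)); apply: cvgMl_tmp.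
by have := cvg_natpowN s0; rewrite -(cvg_shiftS (fun n => n%:R `^ (- s))).
Qed.

Lemma dser_balanced_cvg s : 0 < s ->
  \sum_(1 <= n < M.+1) dterm f s n @[M --> \oo] --> dser f s.
Proof.
move=> s0; apply: (@cvg_rate _ _ (fun N => q%:R * b * N.+1%:R `^ (- s))); last first.
  by move=> M; exact: dser_balanced_bound.
rewrite -[X in _ --> X](mulr0 (q%:R * b)); apply: cvgMl_tmp.
by have := cvg_natpowN s0; rewrite -(cvg_shiftS (fun n => n%:R `^ (- s))).
Qed.

(* The series is cut at [N], which [L1_neq0] takes to be a power of [1 / d]: the
   tails are [O(1 / N)] and the head is [O(d * sqrt N)]. *)
Lemma dser_balanced_diff d N : 0 <= d -> (0 < N)%N ->
  nC (dser f (1 + d) - dser f 1) <= 2 * (q%:R * b) / N%:R + 4 * d * b * Num.sqrt N%:R.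
Proof.
move=> d0 N0; have b0 : 0 <= b := le_trans (nC_ge0 _) (fb 0).
have h1 := @dser_balanced_bound (1 + d) N (ltr_wpDr d0 ltr01) N0.
have h2 := @dser_balanced_bound 1 N ltr01 N0.
have h3 : nC (\sum_(1 <= n < N) dterm f (1 + d) n - \sum_(1 <= n < N) dterm f 1 n) <= 4 * d * b * Num.sqrt N%:R.
  rewrite -sumrB; apply: le_trans (ler_nC_sum _ _ _) _.
  apply: (@le_trans _ _ (\sum_(1 <= n < N) 2 * d * b * (Num.sqrt n%:R)^-1)).
    apply: ler_sum_nat => n /andP[n0 _]; rewrite /dterm -mulrBl -rCB nCM nC_rC distrC.
    have /andP[g0 g1] := @natpowN_diff_le R n d d0 n0.
    rewrite ger0_norm // [leRHS]mulrAC; apply: ler_pM => //; exact: nC_ge0.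
  rewrite -mulr_sumr; case: N N0 {h1 h2} => // N _.
  apply: (@le_trans _ _ (2 * d * b * (2 * Num.sqrt N%:R))).
    by apply: ler_wpM2l; [rewrite !mulr_ge0 | exact: sum_invsqrt_le].
  have : Num.sqrt N%:R <= Num.sqrt N.+1%:R :> R by rewrite ler_sqrt // ler_nat.
  have : 0 <= d * b by rewrite mulr_ge0.
  by set x := Num.sqrt _; set y := Num.sqrt _; nra.
have h4 : q%:R * b * N%:R `^ (- (1 + d)) <= q%:R * b / N%:R.
  apply: ler_wpM2l; first by rewrite mulr_ge0.
  by rewrite -natpowN1; apply: natpowN_lexp => //; rewrite lerDl.
rewrite natpowN1 in h2.
have -> : dser f (1 + d) - dser f 1 = (dser f (1 + d) - \sum_(1 <= n < N) dterm f (1 + d) n) +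
   ((\sum_(1 <= n < N) dterm f (1 + d) n - \sum_(1 <= n < N) dterm f 1 n) -
    (dser f 1 - \sum_(1 <= n < N) dterm f 1 n)) by ring.
apply: le_trans (ler_nCD _ _) _; have := ler_nCB (\sum_(1 <= n < N) dterm f (1 + d) n - \sum_(1 <= n < N) dterm f 1 n) (dser f 1 - \sum_(1 <= n < N) dterm f 1 n).
by move: h1 h2 h3 h4; rewrite -!mulrA; lra.
Qed.

Lemma dser_balanced_right_cvg : dser f (1 + d) @[d --> 0^'+] --> dser f 1.
Proof.
have b0 : 0 <= b := le_trans (nC_ge0 _) (fb 0).
apply/cvgC/cvgrPdist_le => e e0.
(* The cut depends on [e] alone and settles the tails; the head is then at most [K * d]. *)
pose N := (Num.truncn (4 * (q%:R * b) / e)).+1.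
have N0 : (0 : R) < N%:R by rewrite ltr0n.
have hN : 2 * (q%:R * b) / N%:R <= e / 2.
  rewrite ler_pdivrMr //; have := ltW (truncnS_gt (4 * (q%:R * b) / e)).
  by rewrite ler_pdivrMr // -/N; lra.
pose K := 4 * b * Num.sqrt N%:R + 1.
have K0 : 0 < K by rewrite ltr_wpDl // !mulr_ge0 // sqrtr_ge0.
near=> d.
have d0 : 0 < d by near: d; exact: nbhs_right_gt.
have dK : d <= e / 2 / K by near: d; apply: nbhs_right_le; rewrite !divr_gt0.
rewrite sub0r normrN ger0_norm ?nC_ge0 // nC_distC.
apply: le_trans (@dser_balanced_diff d N (ltW d0) (ltn0Sn _)) _.
move: dK; rewrite ler_pdivlMr // /K; lra.
Unshelve. all: by end_near. Qed.

End Balanced.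

Section Absolute.
Variables (f : nat -> C).
Hypothesis (f1 : forall n, nC (f n) <= 1).

Lemma dterm_tail d N M : 0 < d -> (0 < N)%N ->
  \sum_(N <= n < M) nC (dterm f (1 + d) n) <= N%:R `^ (- (1 + d)) + N%:R `^ (- d) / d.
Proof.
move=> d0 N0; apply: le_trans (natpowN_tail M d0 N0); apply: ler_sum_nat => n _.
rewrite nCM nC_rC ger0_norm ?natpowN_ge0 // -[leRHS]mulr1.
by apply: ler_wpM2l => //; exact: natpowN_ge0.
Qed.

Lemma dser_absolute_cvg d : 0 < d ->
  \sum_(1 <= n < M.+1) dterm f (1 + d) n @[M --> \oo] --> dser f (1 + d).
Proof.
move=> d0.
have tl : (N.+1%:R : R) `^ (- (1 + d)) + N.+1%:R `^ (- d) / d @[N --> \oo] --> (0 : R).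
  by have := natpowN_tail_cvg d0; rewrite -(cvg_shiftS (fun N => N%:R `^ (- (1 + d)) + N%:R `^ (- d) / d)).
have [|L HL] := @cauchy_rate R (fun M => \sum_(1 <= n < M.+1) dterm f (1 + d) n) _ tl.
  move=> N M NM; rewrite (big_cat_nat (n := N.+1)) //= addrAC subrr add0r.
  by apply: le_trans (ler_nC_sum _ _ _) _; exact: dterm_tail.
have cL := cvg_rate tl HL.
by rewrite (dser_lim cL).
Qed.

Lemma dser_euler d : f 1%N = 1 -> (forall m n, f (m * n)%N = f m * f n) -> 0 < d ->
  dser f (1 + d) * \prod_(0 <= p < N | prime p) (1 - dterm f (1 + d) p) @[N --> \oo] --> (1 : C).
Proof.
move=> fE fM d0; apply: (euler_product _ _ (dser_absolute_cvg d0) (natpowN_tail_cvg d0)).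
- by rewrite /dterm powR1 rC1 mul1r.
- by move=> m n; rewrite /dterm natpowNM rCM fM; ring.
- by move=> N M N0; exact: dterm_tail.
Qed.

End Absolute.

(** The residue of zeta at [1]. Telescoping encloses the partial sum [S] between
    [(1 - (M + 1)^(-d)) / d] and [1 + 1 / d], so [1 - d S] is at most [d] in modulus, up to a term
    that [M] makes small. *)
Lemma dser_one_cvg : rC d * dser (fun=> 1) (1 + d) @[d --> 0^'+] --> (1 : C).
Proof.
have one1 (n : nat) : nC (1 : C) <= 1 by rewrite nC1.
apply/cvgC; apply: (@squeeze_cvgr _ _ _ _ (fun=> 0) id); last exact: cvg_at_right_filter cvg_id.
  near=> d; rewrite nC_ge0 /=.
  have d0 : 0 < d by near: d; exact: nbhs_right_gt.
  have /cvgC H := dser_absolute_cvg one1 d0.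
  apply/ler_addgt0Pr => e e0.
  have [M [h1 h2]] : exists M, nC (dser (fun=> 1) (1 + d) - \sum_(1 <= n < M.+1) dterm (fun=> 1) (1 + d) n) <= e / 2 / d /\
    (M.+1%:R : R) `^ (- d) <= e / 2.
    have e2 : 0 < e / 2 / d by rewrite !divr_gt0.
    have e3 : 0 < e / 2 by rewrite divr_gt0.
    move/cvgrPdist_le: H => /(_ _ e2) [M1 _ H1].
    have := cvg_natpowN d0; rewrite -(cvg_shiftS (fun n => n%:R `^ (- d))) => /cvgrPdist_le /(_ _ e3) [M2 _ H2].
    exists (maxn M1 M2); split.
      by have := H1 _ (leq_maxl M1 M2); rewrite sub0r normrN ger0_norm ?nC_ge0.
    by have := H2 _ (leq_maxr M1 M2); rewrite sub0r normrN ger0_norm ?natpowN_ge0.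
  pose S := \sum_(1 <= n < M.+1) (n%:R : R) `^ (- (1 + d)).
  have SE : \sum_(1 <= n < M.+1) dterm (fun=> 1) (1 + d) n = rC S.
    by rewrite rC_sum; apply: eq_bigr => n _; rewrite /dterm mulr1.
  have S1 := natpowN_head M d0; have S2 := natpowN_tail M.+1 d0 (ltn0Sn 0).
  rewrite !powR1 /= in S2.
  have -> : 1 - rC d * dser (fun=> 1) (1 + d) =
    rC (1 - d * S) - rC d * (dser (fun=> 1) (1 + d) - rC S) by rewrite rCB rCM rC1; ring.
  rewrite SE in h1.
  apply: le_trans (ler_nCB _ _) _; rewrite nCM !nC_rC (ger0_norm (ltW d0)).
  have : d * nC (dser (fun=> 1) (1 + d) - rC S) <= e / 2 by rewrite mulrC -ler_pdivlMr.
  have : `|1 - d * S| <= d + e / 2.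
    move: S1; rewrite ler_pdivrMr // -/S => S1.
    have {}S2 : S * d <= d + 1.
      by have := ler_wpM2r (ltW d0) S2; rewrite mulrDl div1r mulVf ?lt0r_neq0 // mul1r.
    have e0R : (0 : R) < e := e0.
    clear -S1 S2 h2 d0 e0R; rewrite ler_norml; apply/andP; split; lra.
  by move=> h3 h4; apply: le_trans (lerD h3 h4) _; rewrite -addrA -splitr.
exact: cvg_cst.
Unshelve. all: by end_near. Qed.

(** Subtracting the mean leaves a balanced series, bounded near [1]; the pole comes from the
    constant part, with residue [mu]. *)
Lemma dser_mean_cvg f (q : nat) (mu : R) : (0 < q)%N -> (forall n, f (n + q)%N = f n) ->
    (forall n, nC (f n) <= 1) -> 0 <= mu <= 1 -> \sum_(0 <= n < q) f n = rC (q%:R * mu) ->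
  rC d * dser f (1 + d) @[d --> 0^'+] --> rC mu.
Proof.
move=> q0 fq f1 /andP[mu0 mu1] fmu.
pose g n := f n - rC mu.
have gq n : g (n + q)%N = g n by rewrite /g fq.
have gb n : nC (g n) <= 2 by apply: le_trans (ler_nCB _ _) _; have := f1 n; rewrite nC_rC ger0_norm //; lra.
have g0 : \sum_(0 <= n < q) g n = 0.
  by rewrite sumrB sumr_const_nat subn0 -mulr_natl fmu rCM rC_nat subrr.
have one1 (n : nat) : nC (1 : C) <= 1 by rewrite nC1.
have E d : 0 < d -> dser f (1 + d) = dser g (1 + d) + rC mu * dser (fun=> 1) (1 + d).
  move=> d0; apply: dser_lim.
  have h1 := dser_balanced_cvg q0 gq g0 gb (addr_gt0 ltr01 d0).
  have h2 := cvgMl_tmp (a := rC mu) (dser_absolute_cvg one1 d0).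
  apply: cvg_trans (cvgD h1 (h2 _)); apply: near_eq_cvg; near=> M.
  rewrite fctE mulr_sumr -big_split /=; apply: eq_bigr => n _.
  by rewrite /dterm /g; ring.
have h1 : rC d * dser g (1 + d) @[d --> 0^'+] --> (0 : C).
  rewrite -(mul0r (dser g 1)); apply: cvgM; last exact: (dser_balanced_right_cvg q0 gq g0 gb).
  by apply: cvg_rC; exact: cvg_at_right_filter cvg_id.
have h2 := cvgMl_tmp (a := rC mu) dser_one_cvg.
rewrite -[rC mu]add0r -[X in _ + X]mulr1.
apply: cvg_trans (cvgD h1 (h2 _)); apply: near_eq_cvg; near=> d.
rewrite fctE /= E; last by near: d; exact: nbhs_right_gt.
ring.
Unshelve. all: by end_near. Qed.

End DirichletSeries.

(** * Non-vanishing at 1 for real characters *)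

Section RealCharacter.
Variable R : realType.
Variables (f : nat -> R).
Hypotheses (f1 : f 1%N = 1) (fM : forall m n, f (m * n)%N = f m * f n).
Hypothesis (f3 : forall n, [\/ f n = 1, f n = 0 | f n = -1]).

(** The coefficients of [zeta(s) L(s, f)]. *)
Definition divisor_sum n : R := \sum_(1 <= d < n.+1 | (d %| n)%N) f d.

Lemma divisor_sum1 : divisor_sum 1 = 1.
Proof. by rewrite /divisor_sum big_mkcond big_nat1 /= f1. Qed.

Lemma divisor_sum_bound n M : (0 < n)%N -> (n <= M)%N ->
  divisor_sum n = \sum_(1 <= d < M.+1 | (d %| n)%N) f d.
Proof.
move=> n0 nM; rewrite /divisor_sum (big_nat_widen _ _ M.+1) //; apply: eq_bigl => d.
by case dn : (d %| n)%N => //=; rewrite ltnS dvdn_leq.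
Qed.

(** The divisors prime to [p] are those of [m]; the others are [p] times a divisor of
    [p ^ k * m]. *)
Lemma divisor_sum_step p k m : prime p -> coprime p m -> (0 < m)%N ->
  divisor_sum (p ^ k.+1 * m) = divisor_sum m + f p * divisor_sum (p ^ k * m).
Proof.
move=> pp pm m0; have p0 := prime_gt0 pp.
have [pk pk1] : (0 < p ^ k * m)%N /\ (0 < p ^ k.+1 * m)%N by rewrite !muln_gt0 !expn_gt0 p0 m0.
rewrite {1}/divisor_sum (bigID (fun d => p %| d)%N) /= addrC; congr (_ + _).
  rewrite (@divisor_sum_bound m (p ^ k.+1 * m)) // ?leq_pmull ?expn_gt0 ?p0 //.
  apply: eq_bigl => d; apply/andP/idP => [[dm pd]|dm].
    by rewrite -(@Gauss_dvdr d (p ^ k.+1)) // coprime_sym coprimeXl // prime_coprime.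
  split; first exact: dvdn_mull.
  rewrite -prime_coprime //; exact: coprime_dvdr dm pm.
rewrite sum_multiples // mulr_sumr expnS -mulnA mulKn //.
by apply: eq_big => [d|d _]; [rewrite dvdn_pmul2l | rewrite fM].
Qed.

Lemma divisor_sum_pow p k m : prime p -> coprime p m -> (0 < m)%N -> 0 <= divisor_sum m ->
  0 <= divisor_sum (p ^ k * m) /\ (~~ odd k -> divisor_sum m <= divisor_sum (p ^ k * m)).
Proof.
move=> pp pm m0 r0.
(* The factor at [p] is [1 + f p + ... + f p ^ k]: at least [1] when [f p] is [1] or [0],
   alternately [1] and [0] when it is [-1]. The induction has to carry the parity. *)
have H : [/\ 0 <= divisor_sum (p ^ k * m), ~~ odd k -> divisor_sum m <= divisor_sum (p ^ k * m),
     f p <> -1 -> divisor_sum m <= divisor_sum (p ^ k * m),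
     f p = -1 -> ~~ odd k -> divisor_sum (p ^ k * m) = divisor_sum m &
     f p = -1 -> odd k -> divisor_sum (p ^ k * m) = 0].
  elim: k => [|k [h0 h1 h2 h3 h4]]; first by rewrite mul1n.
  rewrite divisor_sum_step //.
  have [fp|fp|fp] := f3 p; rewrite fp ?mul1r ?mul0r ?addr0.
  - have N1 : (1 : R) <> -1 by move/eqP; rewrite -addr_eq0 -mulr2n pnatr_eq0.
    by split=> //; first [by move=> /N1 | by rewrite addr_ge0 | by move=> _; rewrite lerDl].
  - have N1 : (0 : R) <> -1 by move/eqP; rewrite eq_sym oppr_eq0 oner_eq0.
    by split=> //; move=> /N1.
  - rewrite mulN1r /=; case ko : (odd k) => /=.
      by rewrite h4 // subr0; split.
    by rewrite h3 ?ko // subrr; split.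
by case: H.
Qed.

Lemma divisor_sum_ge0 n : (0 < n)%N -> 0 <= divisor_sum n.
Proof.
elim/ltn_ind: n => n IH n0.
have [n1|n1] := leqP n 1; first by have -> : n = 1%N by [apply/eqP; rewrite eqn_leq n1]; rewrite divisor_sum1.
have pp := pdiv_prime n1.
have [m pm nE] := pfactor_coprime pp n0.
have m0 : (0 < m)%N by move: n0; rewrite nE; case: m {pm nE}.
have k0 : (0 < logn (pdiv n) n)%N by rewrite logn_gt0 mem_primes pp n0 pdiv_dvd.
rewrite nE mulnC; have [] // := divisor_sum_pow (logn (pdiv n) n) pp pm m0.
apply: IH => //; rewrite [X in (_ < X)%N]nE -{1}[m]muln1 ltn_pmul2l //.
by rewrite -(expn0 (pdiv n)) ltn_exp2l // prime_gt1.
Qed.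

Lemma divisor_sum_square j : (0 < j)%N -> 1 <= divisor_sum (j ^ 2).
Proof.
elim/ltn_ind: j => j IH j0.
have [j1|j1] := leqP j 1; first by have -> : j = 1%N by [apply/eqP; rewrite eqn_leq j1]; rewrite exp1n divisor_sum1.
have pp := pdiv_prime j1.
have [m pm jE] := pfactor_coprime pp j0.
have m0 : (0 < m)%N by move: j0; rewrite jE; case: m {pm jE}.
have k0 : (0 < logn (pdiv j) j)%N by rewrite logn_gt0 mem_primes pp j0 pdiv_dvd.
have m20 : (0 < m ^ 2)%N by rewrite expn_gt0 m0.
have H := IH m _ m0.
rewrite jE expnMn mulnC -expnM muln2; have [_ h] := divisor_sum_pow (logn (pdiv j) j).*2 pp (coprimeXr 2 pm) m20 (divisor_sum_ge0 m20).
apply: le_trans (h _); last by rewrite odd_double.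
apply: H; rewrite [X in (_ < X)%N]jE -{1}[m]muln1 ltn_pmul2l //.
by rewrite -(expn0 (pdiv j)) ltn_exp2l // prime_gt1.
Qed.

(* The summand is nonnegative and at least [1 / m] at [n = m ^ 2]. *)
Lemma hyperbola_lower N :
  ln N.+1%:R <= \sum_(1 <= n < (N ^ 2).+1) divisor_sum n / Num.sqrt (n%:R : R).
Proof.
have g0 n : (0 < n)%N -> 0 <= divisor_sum n / Num.sqrt (n%:R : R).
  by move=> n0; rewrite divr_ge0 ?divisor_sum_ge0 ?sqrtr_ge0.
elim: N => [|N IH]; first by rewrite ln1 big_geq.
have NN : (N ^ 2 < N.+1 ^ 2)%N by rewrite ltn_exp2r.
rewrite (big_cat_nat (n := (N ^ 2).+1)) //=; last by rewrite ltnS ltnW.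
have [_ h] := @ln_succ_bounds R N.+1 (ltn0Sn N).
rewrite -[ln _](subrK (ln N.+1%:R)) addrC; apply: lerD => //.
rewrite big_nat_recr //=; apply: le_trans h _.
rewrite -[leLHS]add0r; apply: lerD.
  by rewrite big_nat; apply: sumr_ge0 => n /andP[Nn _]; apply: g0; apply: leq_trans Nn.
rewrite natrX sqrtr_sqr ger0_norm // -[leLHS]mul1r; apply: ler_wpM2r; first by rewrite invr_ge0.
exact: divisor_sum_square.
Qed.

Variable q : nat.
Hypotheses (q0 : (0 < q)%N) (fq : forall n, f (n + q)%N = f n) (fs : \sum_(0 <= n < q) f n = 0).

Lemma f_le1 n : `|f n| <= 1.
Proof. by case: (f3 n) => ->; rewrite ?normr1 ?normr0 ?normrN1. Qed.

Lemma real_abel_bound (w : nat -> R) N M :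
    (forall n, (N <= n)%N -> 0 <= w n) -> (forall n, (N <= n)%N -> w n.+1 <= w n) ->
  `|\sum_(N <= n < M) w n * f n| <= q%:R * w N.
Proof.
move=> w0 wS; rewrite -nC_rC rC_sum; under eq_bigr do rewrite rCM.
apply: (@abel_bound R w (fun n => rC (f n)) q%:R N M) => // K.
rewrite -[q%:R]mulr1; apply: periodic_sum_bound => //.
- by move=> n; rewrite fq.
- by rewrite -rC_sum fs rC0.
- by move=> n; rewrite nC_rC f_le1.
Qed.

Let A k : R := \sum_(1 <= m < k.+1) (Num.sqrt m%:R)^-1.

Lemma sqrtS_bounds k : (0 < k)%N ->
  2 * (Num.sqrt k.+1%:R - Num.sqrt k%:R) <= (Num.sqrt (k%:R : R))^-1 /\
  (Num.sqrt (k.+1%:R : R))^-1 <= 2 * (Num.sqrt k.+1%:R - Num.sqrt k%:R).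
Proof.
move=> k0.
have a0 : 0 < Num.sqrt (k%:R : R) by rewrite sqrtr_gt0 ltr0n.
have b0 : 0 < Num.sqrt (k.+1%:R : R) by rewrite sqrtr_gt0 ltr0n.
have aE : Num.sqrt (k%:R : R) ^+ 2 = k%:R by rewrite sqr_sqrtr.
have bE : Num.sqrt (k.+1%:R : R) ^+ 2 = k%:R + 1 by rewrite sqr_sqrtr // natr1.
move: a0 b0 aE bE; set a := Num.sqrt k%:R; set b := Num.sqrt _ => a0 b0 aE bE.
have vb : b^-1 * b = 1 by rewrite mulVf // lt0r_neq0.
have va : a^-1 * a = 1 by rewrite mulVf // lt0r_neq0.
have ab : a <= b by rewrite -(@ler_pXn2r _ 2) ?nnegrE ?(ltW a0) ?(ltW b0) // aE bE lerDl.
have H : (b - a) * (b + a) = 1 by have := bE; rewrite -aE; lra.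
by split; [rewrite -(ler_pM2r a0) va | rewrite -(ler_pM2r b0) vb]; nra.
Qed.

(** [A k - 2 sqrt k] decreases while [A k - 2 sqrt (k + 1)] increases, and the two differ by at most
    [1 / sqrt k]. *)
Lemma sqrt_sum_error N k : (0 < N)%N -> (N <= k)%N ->
  (A N - 2 * Num.sqrt N%:R) - (Num.sqrt N%:R)^-1 <= A k - 2 * Num.sqrt k%:R <= A N - 2 * Num.sqrt N%:R.
Proof.
move=> N0 Nk; have up : A k - 2 * Num.sqrt k%:R <= A N - 2 * Num.sqrt N%:R.
  elim: k Nk => [|k IH]; first by case: N N0.
  rewrite leq_eqVlt => /predU1P[->//|]; rewrite ltnS => Nk.
  have [_ h] := sqrtS_bounds (leq_trans N0 Nk).
  by have := IH Nk; rewrite {3}/A big_nat_recr //= -/(A k); lra.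
have lo : A N - 2 * Num.sqrt N.+1%:R <= A k - 2 * Num.sqrt k.+1%:R.
  elim: k {up} Nk => [|k IH]; first by case: N N0.
  rewrite leq_eqVlt => /predU1P[->//|]; rewrite ltnS => Nk.
  have [h _] := sqrtS_bounds (ltn0Sn k).
  by have := IH Nk; rewrite {4}/A big_nat_recr //= -/(A k); lra.
rewrite up andbT; have [h1 _] := sqrtS_bounds N0.
have : Num.sqrt k%:R <= Num.sqrt k.+1%:R :> R by rewrite ler_sqrt // ler_nat.
lra.
Qed.

Lemma sqrt_sum_bounds N : -2 <= A N - 2 * Num.sqrt N%:R <= 0.
Proof.
have [->|N0] := posnP N; first by rewrite /A big_geq // sqrtr0; lra.
have := @sqrt_sum_error 1 N (ltn0Sn 0) N0.
by rewrite /A big_nat1 sqrtr1 invr1 => /andP[h1 h2]; apply/andP; split; lra.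
Qed.

Lemma hyperbola_sumE N :
  \sum_(1 <= n < (N ^ 2).+1) divisor_sum n / Num.sqrt (n%:R : R) =
  \sum_(1 <= d < (N ^ 2).+1) (Num.sqrt d%:R)^-1 * f d * A (N ^ 2 %/ d).
Proof.
transitivity (\sum_(1 <= n < (N ^ 2).+1) \sum_(1 <= d < (N ^ 2).+1)
    if (d %| n)%N then f d / Num.sqrt (n%:R : R) else 0).
  rewrite big_nat [RHS]big_nat; apply: eq_bigr => n /andP[n0 nN].
  by rewrite (@divisor_sum_bound n (N ^ 2)) // mulr_suml big_mkcond.
rewrite exchange_big /= big_nat [RHS]big_nat; apply: eq_bigr => d /andP[d0 dN].
rewrite -big_mkcond /= (sum_multiples _ xpredT) // mulr_sumr; apply: eq_bigr => m _.
by rewrite natrM sqrtrM // invfM; ring.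
Qed.

(** As [k >= N], the constant in [A k = 2 sqrt k + constant + O(1 / sqrt k)] may be read off at [N],
    hence is the same for all [d]. One [1 / sqrt N] pays for this, the other for the rounding of
    [N^2 / d] to [k]. *)
Lemma hyperbola_head N d : (0 < N)%N -> (0 < d)%N -> (d <= N)%N ->
  `|A (N ^ 2 %/ d) - 2 * (N%:R / Num.sqrt d%:R) - (A N - 2 * Num.sqrt N%:R)| <= 2 / Num.sqrt N%:R.
Proof.
move=> N0 d0 dN; set k := (N ^ 2 %/ d)%N.
have Nk : (N <= k)%N by rewrite leq_divRL // -mulnn leq_mul2l dN orbT.
have dR : (0 : R) < d%:R by rewrite ltr0n.
have yE : N%:R / Num.sqrt d%:R = Num.sqrt (N%:R ^+ 2 / d%:R) :> R.
  by rewrite sqrtrM ?sqr_ge0 // sqrtr_sqr ger0_norm // sqrtrV // ltW.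
have ky : k%:R <= N%:R ^+ 2 / d%:R :> R by rewrite ler_pdivlMr // -natrX -natrM ler_nat leq_trunc_div.
have yk : N%:R ^+ 2 / d%:R <= k.+1%:R :> R.
  by rewrite ler_pdivrMr // -natrX -natrM ler_nat ltnW // ltn_ceil.
have h1 : Num.sqrt k%:R <= N%:R / Num.sqrt d%:R :> R.
  by rewrite yE ler_sqrt // (le_trans _ ky).
have h2 : N%:R / Num.sqrt d%:R <= Num.sqrt k.+1%:R :> R by rewrite yE ler_sqrt.
have [h3 _] := sqrtS_bounds (leq_trans N0 Nk).
have h4 : (Num.sqrt (k%:R : R))^-1 <= (Num.sqrt N%:R)^-1.
  by rewrite lef_pV2 ?posrE ?sqrtr_gt0 ?ltr0n ?(leq_trans N0) // ler_sqrt // ler_nat.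
have /andP[h5 h6] := sqrt_sum_error N0 Nk.
rewrite mulr_natl [(_ : R) *+ 2]mulr2n ler_norml; apply/andP; split; lra.
Qed.

(** In a product [m d <= N^2], [d > N] forces [m <= N]. With the sum over [d] inside, Abel summation
    gives [q / sqrt N] for each [m], and the [1 / sqrt m] add up to at most [2 sqrt N]. *)
Lemma hyperbola_tail N : (0 < N)%N ->
  `|\sum_(N.+1 <= d < (N ^ 2).+1) (Num.sqrt d%:R)^-1 * f d * A (N ^ 2 %/ d)| <= 2 * q%:R.
Proof.
move=> N0.
have sN : 0 < Num.sqrt (N%:R : R) by rewrite sqrtr_gt0 ltr0n.
have -> : \sum_(N.+1 <= d < (N ^ 2).+1) (Num.sqrt d%:R)^-1 * f d * A (N ^ 2 %/ d) =
    \sum_(1 <= m < N.+1) (Num.sqrt m%:R)^-1 * \sum_(N.+1 <= d < (N ^ 2 %/ m).+1) (Num.sqrt d%:R)^-1 * f d.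
  transitivity (\sum_(N.+1 <= d < (N ^ 2).+1) \sum_(1 <= m < N.+1)
      if (m * d <= N ^ 2)%N then (Num.sqrt m%:R)^-1 * ((Num.sqrt d%:R)^-1 * f d) else 0 : R).
    rewrite big_nat [RHS]big_nat; apply: eq_bigr => d /andP[Nd dN].
    have d0 : (0 < d)%N by apply: leq_trans Nd.
    rewrite /A (big_nat_widen _ _ N.+1); last first.
      by rewrite ltnS -[X in (_ <= X)%N](mulKn N d0) leq_div2r // -mulnn leq_mul2r ltnW ?orbT.
    rewrite mulr_sumr big_mkcond; apply: eq_bigr => m _ /=.
    by rewrite ltnS leq_divRL //; case: ifP => // _; ring.
  rewrite exchange_big /= big_nat [RHS]big_nat; apply: eq_bigr => m /andP[m0 mN].
  rewrite [X in _ * X](big_nat_widen _ _ (N ^ 2).+1); last by rewrite ltnS leq_div.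
  rewrite mulr_sumr [RHS]big_mkcond; apply: eq_bigr => d _ /=.
  by rewrite ltnS leq_divRL // mulnC.
apply: le_trans (ler_norm_sum _ _ _) _.
apply: (@le_trans _ _ (\sum_(1 <= m < N.+1) (Num.sqrt m%:R)^-1 * (q%:R / Num.sqrt N%:R))).
  apply: ler_sum_nat => m /andP[m0 _]; rewrite normrM ger0_norm ?invr_ge0 ?sqrtr_ge0 //.
  apply: ler_wpM2l; first by rewrite invr_ge0 sqrtr_ge0.
  apply: le_trans (@real_abel_bound (fun d => (Num.sqrt d%:R)^-1) _ _ _ _) _.
  - by move=> n _; rewrite invr_ge0 sqrtr_ge0.
  - move=> n Nn; have n0 : (0 < n)%N by apply: leq_trans Nn.
    by rewrite lef_pV2 ?posrE ?sqrtr_gt0 ?ltr0n // ler_sqrt // ler_nat.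
  - apply: ler_wpM2l => //.
    by rewrite lef_pV2 ?posrE ?sqrtr_gt0 ?ltr0n // ler_sqrt // ler_nat.
rewrite -mulr_suml mulrA ler_pdivrMr // -mulrA [q%:R * _]mulrC mulrA.
by apply: ler_wpM2r => //; exact: sum_invsqrt_le.
Qed.

(* Dirichlet's hyperbola method: the divisor sum is split according to whether
   [d <= N]; the main term is [2 N] times the partial sum of [L(1, f)], which is
   [O(1 / N)] when [L(1, f) = 0]. *)
Lemma hyperbola_upper N : (0 < N)%N ->
    `|\sum_(1 <= n < N.+1) f n / n%:R| <= q%:R / N.+1%:R ->
  \sum_(1 <= n < (N ^ 2).+1) divisor_sum n / Num.sqrt (n%:R : R) <= 6 * q%:R + 4.
Proof.
move=> N0 hL; rewrite hyperbola_sumE (big_cat_nat (n := N.+1)) //=; last first.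
  by rewrite ltnS -mulnn leq_pmull.
have ht := le_trans (ler_norm _) (hyperbola_tail N0).
have sN : 0 < Num.sqrt (N%:R : R) by rewrite sqrtr_gt0 ltr0n.
pose K : R := A N - 2 * Num.sqrt N%:R.
pose e d : R := A (N ^ 2 %/ d) - 2 * (N%:R / Num.sqrt d%:R) - K.
(* The three parts are at most [2 q] by hypothesis, [2 q] by Abel summation, and [4] by
   [hyperbola_head]; the tail adds another [2 q]. *)
have E : \sum_(1 <= d < N.+1) (Num.sqrt d%:R)^-1 * f d * A (N ^ 2 %/ d) =
   2 * N%:R * \sum_(1 <= d < N.+1) f d / d%:R + K * \sum_(1 <= d < N.+1) (Num.sqrt d%:R)^-1 * f d +
   \sum_(1 <= d < N.+1) (Num.sqrt d%:R)^-1 * f d * e d.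
  rewrite !mulr_sumr -!big_split /= big_nat [RHS]big_nat; apply: eq_bigr => d /andP[d0 dN].
  have sd : Num.sqrt (d%:R : R) != 0 by rewrite lt0r_neq0 // sqrtr_gt0 ltr0n.
  rewrite /e; have -> : d%:R = Num.sqrt (d%:R : R) ^+ 2 by rewrite sqr_sqrtr.
  by rewrite sqrtr_sqr ger0_norm ?sqrtr_ge0 //; field.
have b1 : 2 * N%:R * \sum_(1 <= d < N.+1) f d / d%:R <= 2 * q%:R.
  have NS : (0 : R) < N.+1%:R by rewrite ltr0n.
  have := le_trans (ler_norm _) hL; rewrite ler_pdivlMr // => h.
  set s := \sum_(1 <= d < N.+1) _ in h *.
  have := hL; rewrite -/s ler_pdivlMr // => h'.
  have s0 := normr_ge0 s; have ss := ler_norm s; rewrite -natr1 in h'.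
  have N1 : 0 <= (N%:R : R) := ler0n _ _.
  nra.
have b2 : K * \sum_(1 <= d < N.+1) (Num.sqrt d%:R)^-1 * f d <= 2 * q%:R.
  apply: le_trans (ler_norm _) _; rewrite normrM; apply: ler_pM => //.
    by have /andP[h1 h2] := sqrt_sum_bounds N; rewrite ler_norml; apply/andP; split; rewrite /K; lra.
  apply: le_trans (@real_abel_bound (fun d => (Num.sqrt d%:R)^-1) _ _ _ _) _.
  - by move=> n _; rewrite invr_ge0 sqrtr_ge0.
  - by move=> n n0; rewrite lef_pV2 ?posrE ?sqrtr_gt0 ?ltr0n // ler_sqrt // ler_nat.
  - by rewrite sqrtr1 invr1 mulr1.
have b3 : \sum_(1 <= d < N.+1) (Num.sqrt d%:R)^-1 * f d * e d <= 4.
  apply: (@le_trans _ _ (\sum_(1 <= d < N.+1) (Num.sqrt d%:R)^-1 * (2 / Num.sqrt N%:R))).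
    apply: ler_sum_nat => d /andP[d0 dN]; apply: le_trans (ler_norm _) _.
    rewrite -mulrA normrM ger0_norm ?invr_ge0 ?sqrtr_ge0 //; apply: ler_wpM2l; first by rewrite invr_ge0 sqrtr_ge0.
    by rewrite normrM -[leRHS]mul1r; apply: ler_pM => //; [exact: f_le1 | exact: hyperbola_head].
  rewrite -mulr_suml mulrA ler_pdivrMr //.
  by have := sum_invsqrt_le R N; lra.
by rewrite E; move: ht b1 b2 b3; lra.
Qed.

(** The refuted hypothesis is what the Abel tail bound becomes when [L(1, f) = 0]. It would bound by
    [6 q + 4] sums that are at least [ln (N + 1)] for every [N]. *)
Lemma real_L1_neq0 : ~ (forall N, (0 < N)%N -> `|\sum_(1 <= n < N) f n / n%:R| <= q%:R / N%:R).
Proof.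
move=> hL; pose B : R := 6 * q%:R + 4.
pose N := (Num.truncn (expR B)).+1.
have : ln (N.+1%:R : R) <= B.
  by apply: le_trans (hyperbola_lower N) _; apply: hyperbola_upper => //; exact: hL.
apply/negP; rewrite -ltNge -[B]expRK ltr_ln ?posrE ?expR_gt0 ?ltr0n //.
by apply: lt_le_trans (truncnS_gt _) _; rewrite ler_nat /N.
Qed.

End RealCharacter.

(** * Dirichlet characters and L-functions *)

Section CharactersMod.
Variable R : realType.
Local Notation C := (Cplx R).
Variable q : nat.
Hypothesis q1 : (1 < q)%N.
Local Notation Zq := 'Z_q.
Local Notation Uq := {unit 'Z_q}.
Implicit Types (chi : Zq -> C).

Definition chi_ext (g : Uq -> C) : Zq -> C := fun x => oapp g 0 (insub x).

Lemma unit_lift (x : Zq) : x \is a GRing.unit -> exists u : Uq, x = val u.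
Proof. by move=> xu; exists (Sub x xu); rewrite SubK. Qed.

Lemma chi_ext_unit g (u : Uq) : chi_ext g (val u) = g u.
Proof. by rewrite /chi_ext valK. Qed.

Lemma chi_ext_nonunit g (x : Zq) : x \isn't a GRing.unit -> chi_ext g x = 0.
Proof. by move=> xu; rewrite /chi_ext insubN. Qed.

Lemma is_char_neq0 (g : Uq -> C) u : is_char g -> g u != 0.
Proof.
move=> [g1 gM]; apply/eqP => gu; have := gM u (u^-1)%g.
by rewrite mulgV g1 gu mul0r => /eqP; rewrite oner_eq0.
Qed.

Lemma dirichlet_chi_ext g : is_char g -> @dirichlet_character R q (chi_ext g).
Proof.
move=> gc; have [g1 gM] := gc; split.
- by rewrite -(FinRing.val_unit1) chi_ext_unit.
- move=> x y.
  have [xu|xu] := boolP (x \is a GRing.unit); last first.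
    by rewrite [in RHS](chi_ext_nonunit g xu) mul0r chi_ext_nonunit // unitrM negb_and xu.
  have [yu|yu] := boolP (y \is a GRing.unit); last first.
    by rewrite [in RHS](chi_ext_nonunit g yu) mulr0 chi_ext_nonunit // unitrM negb_and yu orbT.
  have [u ->] := unit_lift xu; have [v ->] := unit_lift yu.
  by rewrite -FinRing.val_unitM !chi_ext_unit gM.
- move=> x; have [xu|xu] := boolP (x \is a GRing.unit); last by rewrite chi_ext_nonunit // eqxx.
  by have [u ->] := unit_lift xu; rewrite chi_ext_unit is_char_neq0.
Qed.

Lemma chi_restrict chi : @dirichlet_character R q chi ->
  is_char (fun u : Uq => chi (val u)) /\ chi_ext (fun u : Uq => chi (val u)) = chi.
Proof.
move=> [c1 cM cu]; split; first by split=> [|x y]; rewrite ?FinRing.val_unit1 ?FinRing.val_unitM.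
apply/funext => x; have [xu|xu] := boolP (x \is a GRing.unit).
  by have [u ->] := unit_lift xu; rewrite chi_ext_unit.
by rewrite chi_ext_nonunit //; apply/esym/eqP; move: (cu x); rewrite (negbTE xu) => /negbFE.
Qed.

Lemma card_Uq : #|{: Uq}| = totient q.
Proof. by rewrite -card_units_Zp ?(ltnW q1) // cardsT. Qed.

(** Indexing by an ordinal turns products over all characters into ordinary big operators;
    injectivity and exhaustiveness allow the return to the classical set in [Pi1]. *)
Lemma dirichlet_family : exists Y : 'I_#|{: Uq}| -> Zq -> C,
  [/\ forall i, @dirichlet_character R q (Y i), injective Y,
      forall chi, @dirichlet_character R q chi -> exists i, chi = Y i &
      forall (u : Uq) z, \prod_i (1 - Y i (val u) * z) = (1 - z ^+ #[u]%g) ^+ (totient q %/ #[u]%g)%N].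
Proof.
have gC (x y : Uq) : (x * y = y * x)%g by apply: val_inj; rewrite !FinRing.val_unitM mulrC.
have [X [Xc Xi Xs Xsum]] := char_family C gC.
exists (fun i => chi_ext (X i)); split.
- by move=> i; exact: dirichlet_chi_ext.
- move=> i j e; apply: Xi; apply/funext => u.
  by rewrite -[LHS]chi_ext_unit e chi_ext_unit.
- move=> chi cc; have [rc re] := chi_restrict cc; have [i Hi] := Xs _ rc.
  by exists i; rewrite -re; congr chi_ext; apply/funext.
- move=> u z; under eq_bigr do rewrite chi_ext_unit.
  by rewrite -card_Uq (prod_char_eval u z Xc Xsum).
Qed.

Lemma Zq_nat_sum (F : Zq -> C) : \sum_(0 <= n < q) F n%:R = \sum_x F x.
Proof.
rewrite -{1}(Zp_cast q1) big_mkord; apply: eq_bigr => i _; by rewrite natr_Zp.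
Qed.

Lemma nat_period n : (n + q)%:R = n%:R :> Zq.
Proof. by rewrite natrD pchar_Zp // addr0. Qed.

Lemma unit_nat n : ((n%:R : Zq) \is a GRing.unit) = coprime q n.
Proof. exact: unitZpE. Qed.

Lemma nC_unity (z : C) n : (0 < n)%N -> z ^+ n = 1 -> nC z = 1.
Proof.
move=> n0 zn; have : nC z ^+ n = 1.
  have -> : nC z ^+ n = nC (z ^+ n) by elim: n {n0 zn} => [|n IH]; rewrite ?expr0 ?nC1 // !exprS nCM IH.
  by rewrite zn nC1.
by move/eqP; rewrite pexpr_eq1 ?nC_ge0 // => /eqP.
Qed.

Lemma dirichlet_unity chi (u : Uq) : @dirichlet_character R q chi -> chi (val u) ^+ #[u]%g = 1.
Proof.
move=> /chi_restrict[rc _]; have := is_charX rc u #[u]%g.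
by rewrite expg_order; case: rc => -> _ ->.
Qed.

Lemma dirichlet_le1 chi x : @dirichlet_character R q chi -> nC (chi x) <= 1.
Proof.
move=> cc; have [xu|xu] := boolP (x \is a GRing.unit).
  by have [u ->] := unit_lift xu; rewrite (nC_unity (order_gt0 _) (dirichlet_unity _ cc)).
by case: cc => _ _ cu; move: (cu x); rewrite (negbTE xu) => /negbFE/eqP ->; rewrite nC0.
Qed.

Lemma principal_dirichlet : @dirichlet_character R q (@principal_character R q).
Proof.
split=> [|x y|x]; rewrite /principal_character ?unitr1 //.
  by rewrite unitrM; case: (x \is a GRing.unit); case: (y \is a GRing.unit); rewrite ?mulr1 ?mulr0 ?mul0r.
by case: (x \is a GRing.unit); rewrite /= ?oner_eq0 ?eqxx.
Qed.

Lemma principal_sum : \sum_(0 <= n < q) @principal_character R q n%:R = rC (totient q)%:R.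
Proof.
rewrite totient_count_coprime natr_sum rC_sum; apply: eq_bigr => n _.
by rewrite /principal_character unit_nat rC_nat.
Qed.

(** Multiplication by a unit [u] with [chi u] different from [1] permutes the residues, so the sum
    equals [chi u] times itself. *)
Lemma nonprincipal_sum chi : @dirichlet_character R q chi -> chi <> @principal_character R q ->
  \sum_(0 <= n < q) chi n%:R = 0.
Proof.
move=> cc nc; have [c1 cM cu] := cc.
have [u cu1] : exists u : Uq, chi (val u) != 1.
  apply/not_existsP => H; apply: nc; apply/funext => x; rewrite /principal_character.
  have [xu|xu] := boolP (x \is a GRing.unit).
    by have [u ->] := unit_lift xu; apply/eqP/negPn/negP; exact: H.
  by move: (cu x); rewrite (negbTE xu) => /negbFE/eqP.
rewrite Zq_nat_sum; have : chi (val u) * \sum_x chi x = \sum_x chi x.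
  rewrite mulr_sumr [RHS](reindex_inj (mulrI (valP u))) /=.
  by apply: eq_bigr => x _; rewrite cM.
move/eqP; rewrite -subr_eq0 -{2}[\sum_x _]mul1r -mulrBl mulf_eq0 subr_eq0 (negbTE cu1) /=.
by move/eqP.
Qed.

Lemma conj_dirichlet chi : @dirichlet_character R q chi ->
  @dirichlet_character R q (fun x => (chi x)^*%C).
Proof.
move=> [c1 cM cu]; split=> [|x y|x]; rewrite ?c1 ?cM.
- exact: conjc1.
- exact: (rmorphM (@conjc R)).
- by rewrite -cu; congr (~~ _); exact: (conjc_eq0 (chi x)).
Qed.

End CharactersMod.

(** * L-functions and their product over all characters *)

Section LFunctions.
Variable R : realType.
Local Notation C := (Cplx R).
Variable q : nat.
Hypothesis q1 : (1 < q)%N.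
Local Notation Zq := 'Z_q.
Local Notation Uq := {unit 'Z_q}.
Implicit Types (chi : Zq -> C) (d : R).

Definition nat_char chi n : C := chi n%:R.
Definition Lser chi s := dser (nat_char chi) s.

Lemma nat_charM chi : @dirichlet_character R q chi ->
  nat_char chi 1 = 1 /\ forall m n, nat_char chi (m * n) = nat_char chi m * nat_char chi n.
Proof. by move=> [c1 cM _]; split=> [|m n]; rewrite /nat_char ?natrM. Qed.

Lemma nat_char_period chi n : nat_char chi (n + q)%N = nat_char chi n.
Proof. by rewrite /nat_char nat_period. Qed.

Lemma nat_char_le1 chi : @dirichlet_character R q chi -> forall n, nC (nat_char chi n) <= 1.
Proof. by move=> cc n; exact: dirichlet_le1. Qed.

Lemma dirichlet_L1E chi : dirichlet_L 1 chi = Lser chi 1.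
Proof.
have e : (fun n => \sum_(1 <= k < n.+1) chi k%:R / (k%:R : C) ^+ 1) =
    (fun M => \sum_(1 <= n < M.+1) dterm (nat_char chi) 1 n).
  apply/funext => n; apply: eq_bigr => k _.
  by rewrite /dterm natpowN1 expr1 mulrC rCV rC_nat.
by rewrite /dirichlet_L e.
Qed.

(** Total on the naturals, with default [0] when [p] is not coprime to [q]; the sums over primes
    guard against that case. *)
Definition ord_mod p : nat := oapp (fun u : Uq => #[u]%g) 0%N (insub (p%:R : Zq)).

Lemma ord_modP p : coprime q p -> exists2 u : Uq, p%:R = val u & ord_mod p = #[u]%g.
Proof.
rewrite -(unit_nat q1) => pu; have [u uE] := unit_lift pu; exists u => //.
by rewrite /ord_mod uE valK.
Qed.

Definition euler_exponent p : R := (totient q)%:R / (ord_mod p)%:R.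

Definition euler_log p d : R := - (euler_exponent p * ln (1 - (p%:R `^ (- (1 + d))) ^+ ord_mod p)).

Lemma ord_mod_gt0 p : coprime q p -> (0 < ord_mod p)%N.
Proof. by move=> /ord_modP[u _ ->]; exact: order_gt0. Qed.

Lemma ord_mod_dvd p : coprime q p -> (ord_mod p %| totient q)%N.
Proof. by move=> /ord_modP[u _ ->]; rewrite -(card_Uq q1) -cardsT order_dvdG ?inE. Qed.

Lemma natpowN_lt1 p d : (1 < p)%N -> 0 <= d -> (p%:R : R) `^ (- (1 + d)) < 1.
Proof.
move=> p1 d0; apply: (@le_lt_trans _ _ (p%:R `^ (- 1))).
  by apply: (natpowN_lexp (ltnW p1)); rewrite lerDl.
by rewrite natpowN1 invf_lt1 ?ltr1n // ltr0n ltnW.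
Qed.

Lemma euler_factor_itv p d k : (1 < p)%N -> 0 <= d -> (0 < k)%N ->
  0 < 1 - (p%:R `^ (- (1 + d)) : R) ^+ k <= 1.
Proof.
move=> p1 d0 k0; have p0 := @natpowN_ge0 R p (1 + d).
apply/andP; split; last by rewrite lerBlDr lerDl exprn_ge0.
by rewrite subr_gt0 exprn_ilt1 ?natpowN_lt1 // -lt0n.
Qed.

Lemma prod_local_factor (Y : 'I_#|{: Uq}| -> Zq -> C) p d : prime p ->
    (forall i, @dirichlet_character R q (Y i)) ->
    (forall (u : Uq) z, \prod_i (1 - Y i (val u) * z) = (1 - z ^+ #[u]%g) ^+ (totient q %/ #[u]%g)%N) ->
  0 <= d ->
  \prod_i (1 - dterm (nat_char (Y i)) (1 + d) p) =
  rC (if coprime q p then expR (- euler_log p d) else 1).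
Proof.
move=> pp Yc Yp d0; case: ifPn => cqp; last first.
  rewrite rC1 big1 // => i _; rewrite /dterm /nat_char.
  have [_ _ cu] := Yc i; move: (cu p%:R); rewrite unit_nat // (negbTE cqp) => /negbFE/eqP ->.
  by rewrite mulr0 subr0.
have [u uE oE] := ord_modP cqp.
under eq_bigr do rewrite /dterm /nat_char uE mulrC.
rewrite Yp -rCX -rC1 -rCB -rCX /euler_log opprK oE; congr rC.
have /andP[e0 _] := euler_factor_itv (prime_gt1 pp) d0 (order_gt0 u).
rewrite -[LHS]lnK ?posrE ?exprn_gt0 // lnXn // /euler_exponent oE; congr expR.
rewrite -[LHS]mulr_natl; congr (_ * _).
have tE := divnK (ord_mod_dvd cqp); rewrite oE in tE.
by rewrite -{2}tE natrM mulfK // pnatr_eq0 -lt0n order_gt0.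
Qed.

(** The finite Euler products are multiplied over the characters first, which gives [exp (- S N)]
    with [S] nondecreasing. The limit [E] cannot be [0], as its product with the L-values is [1];
    then [W = - ln E]. The sign of [W] serves in [L1_neq0], where the product must be at least
    [1]. *)
Lemma prod_Lser (Y : 'I_#|{: Uq}| -> Zq -> C) d :
    (forall i, @dirichlet_character R q (Y i)) ->
    (forall (u : Uq) z, \prod_i (1 - Y i (val u) * z) = (1 - z ^+ #[u]%g) ^+ (totient q %/ #[u]%g)%N) ->
  0 < d -> exists W : R, [/\ 0 <= W,
    \sum_(0 <= p < N | prime p && coprime q p) euler_log p d @[N --> \oo] --> W &
    \prod_i Lser (Y i) (1 + d) = rC (expR W)].
Proof.
move=> Yc Yp d0; pose S N := \sum_(0 <= p < N | prime p && coprime q p) euler_log p d.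
have l0 p : prime p -> coprime q p -> 0 <= euler_log p d.
  move=> pp cp; rewrite /euler_log oppr_ge0; apply: mulr_ge0_le0; first by rewrite divr_ge0.
  by apply: ln_le0; have /andP[_] := euler_factor_itv (prime_gt1 pp) (ltW d0) (ord_mod_gt0 cp).
have H : \prod_i Lser (Y i) (1 + d) * rC (expR (- S N)) @[N --> \oo] --> (1 : C).
  have Hi i : Lser (Y i) (1 + d) * \prod_(0 <= p < N | prime p) (1 - dterm (nat_char (Y i)) (1 + d) p) @[N --> \oo] --> (1 : C).
    have [c1 cM] := nat_charM (Yc i).
    by apply: dser_euler => //; exact: nat_char_le1.
  have -> : (fun N => \prod_i Lser (Y i) (1 + d) * rC (expR (- S N))) =
      (fun N => \prod_i (Lser (Y i) (1 + d) * \prod_(0 <= p < N | prime p) (1 - dterm (nat_char (Y i)) (1 + d) p))).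
    apply/funext => N.
    rewrite big_split /=; congr (_ * _); rewrite [RHS]exchange_big /=.
    rewrite [RHS](eq_bigr (fun p => rC (if coprime q p then expR (- euler_log p d) else 1))); last first.
      by move=> p pp; apply: prod_local_factor => //; exact: ltW.
    rewrite -rC_prod /S -sumrN expR_sum; congr rC.
    by rewrite -big_mkcondr.
  have one : \prod_(i < #|{: Uq}|) (1 : C) = 1 by rewrite big1.
  have HB := @cvg_big C 'I_#|{: Uq}| *%R 1 xpredT (@mul_continuous C) nat \oo (index_enum _) _ _ _ (fun i _ => Hi i).
  by rewrite one in HB; exact: HB.
have Sm : {homo S : n m / (n <= m)%N >-> n <= m}.
  move=> n m nm; rewrite /S (big_cat_nat (n := n) (p := m)) //= lerDl.
  by apply: sumr_ge0 => p /andP[]; exact: l0.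
have Em : {homo (fun N => expR (- S N)) : n m / (n <= m)%N >-> m <= n}.
  by move=> n m nm; rewrite ler_expR lerN2 Sm.
have cE : cvgn (fun N => expR (- S N)).
  apply: nonincreasing_is_cvgn => //; exists 0 => _ [N _ <-]; exact: expR_ge0.
set E := limn (fun N => expR (- S N)) in cE.
have PE : \prod_i Lser (Y i) (1 + d) * rC E = 1.
  have HE := @cvgMl_tmp C nat \oo _ _ (\prod_i Lser (Y i) (1 + d)) _ (cvg_rC cE).
  exact: (cvg_unique (@norm_hausdorff _ _) (HE _ _) H).
have E0 : 0 < E.
  have : 0 <= E by apply: limr_ge => //; near=> N; exact: expR_ge0.
  rewrite le_eqVlt => /predU1P[e|//].
  by move: PE; rewrite -e rC0 mulr0 => /eqP; rewrite eq_sym oner_eq0.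
have E1 : E <= 1.
  apply: limr_le => //; near=> N; rewrite expR_le1 oppr_le0 /S.
  by apply: sumr_ge0 => p /andP[]; exact: l0.
exists (- ln E); split.
- by rewrite oppr_ge0 ln_le0.
- apply: cvg_trans (cvgN (continuous_cvg _ (continuous_ln E0) cE)); apply: near_eq_cvg; near=> N.
  by rewrite fctE /= expRK opprK.
- rewrite expRN lnK ?posrE // rCV; apply: (mulIf (x := rC E)).
    by rewrite -rC0 (inj_eq (@rC_inj R)) lt0r_neq0.
  by rewrite PE mulVf // -rC0 (inj_eq (@rC_inj R)) lt0r_neq0.
Unshelve. all: by end_near. Qed.

End LFunctions.

(** * Non-vanishing at 1 *)

Section Nonvanishing.
Variable R : realType.
Local Notation C := (Cplx R).
Variable q : nat.
Hypothesis q1 : (1 < q)%N.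
Local Notation Zq := 'Z_q.
Local Notation Uq := {unit 'Z_q}.
Local Notation principal := (@principal_character R q).
Implicit Types (chi : Zq -> C) (d : R).

Let q0 : (0 < q)%N := ltnW q1.

Lemma cvg_nC {T} (F : set_system T) {FF : Filter F} (u : T -> C) (l : C) :
  u x @[x --> F] --> l -> nC (u x) @[x --> F] --> nC l.
Proof.
move=> /cvgC/cvgrPdist_le H; apply/cvgrPdist_le => e /H; apply: filterS => x.
rewrite sub0r normrN ger0_norm ?nC_ge0 // => xe; apply: le_trans xe.
have h1 : nC l <= nC (l - u x) + nC (u x) by rewrite -{1}(subrK (u x) l) ler_nCD.
have h2 : nC (u x) <= nC (l - u x) + nC l by rewrite nC_distC -{1}(subrK l (u x)) ler_nCD.
by rewrite ler_norml; apply/andP; split; lra.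
Qed.

Lemma Lser_cvg chi s : @dirichlet_character R q chi -> chi <> principal -> 0 < s ->
  \sum_(1 <= n < M.+1) dterm (nat_char chi) s n @[M --> \oo] --> Lser chi s.
Proof.
move=> cc nc s0; exact: (dser_balanced_cvg q0 (nat_char_period q1 chi)
  (nonprincipal_sum q1 cc nc) (nat_char_le1 cc) s0).
Qed.

Lemma Lser_diff chi d N : @dirichlet_character R q chi -> chi <> principal -> 0 <= d -> (0 < N)%N ->
  nC (Lser chi (1 + d) - Lser chi 1) <= 2 * q%:R / N%:R + 4 * d * Num.sqrt N%:R.
Proof.
move=> cc nc d0 N0; have := @dser_balanced_diff R (nat_char chi) q 1 q0 (nat_char_period q1 chi)
  (nonprincipal_sum q1 cc nc) (nat_char_le1 cc) d N d0 N0.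
by rewrite !mulr1.
Qed.

Lemma Lser_right_cvg chi : @dirichlet_character R q chi -> chi <> principal ->
  Lser chi (1 + d) @[d --> 0^'+] --> Lser chi 1.
Proof.
move=> cc nc; exact: (dser_balanced_right_cvg q0 (nat_char_period q1 chi)
  (nonprincipal_sum q1 cc nc) (nat_char_le1 cc)).
Qed.

Lemma Lser_principal_cvg : rC d * Lser principal (1 + d) @[d --> 0^'+] --> rC ((totient q)%:R / q%:R).
Proof.
apply: (dser_mean_cvg q0 (nat_char_period q1 principal)).
- exact: (nat_char_le1 (principal_dirichlet R q)).
- rewrite divr_ge0 //= ler_pdivrMr ?ltr0n // mul1r ler_nat totient_count_coprime.
  rewrite -[leqRHS]card_ord -sum1_card big_mkord; apply: leq_sum => i _; exact: leq_b1.
- rewrite principal_sum //; congr rC; rewrite mulrCA divff ?mulr1 //.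
  by rewrite pnatr_eq0 -lt0n.
Qed.

Lemma Lser_conj chi : @dirichlet_character R q chi -> chi <> principal ->
  Lser (fun x => (chi x)^*%C) 1 = ((Lser chi 1)^*%C : C).
Proof.
move=> cc nc; apply: dser_lim; apply/cvgC.
have /cvgC := Lser_cvg cc nc ltr01; apply: cvg_trans; apply: near_eq_cvg; near=> M.
rewrite -nC_conj; congr nC; rewrite (rmorphB (@conjc R)) (rmorph_sum (@conjc R)); congr (_ - _).
apply: eq_bigr => n _; rewrite /dterm (rmorphM (@conjc R)); congr (_ * _).
exact: conjc_real.
Unshelve. all: by end_near. Qed.

(** Being real and of modulus [1] on units, [chi] takes only the values [1], [0], [-1]; a zero at
    [1] would give the estimate refuted by [real_L1_neq0]. *)
Lemma L1_real_neq0 chi : @dirichlet_character R q chi -> chi <> principal ->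
  (forall x, (chi x)^*%C = chi x) -> Lser chi 1 != 0.
Proof.
move=> cc nc cr; apply/eqP => L0.
pose f n : R := complex.Re (nat_char chi n).
have fE n : nat_char chi n = rC (f n).
  rewrite /f; have := cr n%:R; rewrite /nat_char; case: (chi _) => a b [/eqP].
  by rewrite eq_sym -addr_eq0 -mulr2n mulrn_eq0 /= => /eqP ->.
have [c1 cM] := nat_charM cc.
have f1 : f 1%N = 1 by apply: (@rC_inj R); rewrite -fE c1.
have fM m n : f (m * n)%N = f m * f n by apply: (@rC_inj R); rewrite rCM -!fE cM.
have f3 n : [\/ f n = 1, f n = 0 | f n = -1].
  have [xu|xu] := boolP ((n%:R : Zq) \is a GRing.unit).
    have [u uE] := unit_lift xu.
    have := nC_unity (order_gt0 u) (dirichlet_unity u cc).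
    rewrite -uE -/(nat_char chi n) fE nC_rC.
    case: (ltrgt0P (f n)) => _ e; [by apply: Or31|apply: Or33|by move/eqP: e; rewrite eq_sym oner_eq0].
    by rewrite -e opprK.
  apply: Or32; apply: (@rC_inj R); rewrite -fE /nat_char.
  by case: cc => _ _ cu; move: (cu n%:R); rewrite (negbTE xu) => /negbFE/eqP.
apply: (@real_L1_neq0 R f f1 fM f3 q q0).
- by move=> n; apply: (@rC_inj R); rewrite -!fE (nat_char_period q1).
- apply: (@rC_inj R); rewrite rC_sum rC0; apply: etrans (nonprincipal_sum q1 cc nc).
  by apply: eq_bigr => n _; rewrite -fE.
- move=> N N0.
  have := @dser_balanced_bound R (nat_char chi) q 1 q0 (nat_char_period q1 chi)
    (nonprincipal_sum q1 cc nc) (nat_char_le1 cc) 1 N ltr01 N0.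
  rewrite -/(Lser chi 1) L0 sub0r nCN mulr1 natpowN1.
  have -> : \sum_(1 <= n < N) dterm (nat_char chi) 1 n = rC (\sum_(1 <= n < N) f n / n%:R).
    by rewrite rC_sum; apply: eq_bigr => n _; rewrite /dterm fE -rCM natpowN1 mulrC.
  by rewrite nC_rC.
Qed.

(* If a non-real [chi] vanished at [1] then so would its conjugate, and two zeros
   against the simple pole of the principal series would make
   [\prod_chi L(1 + d, chi)], which is at least [1], tend to [0].  The rate
   [L(1 + d) = O(d ^ (2/3))] is enough for this; it is tested along
   [d = 1 / m ^ 3]. *)
Lemma L1_neq0 chi : @dirichlet_character R q chi -> chi <> principal -> Lser chi 1 != 0.
Proof.
move=> cc nc; have [cr|ncr] := pselect (forall x, (chi x)^*%C = chi x); first exact: L1_real_neq0.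
apply/eqP => L0.
have [Y [Yc Yi Ys Yp]] := dirichlet_family R q1.
have [i iE] := Ys _ cc; have [j jE] := Ys _ (conj_dirichlet cc); have [k kE] := Ys _ (principal_dirichlet R q).
have nj : (fun x => (chi x)^*%C) <> principal.
  move=> e; apply: nc; apply/funext => x; have /(congr1 (fun h => (h x)^*%C)) := e.
  rewrite conjcK => ->; rewrite /principal_character.
  by case: (x \is a GRing.unit); [exact: conjc1 | exact: conjc0].
have ij : j != i by apply/eqP => e; apply: ncr => x; move: jE; rewrite e -iE => /(congr1 (fun h => h x)).
have ki : i != k by apply/eqP => e; apply: nc; rewrite kE iE e.
have kj : j != k by apply/eqP => e; apply: nj; rewrite kE jE e.
pose u m : R := (m.+1%:R ^+ 3)^-1.
have u0 m : 0 < u m by rewrite invr_gt0 exprn_gt0 // ltr0n.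
pose T d := (rC d * Lser (Y k) (1 + d)) * \prod_(h | [&& h != k, h != i & h != j]) Lser (Y h) (1 + d).
have Tcvg : T d @[d --> 0^'+] --> (rC ((totient q)%:R / q%:R)) *
    \prod_(h | [&& h != k, h != i & h != j]) Lser (Y h) 1.
  apply: cvgM; first by rewrite -kE; exact: Lser_principal_cvg.
  apply: (@cvg_big C 'I_#|{: Uq}| *%R 1 (fun h => [&& h != k, h != i & h != j]) (@mul_continuous C)).
  move=> h /and3P[hk _ _]; apply: Lser_right_cvg => //.
  by rewrite kE => /Yi e; rewrite e eqxx in hk.
have ucvg : u m @[m --> \oo] --> (0 : R)^'+.
  move=> A [r /= r0 rA]; exists (Num.truncn r^-1).+1 => // m /= rm; apply: rA => //=.
  rewrite sub0r normrN (gtr0_norm (u0 m)) /u invf_plt ?posrE ?exprn_gt0 ?ltr0n //.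
  apply: lt_le_trans (truncnS_gt _) _; rewrite -natrX ler_nat; apply: leq_trans rm _.
  by rewrite (leq_trans (leqnSn m)) // -{1}[m.+1]expn1 leq_pexp2l.
have pE d : \prod_h Lser (Y h) (1 + d) = Lser (Y k) (1 + d) * (Lser (Y i) (1 + d) * (Lser (Y j) (1 + d) *
    \prod_(h | [&& h != k, h != i & h != j]) Lser (Y h) (1 + d))).
  rewrite (bigD1 k) //= (bigD1 i) /= ?ki // (bigD1 j) /= ?kj ?ij //; congr (_ * (_ * (_ * _))).
  by apply: eq_bigl => h; rewrite -andbA.
pose B : R := 2 * q%:R + 4.
(* With [d = (m + 1)^(-3)] and the cut at [(m + 1)^2], tails and head are both [O((m + 1)^(-2))],
   with total constant [B]. *)
have small chi' m : @dirichlet_character R q chi' -> chi' <> principal -> Lser chi' 1 = 0 ->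
    nC (Lser chi' (1 + u m)) <= B / m.+1%:R ^+ 2.
  move=> c' n' L'; have := @Lser_diff chi' (u m) (m.+1 ^ 2) c' n' (ltW (u0 m)) _.
  rewrite expn_gt0 /= => /(_ isT); rewrite L' subr0 natrX sqrtr_sqr ger0_norm // => /le_trans; apply.
  rewrite /B /u [leRHS]mulrDl lerD2l -mulrA; apply: ler_wpM2l => //.
  have m0 : m.+1%:R != 0 :> R by rewrite pnatr_eq0.
  by rewrite le_eqVlt; apply/orP; left; apply/eqP; field.
(* [T] absorbs one factor [d] against the pole, so the two zeros leave
   [(m + 1)^(-4) / d = (m + 1)^(-1)]. *)
have prod_small m : 1 <= nC (T (u m)) * (B ^+ 2 / m.+1%:R).
  have [W [W0 _ WE]] := prod_Lser q1 Yc Yp (u0 m).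
  have : 1 <= nC (rC (expR W)) by rewrite nC_rC ger0_norm ?expR_ge0 // -expR0 ler_expR.
  move=> /le_trans; apply; rewrite -WE pE.
  have hi : nC (Lser (Y i) (1 + u m)) <= B / m.+1%:R ^+ 2 by rewrite -iE; exact: small.
  have hj : nC (Lser (Y j) (1 + u m)) <= B / m.+1%:R ^+ 2.
    rewrite -jE; apply: small => //; first exact: conj_dirichlet.
    by rewrite Lser_conj // L0; exact: conjc0.
  rewrite /T !nCM nC_rC (ger0_norm (ltW (u0 m))).
  set a := nC (Lser (Y k) _); set b := nC (Lser (Y i) _); set c := nC (Lser (Y j) _); set t := nC (\prod_(_ | _) _).
  have a0 : 0 <= a := nC_ge0 _; have b0 : 0 <= b := nC_ge0 _; have c0 : 0 <= c := nC_ge0 _; have t0 : 0 <= t := nC_ge0 _.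
  have -> : a * (b * (c * t)) = a * t * (b * c) by ring.
  have -> : u m * a * t * (B ^+ 2 / m.+1%:R) = a * t * (B / m.+1%:R ^+ 2 * (B / m.+1%:R ^+ 2)).
    have m0 : m.+1%:R != 0 :> R by rewrite pnatr_eq0.
    by rewrite /u; field.
  by apply: ler_wpM2l; [rewrite mulr_ge0 | apply: ler_pM].
have lim0 : nC (T (u m)) * (B ^+ 2 / m.+1%:R) @[m --> \oo] --> (0 : R).
  rewrite -(mulr0 (nC (rC ((totient q)%:R / q%:R) * \prod_(h | [&& h != k, h != i & h != j]) Lser (Y h) 1))).
  apply: cvgM; first by apply: cvg_nC; exact: (cvg_comp _ _ ucvg Tcvg).
  by rewrite -(mulr0 (B ^+ 2)); apply: cvgMl_tmp; exact: cvg_harmonic.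
have : (1 : R) <= 0 by apply: (cvgr_to_ge lim0); near=> m; exact: prod_small.
by rewrite ler10.
Unshelve. all: by end_near. Qed.

End Nonvanishing.

(** * The Mertens constant *)

Section Tannery.
Variable R : realType.
Implicit Types (d : R).

Lemma sum_le_cvg (h M tau : nat -> R) : tau @ \oo --> (0 : R) ->
    (forall N K, (0 < N)%N -> \sum_(N <= n < K) M n <= tau N) ->
    (forall n, `|h n| <= M n) ->
  exists S, forall N, (0 < N)%N -> `|S - \sum_(0 <= n < N) h n| <= tau N.
Proof.
move=> t0 tM hM; pose u N := \sum_(0 <= n < N) h n.
have uN N K : (0 < N)%N -> (N <= K)%N -> `|u K - u N| <= tau N.
  move=> N0 NK; rewrite /u (big_cat_nat (n := N) (p := K)) //= addrAC subrr add0r.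
  apply: le_trans (ler_norm_sum _ _ _) _; apply: le_trans (tM N K N0).
  by apply: ler_sum.
have tge N : (0 < N)%N -> 0 <= tau N by move=> N0; apply: le_trans (normr_ge0 _) (uN N N N0 (leqnn _)).
have [|S HS] := @nested_real R (fun N => u N.+1) (fun N => tau N.+1).
  move=> N K; have := tge N.+1 isT; have := tge K.+1 isT.
  have [NK|/ltnW KN] := leqP N K.
    by have := @uN N.+1 K.+1 isT NK; rewrite ler_norml => /andP[]; lra.
  by have := @uN K.+1 N.+1 isT KN; rewrite ler_norml => /andP[]; lra.
exists S => -[//|N] _; have /andP[h1 h2] := HS N.
by rewrite ler_norml; apply/andP; split; rewrite -/(u N.+1); lra.
Qed.

Lemma sum_le_is_cvg (h : nat -> R) S (tau : nat -> R) : tau @ \oo --> (0 : R) ->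
  (forall N, (0 < N)%N -> `|S - \sum_(0 <= n < N) h n| <= tau N) ->
  \sum_(0 <= n < N) h n @[N --> \oo] --> S.
Proof.
move=> t0 H; apply/cvgrPdist_le => e e0; move/cvgrPdist_le: t0 => /(_ _ e0) [N0 _ HN].
exists N0.+1 => // N /= NN; apply: le_trans (H N _) _; first exact: leq_trans NN.
by have := HN N (ltnW NN); rewrite sub0r normrN; apply: le_trans; exact: ler_norm.
Qed.

(** Dominated convergence for series: cutting where [tau N <= e / 4] makes both tails small
    uniformly in [d], and the head is a finite sum. *)
Lemma tannery (g : nat -> R -> R) (g0 M tau : nat -> R) (G : R -> R) :
    tau @ \oo --> (0 : R) ->
    (forall N K, (0 < N)%N -> \sum_(N <= n < K) M n <= tau N) ->
    (forall n d, 0 < d -> `|g n d| <= M n) -> (forall n, `|g0 n| <= M n) ->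
    (forall n, g n d @[d --> 0^'+] --> g0 n) ->
    (forall d, 0 < d -> \sum_(0 <= n < N) g n d @[N --> \oo] --> G d) ->
  exists2 S : R, \sum_(0 <= n < N) g0 n @[N --> \oo] --> S & G d @[d --> 0^'+] --> S.
Proof.
move=> t0 tM gM g0M gg0 gG.
have [S HS] := sum_le_cvg t0 tM g0M.
exists S; first exact: sum_le_is_cvg HS.
apply/cvgrPdist_le => e e0.
have e4 : 0 < e / 4 by rewrite divr_gt0.
move/cvgrPdist_le: (t0) => /(_ _ e4) [N0 _ HN].
pose N := maxn N0 1; have N1 : (0 < N)%N by rewrite leq_maxr.
have tN : tau N <= e / 4 by have := HN N (leq_maxl _ _); rewrite sub0r normrN; apply: le_trans; exact: ler_norm.
have fin : \sum_(0 <= n < N) g n d @[d --> 0^'+] --> \sum_(0 <= n < N) g0 n.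
  exact: (@cvg_big R nat +%R 0 xpredT (@add_continuous R) R (0^'+) (index_iota 0 N) g g0 _ (fun n _ => gg0 n)).
near=> d.
have d0 : 0 < d by near: d; exact: nbhs_right_gt.
have h1 : `|\sum_(0 <= n < N) g0 n - \sum_(0 <= n < N) g n d| <= e / 4.
  by near: d; move/cvgrPdist_le: fin => /(_ _ e4).
have [S' HS'] := sum_le_cvg t0 tM (fun n => gM n d d0).
have -> : G d = S'.
  by apply: (cvg_unique (@Rhausdorff R) (gG d d0)); exact: sum_le_is_cvg HS'.
have := HS N N1; have := HS' N N1; move: h1 tN; rewrite !ler_norml.
set a := \sum_(_ <= _ < _) _; set b := \sum_(_ <= _ < _) _.
move=> /andP[? ?] ? /andP[? ?] /andP[? ?]; have e0' : (0 : R) < e := e0.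
by apply/andP; split; lra.
Unshelve. all: by end_near. Qed.

Lemma inv_sqr_tail N K : (0 < N)%N -> forall B : R, 0 <= B ->
  \sum_(N <= n < K) B * n%:R `^ (- 2) <= B * (N%:R `^ (- (1 + 1)) + N%:R `^ (- 1) / 1).
Proof.
move=> N0 B B0; rewrite -mulr_sumr; apply: ler_wpM2l => //.
by have := @natpowN_tail R 1 N K ltr01 N0.
Qed.

Lemma inv_sqr_tail_cvg (B : R) :
  B * (N%:R `^ (- (1 + 1)) + N%:R `^ (- 1) / 1) @[N --> \oo] --> (0 : R).
Proof.
by rewrite -[X in _ --> X](mulr0 B); apply: cvgMl_tmp; exact: (natpowN_tail_cvg ltr01).
Qed.

Lemma ln1B_bounds (x : R) : 0 <= x <= 2^-1 -> x <= - ln (1 - x) <= x + 2 * x ^+ 2.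
Proof.
move=> /andP[x0 x1]; have p : 0 < 1 - x by lra.
apply/andP; split.
  by rewrite lerNr; have := @le_ln1Dx R (- x); apply; lra.
rewrite -lnV ?posrE //.
have -> : (1 - x)^-1 = 1 + x / (1 - x) by field; rewrite lt0r_neq0.
apply: le_trans (le_ln1Dx _) _.
  by apply: lt_le_trans (_ : 0 <= _); rewrite ?ltrN10 // divr_ge0 // ltW.
by rewrite ler_pdivrMr //; nra.
Qed.

End Tannery.

(** * The contribution of each prime *)

Section Masses.
Variable R : realType.
Variable q : nat.
Hypothesis q1 : (1 < q)%N.
Local Notation Zq := 'Z_q.
Local Notation Uq := {unit 'Z_q}.
Local Notation phi := ((totient q)%:R : R).
Implicit Types (d : R).

Definition mertens_mass p : R :=
  if prime p && (p%:R == 1 :> Zq) then - (phi * ln (1 - p%:R^-1)) else 0.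

Definition excess_log p d : R :=
  if prime p && coprime q p then euler_log q p d - mertens_mass p * expR (- (d * ln p%:R)) else 0.

Definition excess_log0 p : R :=
  if [&& prime p, coprime q p & p%:R != 1 :> Zq] then euler_log q p 0 else 0.

Lemma ord_mod1 p : p%:R = 1 :> Zq -> coprime q p /\ ord_mod q p = 1%N.
Proof.
move=> p1; have cp : coprime q p by rewrite -unit_nat // p1 unitr1.
split=> //; have [u uE ->] := ord_modP q1 cp; apply/eqP; rewrite -dvdn1 order_dvdn expg1.
by apply/eqP/val_inj; rewrite FinRing.val_unit1 -uE.
Qed.

Lemma ord_mod_gt1 p : coprime q p -> p%:R <> 1 :> Zq -> (1 < ord_mod q p)%N.
Proof.
move=> cp n1; have [u uE ->] := ord_modP q1 cp; rewrite order_gt1.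
by apply/eqP => u1; apply: n1; rewrite uE u1 FinRing.val_unit1.
Qed.

Lemma inv_prime p : prime p -> 0 < (p%:R : R)^-1 <= 2^-1.
Proof.
move=> pp; rewrite invr_gt0 ltr0n prime_gt0 //= lef_pV2 ?posrE ?ltr0n ?prime_gt0 //.
by rewrite ler_nat prime_gt1.
Qed.

Lemma mertens_mass_ge0 p : 0 <= mertens_mass p.
Proof.
rewrite /mertens_mass; case: ifP => // /andP[pp _].
have /andP[i0 i1] := inv_prime pp.
rewrite oppr_ge0; apply: mulr_ge0_le0 => //; apply: ln_le0; lra.
Qed.

Lemma mertens_mass_le p : mertens_mass p <= 2 * phi * p%:R^-1.
Proof.
rewrite /mertens_mass; case: ifP => [/andP[pp _]|_]; last by rewrite mulr_ge0 // mulr_ge0.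
have /andP[i0 i1] := inv_prime pp.
rewrite -mulrN [2 * phi]mulrC -mulrA; apply: ler_wpM2l => //.
have /andP[_ h] : (p%:R : R)^-1 <= - ln (1 - (p%:R : R)^-1) <= p%:R^-1 + 2 * p%:R^-1 ^+ 2.
  by apply: ln1B_bounds; rewrite ltW.
by apply: le_trans h _; move: i0 i1; set x := p%:R^-1; nra.
Qed.

Lemma euler_log_bound p d : prime p -> coprime q p -> p%:R <> 1 :> Zq -> 0 <= d ->
  `|euler_log q p d| <= 2 * phi * p%:R `^ (- 2).
Proof.
rewrite (natpowN_nat R p (ltn0Sn 1)) -exprVn.
move=> pp cp n1 d0; have t2 := ord_mod_gt1 cp n1; have t0 := ord_mod_gt0 q1 cp.
have /andP[i0 i1] := inv_prime pp.
have p0 := prime_gt0 pp.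
have [y [y0 yz ->]] : exists y : R, [/\ 0 <= y, y <= p%:R^-1 ^+ 2 &
    euler_log q p d = phi / (ord_mod q p)%:R * (- ln (1 - y))].
  exists (p%:R `^ (- (1 + d)) ^+ ord_mod q p); split.
  - by rewrite exprn_ge0 // natpowN_ge0.
  - have xi : (p%:R : R) `^ (- (1 + d)) <= p%:R^-1.
      by rewrite -natpowN1; apply: natpowN_lexp => //; rewrite lerDl.
    apply: (@le_trans _ _ (p%:R `^ (- (1 + d)) ^+ 2)).
      apply: ler_wiXn2l => //.
      by apply: le_trans xi (le_trans i1 _); rewrite invf_le1 // ler1n.
    by apply: lerXn2r => //; rewrite nnegrE ?natpowN_ge0 // ltW.
  - by rewrite mulrN.
have yh : y <= 4^-1.
  apply: le_trans yz _; apply: (@le_trans _ _ ((2^-1 : R) ^+ 2)); last by rewrite expr2; lra.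
  by apply: lerXn2r => //; rewrite nnegrE; [exact: ltW | rewrite invr_ge0].
have /andP[h1 h2] : y <= - ln (1 - y) <= y + 2 * y ^+ 2.
  by apply: ln1B_bounds; rewrite y0 /=; lra.
rewrite normrM ger0_norm; last by rewrite divr_ge0.
rewrite [2 * phi]mulrC -!mulrA; apply: ler_wpM2l; first exact: ler0n.
rewrite ger0_norm; last by apply: le_trans h1.
apply: (@le_trans _ _ (1 * (- ln (1 - y)))).
  apply: ler_wpM2r; first exact: le_trans h1.
  by rewrite invf_le1 ?ltr0n // ler1n.
rewrite mul1r; apply: le_trans h2 _.
have : y * y <= y * 4^-1 by exact: ler_wpM2l.
by rewrite expr2; lra.
Qed.

(** For [p = 1] modulo [q] the two terms share the linear part [phi(q) p^(-1 - d)], so the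
    difference is quadratic in [1 / p], uniformly in [d]; otherwise the logarithm starts with an
    exponent at least [2]. *)
Lemma excess_log_bound p d : 0 < d -> `|excess_log p d| <= 2 * phi * p%:R `^ (- 2).
Proof.
move=> d0; rewrite /excess_log; case: ifP => [/andP[pp cp]|_]; last first.
  by rewrite normr0 mulr_ge0 ?natpowN_ge0 // mulr_ge0.
have [p1|/eqP n1] := eqVneq (p%:R : Zq) 1; last first.
  rewrite /mertens_mass (negbTE (introN eqP n1)) andbF mul0r subr0.
  exact: (euler_log_bound pp cp n1 (ltW d0)).
have [_ o1] := ord_mod1 p1.
have /andP[i0 i1] := inv_prime pp.
have p0 := prime_gt0 pp.
rewrite (natpowN_nat R p (ltn0Sn 1)) -exprVn.
rewrite /mertens_mass pp p1 eqxx /= /euler_log /euler_exponent o1 expr1 divr1 natpowND // natpowN1.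
rewrite -natpowNE //.
set tau := p%:R `^ (- d); set y := p%:R^-1 in i0 i1 *.
have tau0 : 0 < tau := natpowN_gt0 _ p0.
have tau1 : tau <= 1 := natpowN_le1 (ltW d0) p0.
have -> : - (phi * ln (1 - y * tau)) - - (phi * ln (1 - y)) * tau =
    phi * (- ln (1 - y * tau) - tau * - ln (1 - y)) by ring.
rewrite normrM ger0_norm // [2 * phi]mulrC -!mulrA; apply: ler_wpM2l => //.
have yt : 0 <= y * tau <= y by rewrite mulr_ge0 ?(ltW i0) ?(ltW tau0) //= ler_piMr // ltW.
have /andP[h1 h2] : y * tau <= - ln (1 - y * tau) <= y * tau + 2 * (y * tau) ^+ 2.
  by apply: ln1B_bounds; lra.
have /andP[h3 h4] : y <= - ln (1 - y) <= y + 2 * y ^+ 2 by apply: ln1B_bounds; lra.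
have h3' := ler_wpM2l (ltW tau0) h3; have h4' := ler_wpM2l (ltW tau0) h4.
have /andP[yt0 yty] := yt.
have sq : (y * tau) ^+ 2 <= y ^+ 2 by apply: lerXn2r => //; rewrite nnegrE ltW.
have sq' : tau * (2 * y ^+ 2) <= 2 * y ^+ 2 by rewrite ler_piMl // mulr_ge0 // sqr_ge0.
by rewrite ler_norml; apply/andP; split; lra.
Qed.

Lemma excess_log0_bound p : `|excess_log0 p| <= 2 * phi * p%:R `^ (- 2).
Proof.
rewrite /excess_log0; case: ifP => [/and3P[pp cp n1]|_].
  exact: (euler_log_bound pp cp (elimN eqP n1) (lexx 0)).
by rewrite normr0 mulr_ge0 ?natpowN_ge0 // mulr_ge0.
Qed.

Lemma natpowN_right_cvg p : (0 < p)%N -> (p%:R : R) `^ (- (1 + d)) @[d --> 0^'+] --> p%:R `^ (- 1).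
Proof.
move=> p0; under eq_cvg do rewrite natpowNE //.
rewrite natpowNE // -[X in expR (- (X * _))]addr0.
have C : - ((1 + d) * ln p%:R) @[d --> (0 : R)^'+] --> (- ((1 + 0) * ln p%:R) : R).
  apply: cvgN; apply: cvgMr_tmp; apply: cvgD; first exact: cvg_cst.
  exact: cvg_at_right_filter cvg_id.
exact: (continuous_cvg _ (@continuous_expR R _) C).
Qed.

Lemma euler_log_right_cvg p : prime p -> coprime q p ->
  euler_log q p d @[d --> 0^'+] --> euler_log q p (0 : R).
Proof.
move=> pp cp; rewrite /euler_log; apply: cvgN; apply: cvgMl_tmp.
have c1 : 1 - ((p%:R : R) `^ (- (1 + d))) ^+ ord_mod q p @[d --> 0^'+] --> 1 - (p%:R `^ (- (1 + 0))) ^+ ord_mod q p.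
  apply: cvgB; first exact: cvg_cst.
  by rewrite addr0; exact: (continuous_cvg _ (@exprn_continuous R (ord_mod q p) _) (natpowN_right_cvg (prime_gt0 pp))).
apply: (continuous_cvg _ (continuous_ln _) c1).
by have /andP[] := @euler_factor_itv R p 0 (ord_mod q p) (prime_gt1 pp) (lexx 0) (ord_mod_gt0 q1 cp).
Qed.

Lemma excess_log_right_cvg p : excess_log p d @[d --> 0^'+] --> excess_log0 p.
Proof.
rewrite /excess_log /excess_log0.
have [pp|_] := boolP (prime p); last exact: cvg_cst.
have [cp|_] := boolP (coprime q p); last exact: cvg_cst.
have c1 := euler_log_right_cvg pp cp.
have c2 : mertens_mass p * expR (- (d * ln p%:R)) @[d --> 0^'+] --> mertens_mass p.
  have C : - (d * ln p%:R) @[d --> (0 : R)^'+] --> (- (0 * ln p%:R) : R).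
    by apply: cvgN; apply: cvgMr_tmp; exact: cvg_at_right_filter cvg_id.
  have e1 : mertens_mass p = mertens_mass p * expR (- (0 * ln p%:R)) by rewrite mul0r oppr0 expR0 mulr1.
  rewrite {2}e1; apply: cvgMl_tmp; exact: (continuous_cvg _ (@continuous_expR R _) C).
have c3 := cvgB c1 c2; rewrite /=.
have -> : (if p%:R != 1 :> Zq then euler_log q p 0 else 0) = euler_log q p 0 - mertens_mass p; last exact: c3.
rewrite /mertens_mass pp /=; case: eqP => [p1|_] /=; last by rewrite subr0.
have [_ o1] := ord_mod1 p1.
by rewrite /euler_log /euler_exponent o1 expr1 divr1 addr0 natpowN1 subrr.
Qed.

End Masses.

(** * From the L-values to the Mertens constant *)

Section MertensConstant.
Variable R : realType.
Local Notation C := (Cplx R).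
Variable q : nat.
Hypothesis q1 : (1 < q)%N.
Local Notation Zq := 'Z_q.
Local Notation Uq := {unit 'Z_q}.
Local Notation phi := ((totient q)%:R : R).
Local Notation mass := (@mertens_mass R q).
Local Notation principal := (@principal_character R q).
Implicit Types (d u : R).

Let q0 : (0 < q)%N := ltnW q1.
Let phi0 : 0 < phi. Proof. by rewrite ltr0n totient_gt0. Qed.

Definition mass_cumul u : R := \sum_(0 <= p < (Num.truncn (expR u)).+1) mass p.
Definition mass_laplace d : R := lim (\sum_(0 <= p < M) mass p * expR (- (d * ln p%:R)) @[M --> \oo]).

Lemma mass0 : mass 0 = 0. Proof. by rewrite /mertens_mass. Qed.

Lemma mass_laplace_cvg d : 0 < d ->
  \sum_(0 <= p < M) mass p * expR (- (d * ln p%:R)) @[M --> \oo] --> mass_laplace d.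
Proof.
move=> d0; apply: nondecreasing_is_cvgn.
  move=> n m nm; rewrite (big_cat_nat (n := n) (p := m)) //= lerDl.
  by apply: sumr_ge0 => p _; rewrite mulr_ge0 ?expR_ge0 // mertens_mass_ge0.
exists (2 * phi * (1 + 1 / d)) => _ [M _ <-].
case: M => [|M]; first by rewrite big_geq // mulr_ge0 ?mulr_ge0 // addr_ge0 // divr_ge0 // ltW.
rewrite big_ltn // mass0 mul0r add0r.
have := @natpowN_tail R d 1 M.+1 d0 isT; rewrite !powR1 /= => h.
have h' : 2 * phi * \sum_(1 <= n < M.+1) n%:R `^ (- (1 + d)) <= 2 * phi * (1 + 1 / d).
  by apply: ler_wpM2l => //; rewrite mulr_ge0.
apply: le_trans h'; rewrite mulr_sumr; apply: ler_sum_nat => n /andP[n0 _].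
rewrite natpowND // natpowN1 -natpowNE // mulrA; apply: ler_wpM2r; first exact: natpowN_ge0.
exact: mertens_mass_le.
Qed.

Lemma mass_laplace_pair : laplace_pair mass (fun p => ln p%:R) mass_cumul mass_laplace.
Proof.
split=> [n|n|u|d d0].
- exact: mertens_mass_ge0.
- by case: n => [|n]; [rewrite ln0 | rewrite ln_ge0 // ler1n].
- exists (Num.truncn (expR u)).+1 => // M /= uM.
  rewrite /mass_cumul (big_nat_widen _ _ M xpredT) // big_mkcond; apply: etrans (esym (big_mkcond _ _)).
  apply: eq_bigr => -[|n] _ /=; first by rewrite mass0 !if_same.
  by rewrite ltnS ltnNge truncn_le_nat -leNgt -[in RHS]ler_ln ?posrE ?expR_gt0 // expRK.
- exact: mass_laplace_cvg.
Qed.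

Lemma mertens_partialE x : 0 < x ->
  mass_cumul (ln x) = - (phi * ln (mertens_partial (1 : Zq) x)) /\ 0 < mertens_partial (1 : Zq) x.
Proof.
move=> x0; rewrite /mass_cumul lnK ?posrE // /mertens_partial.
have PS n : \prod_(0 <= p < n.+1 | prime p && (p%:R == 1 :> Zq)) (1 - (p%:R : R)^-1) =
    \prod_(0 <= p < n | prime p && (p%:R == 1 :> Zq)) (1 - (p%:R : R)^-1) *
    (if prime n && (n%:R == 1 :> Zq) then 1 - n%:R^-1 else 1).
  by rewrite big_mkcond big_nat_recr //= -big_mkcond.
elim: (Num.truncn x).+1 => [|n [IH1 IH2]]; first by rewrite !big_geq // ln1 mulr0 oppr0.
rewrite big_nat_recr //= PS IH1 /mertens_mass.
case: ifP => [/andP[pp _]|_]; last by rewrite !mulr1 addr0.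
have /andP[i0 i1] := inv_prime R pp.
have p1 : 0 < 1 - (n%:R : R)^-1 by lra.
by split; [rewrite lnM ?posrE //; ring | rewrite mulr_gt0].
Qed.

(** [d exp (W d)] tends to [K], which is [phi(q)/q] times [Lambda], and the Tauberian theorem gives
    the constant [m = gamma + ln K - S]. In [c(q,1)] the [gamma] cancels against [e^(-gamma)] and
    the [phi(q)/q] of [K] against [q/phi(q)], leaving [exp S / Lambda]. *)
Lemma mertens_c_Pi1 : exists2 S : R, \sum_(0 <= p < N) @excess_log0 R q p @[N --> \oo] --> S &
  rC (mertens_c R (1 : Zq)) = rC (expR S) * Pi1 R q.
Proof.
have [Y [Yc Yi Ys Yp]] := dirichlet_family R q1.
have [k kE] := Ys _ (principal_dirichlet R q).
have Yk h : h != k -> Y h <> principal by move=> hk; rewrite kE => /Yi e; rewrite e eqxx in hk.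
pose W d : R := lim (\sum_(0 <= p < N | prime p && coprime q p) euler_log q p d @[N --> \oo]).
have Wcvg d : 0 < d -> \sum_(0 <= p < N | prime p && coprime q p) euler_log q p d @[N --> \oo] --> W d.
  by move=> d0; have [w [_ wc _]] := prod_Lser q1 Yc Yp d0; rewrite /W (cvg_lim (@Rhausdorff R) wc).
have WE d : 0 < d -> \prod_i Lser (Y i) (1 + d) = rC (expR (W d)).
  by move=> d0; have [w [_ wc ->]] := prod_Lser q1 Yc Yp d0; rewrite /W (cvg_lim (@Rhausdorff R) wc).
(* [W d] and [mass_laplace d] both diverge at [0], but the terms of their difference are dominated
   by a multiple of [p^(-2)]. *)
have [S Scvg WLS] : exists2 S : R, \sum_(0 <= n < N) @excess_log0 R q n @[N --> \oo] --> S &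
    W d - mass_laplace d @[d --> 0^'+] --> S.
  apply: (@tannery R (@excess_log R q) (@excess_log0 R q) (fun n => 2 * phi * n%:R `^ (- 2)) _
    (fun d => W d - mass_laplace d) (inv_sqr_tail_cvg (2 * phi))).
  - by move=> N K N0; apply: inv_sqr_tail => //; rewrite mulr_ge0.
  - by move=> n d d0; exact: excess_log_bound.
  - by move=> n; exact: excess_log0_bound.
  - by move=> n; exact: excess_log_right_cvg.
  move=> d d0; apply: cvg_trans (cvgB (Wcvg d d0) (mass_laplace_cvg d0)); apply: near_eq_cvg; near=> N.
  rewrite !fctE big_mkcond -sumrB; apply: eq_bigr => p _; rewrite /excess_log.
  case: ifP => // /negbT h; have -> : mass p = 0; last by rewrite mul0r subr0.
  rewrite /mertens_mass; case: ifP => // /andP[pp /eqP /(ord_mod1 q1)[cp _]].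
  by rewrite pp cp in h.
exists S => //.
pose Lambda : C := \prod_(h | h != k) Lser (Y h) 1.
have L0 : Lambda != 0 by apply/prodf_neq0 => h hk; apply: L1_neq0 => //; exact: Yk.
have PiE : Pi1 R q = Lambda^-1.
  rewrite /Pi1 (fsbigE [seq Y h | h <- enum 'I_#|{: Uq}| & h != k]).
  - rewrite big_map big_filter_cond big_enum_cond /Lambda -prodfV.
    apply: eq_big => [h|h _]; last by rewrite dirichlet_L1E.
    case: (boolP (h != k)) => [hk|_]; last by rewrite andbF.
    apply/and3P; split=> //; apply: mem_set; split; [exact: Yc | exact: Yk].
  - by rewrite map_inj_uniq // filter_uniq // enum_uniq.
  - move=> x /= /mapP[h]; rewrite mem_filter => /andP[hk _] ->; split; first exact: Yc.
    exact: Yk.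
  - move=> chi [cc nc] /negP; case; have [h hE] := Ys _ cc; apply/mapP; exists h => //.
    by rewrite mem_filter mem_enum andbT; apply/eqP => e; apply: nc; rewrite hE e kE.
have dW : rC (d * expR (W d)) @[d --> 0^'+] --> rC (phi / q%:R) * Lambda.
  have h1 : (rC d * Lser (Y k) (1 + d)) * \prod_(h | h != k) Lser (Y h) (1 + d) @[d --> 0^'+] --> rC (phi / q%:R) * Lambda.
    apply: cvgM; first by rewrite -kE; exact: Lser_principal_cvg.
    apply: (@cvg_big C 'I_#|{: Uq}| *%R 1 (fun h => h != k) (@mul_continuous C)).
    by move=> h hk; apply: Lser_right_cvg => //; exact: Yk.
  apply: cvg_trans h1; apply: near_eq_cvg; near=> d.
  have d0 : 0 < d by near: d; exact: nbhs_right_gt.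
  by rewrite [RHS]rCM -(WE d d0) (bigD1 (P := xpredT) k isT) mulrA.
(* A limit of nonnegative reals is a nonnegative real, and this one is not [0] since no [L(1, chi)]
   is; its logarithm can now be taken. *)
have [K K0 KE] : exists2 K : R, 0 < K & rC (phi / q%:R) * Lambda = rC K /\
    d * expR (W d) @[d --> 0^'+] --> K.
  set z := rC (phi / q%:R) * Lambda in dW *.
  have [Rd zE] := cvg_rC_real dW.
  exists (complex.Re z); last by split.
  rewrite lt_neqAle; apply/andP; split.
    rewrite eq_sym -(inj_eq (@rC_inj R)) -zE mulf_eq0 negb_or L0 andbT.
    by rewrite -rC0 (inj_eq (@rC_inj R)) lt0r_neq0 // divr_gt0 // ltr0n.
  apply: (cvgr_to_ge Rd); near=> d; apply: mulr_ge0; last exact: expR_ge0.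
  by apply: ltW; near: d; exact: nbhs_right_gt.
have [KL Kcvg] := KE.
have lnW : W d + ln d @[d --> 0^'+] --> ln K.
  apply: cvg_trans (continuous_cvg _ (continuous_ln K0) Kcvg); apply: near_eq_cvg; near=> d.
  have d0 : 0 < d by near: d; exact: nbhs_right_gt.
  by rewrite /= lnM ?posrE ?expR_gt0 // expRK addrC.
have lnL : mass_laplace d + ln d @[d --> 0^'+] --> ln K - S.
  apply: cvg_trans (cvgB lnW WLS); apply: near_eq_cvg; near=> d.
  by rewrite !fctE; ring.
have HV := tauberian_log mass_laplace_pair lnL.
have lncvg : ln x @[x --> (+oo : set_system R)] --> (+oo : set_system R).
  move=> A [B [_ HA]]; exists (expR (Num.max B 0)); split; first exact: num_real.
  move=> x /= Bx; apply: HA; have x0 : 0 < x by apply: lt_trans Bx; exact: expR_gt0.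
  apply: le_lt_trans (_ : Num.max B 0 < _); first by rewrite le_max lexx.
  by rewrite -ltr_expR lnK.
have HVx := cvg_comp _ _ lncvg HV.
pose m : R := euler_gamma R + (ln K - S).
(* The function of [x] in [mertens_C] is [exp (- (V(ln x) - ln ln x) / phi(q))] for [x > 1]. *)
have MC : mertens_C R (1 : Zq) = expR (- (m / phi)).
  apply: cvg_lim; first exact: Rhausdorff.
  have H1 : - ((mass_cumul (ln x) - ln (ln x)) / phi) @[x --> +oo] --> - (m / phi).
    by apply: cvgN; apply: cvgMr_tmp; exact: HVx.
  apply: cvg_trans (continuous_cvg _ (@continuous_expR R _) H1); apply: near_eq_cvg; near=> x.
  have x1 : 1 < x by near: x; exact: nbhs_pinfty_gt.
  have [VE M0] := @mertens_partialE x (lt_trans ltr01 x1).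
  have lx : 0 < ln x by exact: ln_gt0.
  rewrite /= VE -[RHS]lnK ?posrE ?mulr_gt0 ?powR_gt0 //; congr expR.
  rewrite lnM ?posrE ?powR_gt0 // ln_powR; field.
  by rewrite lt0r_neq0.
have cE : mertens_c R (1 : Zq) = expR S * (phi / q%:R) / K.
  rewrite /mertens_c MC -expRM_natl.
  have -> : phi * - (m / phi) = - euler_gamma R + (- ln K + S).
    by rewrite mulrN mulrCA divff ?lt0r_neq0 // mulr1 /m; ring.
  rewrite !expRD [expR (- ln K)]expRN lnK ?posrE //.
  have h1 : expR (- euler_gamma R) != 0 by rewrite lt0r_neq0 // expR_gt0.
  have h2 : phi != 0 by rewrite lt0r_neq0.
  have h3 : q%:R != 0 :> R by rewrite pnatr_eq0 -lt0n.
  have h4 : K != 0 by rewrite lt0r_neq0.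
  by field; rewrite h1 h2 h3 h4.
rewrite cE PiE rCM rCV -KL rCM invfM.
have p0 : rC (phi / q%:R) != 0.
  by rewrite -rC0 (inj_eq (@rC_inj R)) lt0r_neq0 // divr_gt0 // ltr0n.
by rewrite mulrA -[X in X / _]mulrA divff // mulr1.
Unshelve. all: by end_near. Qed.

End MertensConstant.

(** * Products over primes *)

Section FinalProducts.
Variable R : realType.
Local Notation C := (Cplx R).
Variable q : nat.
Hypothesis q3 : (3 <= q)%N.
Local Notation Zq := 'Z_q.
Local Notation Uq := {unit 'Z_q}.
Local Notation phi := ((totient q)%:R : R).
Local Notation l := (carmichael q).
Local Notation e := (phi / l%:R).

Definition zeta_factor t p : R := 1 - (p%:R ^+ t)^-1.
Local Notation F := zeta_factor.

Let q1 : (1 < q)%N := ltnW q3.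
Let q0 : (0 < q)%N := ltnW q1.
Let l2 : (2 <= l)%N := carmichael_ge2 q3.

Lemma zeta_factor_bounds t p : (2 <= t)%N -> prime p ->
  0 < F t p /\ `|ln (F t p)| <= 2 * p%:R `^ (- 2).
Proof.
rewrite (natpowN_nat R p (ltn0Sn 1)) => t2 pp.
have /andP[i0 i1] := inv_prime R pp.
rewrite /F; have [y [y0 yz ->]] : exists y : R, [/\ 0 <= y, y <= (p%:R ^+ 2)^-1 & (p%:R ^+ t)^-1 = y].
  exists ((p%:R ^+ t)^-1); split; [by rewrite invr_ge0 exprn_ge0 | | by []].
  rewrite lef_pV2 ?posrE ?exprn_gt0 ?ltr0n ?prime_gt0 //.
  by apply: ler_weXn2l => //; rewrite ler1n prime_gt0.
have yh : y <= 4^-1.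
  apply: le_trans yz _; rewrite -exprVn; apply: (@le_trans _ _ ((2^-1 : R) ^+ 2)); last by rewrite expr2; lra.
  by apply: lerXn2r; rewrite ?nnegrE ?invr_ge0.
have /andP[h1 h2] : y <= - ln (1 - y) <= y + 2 * y ^+ 2.
  by apply: ln1B_bounds; rewrite y0 /=; lra.
split; first lra.
rewrite -normrN ger0_norm; last by apply: le_trans h1.
apply: le_trans h2 _.
have : y * y <= y * 4^-1 by exact: ler_wpM2l.
by rewrite expr2; lra.
Qed.

(** Turns each product into the exponential of an absolutely convergent sum, so that the final
    identity can be checked on logarithms, prime by prime. *)
Lemma prime_prod_expR (P : pred nat) (f h : nat -> R) (B : R) : 0 <= B ->
    (forall p, prime p -> P p -> f p = expR (h p)) ->
    (forall p, prime p -> P p -> `|h p| <= B * p%:R `^ (- 2)) ->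
  exists2 T : R, \sum_(0 <= p < N | prime p && P p) h p @[N --> \oo] --> T &
    prime_prod P f = expR T.
Proof.
move=> B0 fh hB.
have [|T HT] := @sum_le_cvg R (fun p => if prime p && P p then h p else 0) _ _ (inv_sqr_tail_cvg B)
  (fun N K N0 => inv_sqr_tail K N0 B0).
  move=> n; case: ifP => [/andP[pn Pn]|_]; first exact: hB.
  by rewrite normr0 mulr_ge0 // natpowN_ge0.
have Tc : \sum_(0 <= p < N | prime p && P p) h p @[N --> \oo] --> T.
  by under eq_cvg do rewrite big_mkcond; exact: (sum_le_is_cvg (inv_sqr_tail_cvg B)).
exists T => //; apply: cvg_lim; first exact: Rhausdorff.
apply: cvg_trans (continuous_cvg _ (@continuous_expR R _) Tc); apply: near_eq_cvg; near=> N.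
by rewrite /= expR_sum; apply: eq_bigr => p /andP[pp Pp]; rewrite fh.
Unshelve. all: by end_near. Qed.

(** The Euler product with all coefficients [1] at [d = t - 1], brought back to the reals; its limit
    [1] excludes [zeta t = 0]. *)
Lemma zeta_euler t : (2 <= t)%N ->
  0 < zeta R t /\ \sum_(0 <= p < N | prime p) ln (F t p) @[N --> \oo] --> - ln (zeta R t).
Proof.
move=> t2; have t0 : (0 < t)%N := ltnW t2.
have one1 (n : nat) : nC (1 : C) <= 1 by rewrite nC1.
pose d : R := t.-1%:R.
have d0 : 0 < d by rewrite ltr0n -subn1 subn_gt0.
have dE : 1 + d = t%:R by rewrite /d addrC natr1 prednK.
have tE n : dterm (fun=> 1) (1 + d) n = rC ((n%:R ^+ t)^-1).
  by rewrite /dterm mulr1 dE natpowN_nat.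
have c1 := dser_absolute_cvg one1 d0.
have c2 := dser_euler one1 (erefl _) (fun m n => esym (mulr1 1)) d0.
have [z1 zE] : \sum_(1 <= n < M.+1) (n%:R ^+ t)^-1 @[M --> \oo] --> complex.Re (dser (fun=> 1) (1 + d)) /\
    dser (fun=> 1) (1 + d) = rC (complex.Re (dser (fun=> 1) (1 + d))).
  apply: cvg_rC_real; apply: cvg_trans c1; apply: near_eq_cvg; near=> M.
  by rewrite rC_sum; apply: eq_bigr => n _; rewrite tE.
have zz : zeta R t = complex.Re (dser (fun=> 1) (1 + d)) by apply: cvg_lim => //; exact: Rhausdorff.
rewrite -zz in zE z1.
have [H _] : zeta R t * \prod_(0 <= p < N | prime p) F t p @[N --> \oo] --> complex.Re (1 : C) /\ (1 : C) = rC (complex.Re (1 : C)).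
  apply: cvg_rC_real; apply: cvg_trans c2; apply: near_eq_cvg; near=> N.
  by rewrite rCM zE rC_prod; congr (_ * _); apply: eq_bigr => p _; rewrite tE /F rCB rC1.
rewrite /= in H.
have zpos : 0 < zeta R t.
  rewrite lt_neqAle; apply/andP; split.
    apply/eqP => z0; have : (0 : R) = 1; last by move/eqP; rewrite eq_sym oner_eq0.
    have H0 : zeta R t * \prod_(0 <= p < N | prime p) F t p @[N --> \oo] --> (0 : R).
      by rewrite -z0; under eq_cvg do rewrite mul0r; exact: cvg_cst.
    exact: (cvg_unique (@Rhausdorff R) H0 H).
  apply: (cvgr_to_ge z1); near=> M; apply: sumr_ge0 => n _; by rewrite invr_ge0 exprn_ge0.
split=> //.
have c3 := continuous_cvg _ (continuous_ln (@ltr01 R)) H.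
have c4 := cvgB (c3 _) (cvg_cst (ln (zeta R t))).
rewrite (_ : - ln (zeta R t) = ln 1 - ln (zeta R t)); last by rewrite ln1 sub0r.
apply: cvg_trans (c4 _ _ _); apply: near_eq_cvg; near=> N.
have prodE : ln (\prod_(0 <= p < N | prime p) F t p) = \sum_(0 <= p < N | prime p) ln (F t p) /\
    0 < \prod_(0 <= p < N | prime p) F t p.
  elim/big_rec2: _ => [|p y x pp [IH1 IH2]]; first by rewrite ln1.
  have [f0 _] := zeta_factor_bounds t2 pp.
  by rewrite lnM ?posrE // IH1; split=> //; rewrite mulr_gt0.
case: prodE => pE p0; rewrite !fctE /= lnM ?posrE // pE; ring.
Unshelve. all: by end_near. Qed.

Lemma sum_primes_dvd (h : nat -> R) :
  \sum_(0 <= p < N | prime p && ~~ coprime q p) h p @[N --> \oo] --> \sum_(p <- primes q) h p.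
Proof.
apply: (@cvg_trans _ ((fun=> \sum_(p <- primes q) h p) @ \oo)); last exact: cvg_cst.
apply: near_eq_cvg; exists q.+1 => // N /= qN.
rewrite -[RHS]big_filter; apply: perm_big; apply: uniq_perm; rewrite ?primes_uniq ?filter_uniq ?iota_uniq //.
move=> p; rewrite mem_filter mem_index_iota /= mem_primes q0 /=; apply/esym.
case pp : (prime p) => //=; rewrite coprime_sym prime_coprime // negbK.
case pq : (p %| q)%N => //=; apply: leq_trans qN; rewrite ltnS; exact: dvdn_leq.
Qed.

Definition low_log (b : Uq) p : R := - (phi / #[b]%g%:R) * ln (F #[b]%g p) + e * ln (F l p).

(** The first term charges every prime as if its order were [lambda(q)], which is what zeta
    provides. It is refunded where nothing is due, at [p] dividing [q] and at [p = 1], and [low_log]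
    corrects it for the classes of smaller order. *)
Lemma excess_log0E p : prime p -> excess_log0 R q p =
  - (e * ln (F l p)) + (if ~~ coprime q p then e * ln (F l p) else 0) +
  (if p%:R == 1 :> Zq then e * ln (F l p) else 0) +
  \sum_(b in low_order q) (if p%:R == val b :> Zq then low_log b p else 0).
Proof.
move=> pp; rewrite /excess_log0 pp /=.
have [cp|ncp] /= := boolP (coprime q p); last first.
  have nu (u : Uq) : (p%:R == val u :> Zq) = false.
    by apply/negP => /eqP pu; move: ncp; rewrite -(unit_nat q1) pu (valP u).
  have := nu 1%g; rewrite FinRing.val_unit1 => ->.
  by rewrite big1 ?addr0 ?addNr // => b _; rewrite nu.
rewrite addr0; have [u uE oE] := ord_modP q1 cp.
have eu (b : Uq) : (p%:R == val b :> Zq) = (b == u).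
  by rewrite uE eq_sym (inj_eq val_inj).
have e1 : (p%:R == 1 :> Zq) = (u == 1%g) by rewrite -[1]FinRing.val_unit1 eu eq_sym.
have sumE : \sum_(b in low_order q) (if p%:R == val b :> Zq then low_log b p else 0) =
    if u \in low_order q then low_log u p else 0.
  rewrite big_mkcond (bigD1 u) //= eu eqxx big1 ?addr0 // => b bu.
  by rewrite eu (negbTE bu); case: ifP.
rewrite sumE e1 inE; have [u1|u1] /= := eqVneq u 1%g; first by rewrite addr0 addNr.
have eL : euler_log q p 0 = - (phi / #[u]%g%:R) * ln (F #[u]%g p).
  by rewrite /euler_log /euler_exponent oE addr0 natpowN1 exprVn mulNr.
rewrite addr0 eL /low_log; case: ltnP => ul; first by ring.
(* The order divides [lambda(q)] and is not smaller, so the first term is already exact. *)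
have -> : #[u]%g = l.
  by apply/eqP; rewrite eqn_leq ul andbT dvdn_leq ?carmichael_gt0 // order_dvd_carmichael.
by ring.
Qed.

(** Both sides are exponentials, and by [excess_log0E] their exponents are limits of the same
    partial sums. *)
Lemma expR_excess (S : R) : \sum_(0 <= p < N) excess_log0 R q p @[N --> \oo] --> S ->
  expR S = zeta R l `^ e * (\prod_(p <- primes q) F l p `^ e)
    * prime_prod (fun p => p%:R == 1 :> Zq) (fun p => F l p `^ e)
    * \prod_(b in low_order q) prime_prod (fun p => p%:R == val b :> Zq)
        (fun p => F #[b]%g p `^ (- (phi / #[b]%g%:R)) * F l p `^ e).
Proof.
move=> HS.
have Fpow t x p : (2 <= t)%N -> prime p -> F t p `^ x = expR (x * ln (F t p)).
  by move=> t2 pp; have [f0 _] := zeta_factor_bounds t2 pp; rewrite /powR gt_eqF.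
have e0 : 0 <= e by rewrite divr_ge0.
have [zpos zcvg] := zeta_euler l2.
have [|p pp _|T1 T1c ->] := @prime_prod_expR (fun p => p%:R == 1 :> Zq) (fun p => F l p `^ e)
   (fun p => e * ln (F l p)) (e * 2) (mulr_ge0 e0 (ler0n _ 2)).
- by move=> p pp _; exact: Fpow.
- have [_ h] := zeta_factor_bounds l2 pp.
  by rewrite normrM (ger0_norm e0) -mulrA; apply: ler_wpM2l.
(* The implication leaves the value free outside [low_order q], so that [sval (Tb b)] is defined for
   every [b] and can be summed. *)
have Tb (b : Uq) : {T : R | b \in low_order q ->
    \sum_(0 <= p < N | prime p && (p%:R == val b :> Zq)) low_log b p @[N --> \oo] --> T /\
    prime_prod (fun p => p%:R == val b :> Zq)
        (fun p => F #[b]%g p `^ (- (phi / #[b]%g%:R)) * F l p `^ e) = expR T}.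
  apply: cid; have [bl|_] := boolP (b \in low_order q); last by exists 0.
  have b2 : (2 <= #[b]%g)%N by move: bl; rewrite inE order_gt1 => /andP[].
  have f0 : 0 <= phi / #[b]%g%:R by rewrite divr_ge0.
  have B0 : 0 <= phi / #[b]%g%:R * 2 + e * 2 by rewrite addr_ge0 // mulr_ge0.
  have [|p pp _|T h1 h2] := @prime_prod_expR (fun p => p%:R == val b :> Zq)
    (fun p => F #[b]%g p `^ (- (phi / #[b]%g%:R)) * F l p `^ e) (low_log b) _ B0.
  - by move=> p pp _; rewrite !Fpow // -expRD.
  - rewrite /low_log; have [_ hb] := zeta_factor_bounds b2 pp; have [_ hl] := zeta_factor_bounds l2 pp.
    apply: le_trans (ler_normD _ _) _; rewrite mulrDl; apply: lerD.
      by rewrite normrM normrN (ger0_norm f0) -mulrA; apply: ler_wpM2l.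
    by rewrite normrM (ger0_norm e0) -mulrA; apply: ler_wpM2l.
  - by exists T.
rewrite (eq_bigr (fun b => expR (sval (Tb b)))); last first.
  by move=> b bl; exact: (svalP (Tb b) bl).2.
have -> : \prod_(p <- primes q) F l p `^ e = expR (\sum_(p <- primes q) e * ln (F l p)).
  rewrite expR_sum big_seq [RHS]big_seq; apply: eq_bigr => p.
  by rewrite mem_primes => /and3P[pp _ _]; exact: Fpow.
have -> : zeta R l `^ e = expR (e * ln (zeta R l)) by rewrite /powR gt_eqF.
rewrite -expR_sum -!expRD; congr expR.
apply: (cvg_unique (@Rhausdorff R) HS).
have C1 := cvgMl_tmp (a := - e) zcvg; have C2 := @sum_primes_dvd (fun p => e * ln (F l p)).
have C3 := @cvg_big R Uq +%R 0 (fun b => b \in low_order q) (@add_continuous R) nat \oo (index_enum _)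
  (fun b N => \sum_(0 <= p < N | prime p && (p%:R == val b :> Zq)) low_log b p) (fun b => sval (Tb b)) _
  (fun b bl => (svalP (Tb b) bl).1).
have -> : e * ln (zeta R l) + \sum_(p <- primes q) e * ln (F l p) + T1 +
    \sum_(b in low_order q) sval (Tb b) =
  - e * - ln (zeta R l) + \sum_(p <- primes q) e * ln (F l p) + T1 + \sum_(b in low_order q) sval (Tb b).
  by rewrite mulrNN.
apply: cvg_trans (cvgD (cvgD (cvgD (C1 _) C2) T1c) (C3 _)); apply: near_eq_cvg; near=> N.
pose cond (Q : pred nat) (h : nat -> R) := \sum_(0 <= p < N | prime p && Q p) h p.
have condE Q h : cond Q h = \sum_(0 <= p < N | prime p) (if Q p then h p else 0).
  by rewrite /cond big_mkcondr.
rewrite !fctE /= mulr_sumr -![\sum_(0 <= p < N | prime p && _) _]/(cond _ _) !condE.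
rewrite (eq_bigr (fun b => \sum_(0 <= p < N | prime p) (if p%:R == val b :> Zq then low_log b p else 0))); last first.
  by move=> b _; exact: (condE (fun p => p%:R == val b :> Zq)).
rewrite exchange_big /= -!big_split /= [RHS](bigID prime) /= [X in _ + X]big1 ?addr0; last first.
  by move=> p np; rewrite /excess_log0 (negbTE np).
by apply: eq_bigr => p pp; rewrite excess_log0E // mulNr.
Unshelve. all: by end_near. Qed.

End FinalProducts.

Local Open Scope complex_scope.

Theorem theorem1 (R : realType) (q : nat) (hq : (3 <= q)%N) :
  let l := carmichael q in
  let e : R := (totient q)%:R / l%:R in
  let F (t p : nat) : R := 1 - (p%:R ^+ t)^-1 in
  (mertens_c R (1 : 'Z_q))%:C =
    (zeta R l `^ e)%:C
    * Pi1 R q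
    * (\prod_(p <- primes q) F l p `^ e)%:C
    * (prime_prod (fun p => p%:R == 1 :> 'Z_q) (fun p => F l p `^ e))%:C
    * (\prod_(b in low_order q)
         prime_prod (fun p => p%:R == val b :> 'Z_q)
           (fun p => F #[b]%g p `^ (- ((totient q)%:R / #[b]%g%:R))
                     * F l p `^ e))%:C
  :> Cplx R.
Proof.
move=> l e F; have [S HS HE] := mertens_c_Pi1 R (ltnW hq).
apply: (etrans HE); rewrite (expR_excess hq HS) !rCM.
rewrite [LHS]mulrC; do 2![rewrite mulrA; congr (_ * _)]; rewrite mulrA.
by congr (_ * _); exact: mulrC.
Qed.
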